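(* Let $\mathcal H$ be a complex separable infinite-dimensional Hilbert space, $T\in GL(\mathcal H)$ and $f_0\in\mathcal H$. Then the following statements are equivalent: (i) The system $(T^nf_0)_{n\in\mathbb Z}$ is a frame for $\mathcal H$. (ii) $(T,f_0)\cong(M_\sigma,1_\sigma)$ for some Borel set $\sigma\subset\mathbb T$ with $|\sigma|>0$. In case these equivalent conditions are satisfied, the Borel set $\sigma$ in (ii) is unique, and the frame $(T^nf_0)_{n\in\mathbb Z}$ is a Riesz basis for $\mathcal H$ if and only if $\sigma=\mathbb T$. Here Borel sets whose symmetric difference has arc length measure zero are identified.
   Context: For Hilbert spaces, $L(\mathcal H_1,\mathcal H_2)$ is the set of bounded linear operators from $\mathcal H_1$ to $\mathcal H_2$, $GL(\mathcal H_1,\mathcal H_2)$ the set of bijective ones, $L(\mathcal H)=L(\mathcal H,\mathcal H)$, $GL(\mathcal H)=GL(\mathcal H,\mathcal H)$. A system $(f_n)_{n\in I}$ is a frame for $\mathcal H$ if there are $A,B>0$ with $A\|f\|^2\le\sum_{n\in I}|\langle f,f_n\rangle|^2\le B\|f\|^2$ for all $f\in\mathcal H$. Similarity: for $T_j\in L(\mathcal H_j)$, $f_j\in\mathcal H_j$, $j=1,2$, write $(T_1,f_1)\cong(T_2,f_2)$ if there is $V\in GL(\mathcal H_1,\mathcal H_2)$ with $T_2=VT_1V^{-1}$ and $f_2=Vf_1$. $\mathbb T$ is the unit circle with normalized arc length measure $|\cdot|$ ($|\mathbb T|=1$). For a Borel set $\sigma\subset\mathbb T$, $L^2(\sigma)$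 is taken with respect to this measure, $M_\sigma:L^2(\sigma)\to L^2(\sigma)$ is $(M_\sigma g)(z)=zg(z)$, and $1_\sigma\in L^2(\sigma)$ is the constant function $1$. *)

(* Defs.v *)
From HB Require Import structures.
From mathcomp Require Import all_boot all_order all_algebra sesquilinear.
From mathcomp Require Import all_classical all_reals all_analysis.
From mathcomp Require Import measurable_realfun complex ring lra.

Set Implicit Arguments.
Unset Strict Implicit.
Unset Printing Implicit Defensive.

Import Order.TTheory GRing.Theory Num.Theory numFieldNormedType.Exports.

Local Open Scope classical_set_scope.
Local Open Scope ring_scope.

(* The norm of a normed space over R[i] takes its values in R[i]; [rnorm] is
   the same norm, seen as an element of R. *)
Definition rnorm (R : rcfType) (V : normedZmodType R[i]) (x : V) : R :=
  complex.Re `|x|.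

Section rnorm_theory.
Variable R : rcfType.

Lemma rnormE (V : normedZmodType R[i]) (x : V) : (rnorm x)%:C%C = `|x|.
Proof.
rewrite /rnorm; have : 0 <= `|x| by [].
by case: (`|x|) => a b; rewrite lecE /= => /andP[/eqP -> _].
Qed.

Lemma rnorm_ge0 (V : normedZmodType R[i]) (x : V) : 0 <= rnorm x.
Proof. by rewrite -lecR rnormE normr_ge0. Qed.

Lemma rnorm2E (z : R[i]) :
  rnorm z ^+ 2 = complex.Re z ^+ 2 + complex.Im z ^+ 2.
Proof.
by case: z => a b; rewrite /rnorm normc_def /= sqr_sqrtr // addr_ge0 ?sqr_ge0.
Qed.

End rnorm_theory.

(* Inner products are linear in the first argument. *)
HB.mixin Record NormedModule_hasInner (R : realType) H
    of NormedModule R[i] H := {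
  inner : {dot H for (@Num.conj_op R[i])};
  normr_inner : forall x : H, `|x| ^+ 2 = inner x x
}.

#[short(type="innerProductType")]
HB.structure Definition InnerProduct (R : realType) :=
  {H of NormedModule R[i] H & NormedModule_hasInner R H}.

#[short(type="hilbertType")]
HB.structure Definition Hilbert (R : realType) :=
  {H of CompleteNormedModule R[i] H & NormedModule_hasInner R H}.

HB.mixin Record isBoundedOperator (K : numFieldType) (V W : normedModType K)
    (f : V -> W) := {
  bounded_operatorP : exists M : K, forall x, `|f x| <= M * `|x|
}.

#[short(type="boundedOperator")]
HB.structure Definition BoundedOperator (K : numFieldType)
    (V W : normedModType K) :=
  {f of @GRing.Linear K V W *:%R f & isBoundedOperator K V W f}.

Section complex_integral.
Context d (T : measurableType d) (R : realType).
Variables (mu : {measure set T -> \bar R}) (D : set T).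
Implicit Types f g : T -> R[i].

Definition cmeasurable_fun f :=
  measurable_fun D (fun x => complex.Re (f x)) /\ measurable_fun D (fun x => complex.Im (f x)).

Definition cintegrable f :=
  mu.-integrable D (fun x => (complex.Re (f x))%:E) /\
  mu.-integrable D (fun x => (complex.Im (f x))%:E).

Definition cintegral f : R[i] :=
  ((\int[mu]_(x in D) complex.Re (f x)) +i*
   (\int[mu]_(x in D) complex.Im (f x)))%C.

Hypothesis mD : measurable D.

Lemma cintegralD f g : cintegrable f -> cintegrable g ->
  cintegral (f \+ g) = cintegral f + cintegral g.
Proof.
move=> [fr fi] [gr gi]; rewrite /cintegral.
apply/eqP; rewrite eq_complex /= -!RintegralD//.
by apply/andP; split; apply/eqP; apply: eq_Rintegral => x _ /=; case: (f x); case: (g x).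
Qed.

Lemma cintegralZ (a : R[i]) f : cintegrable f ->
  cintegral (fun x => a * f x) = a * cintegral f.
Proof.
have iZ (c : R) (h : T -> R) : mu.-integrable D (EFin \o h) ->
  mu.-integrable D (EFin \o (fun x => c * h x)).
  by move=> ih; have := integrableZl mD c ih; apply: eq_integrable.
move=> [fr fi]; case: a => a b; rewrite /cintegral.
apply/eqP; rewrite eq_complex /=.
rewrite -!RintegralZl//.
rewrite -RintegralB//; [|exact: iZ|exact: iZ].
rewrite -RintegralD//; [|exact: iZ|exact: iZ].
by apply/andP; split; apply/eqP; apply: eq_Rintegral => x _ /=; case: (f x).
Qed.

Lemma cintegral_conj f : cintegrable f ->
  cintegral (fun x => (f x)^*) = (cintegral f)^*.
Proof.
move=> [fr fi]; rewrite /cintegral.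
apply/eqP; rewrite eq_complex /= -[X in _ && (_ == X)]mulN1r -RintegralZl//.
by apply/andP; split; apply/eqP; apply: eq_Rintegral => x _ /=; case: (f x) => // a b;
  rewrite mulN1r.
Qed.

End complex_integral.

Section L2fun.
Context d (T : measurableType d) (R : realType).
Variables (mu : {measure set T -> \bar R}) (D : set T) (mD : measurable D).
Implicit Types f g : T -> R[i].

Definition square_integrable f :=
  cmeasurable_fun D f /\ (\int[mu]_(x in D) (rnorm (f x) ^+ 2)%:E < +oo)%E.

Lemma square_integrableP f : square_integrable f <->
  cmeasurable_fun D f /\
  mu.-integrable D (fun x => (rnorm (f x) ^+ 2)%:E).
Proof.
have fE : (\int[mu]_(x in D) `|(rnorm (f x) ^+ 2)%:E| =
           \int[mu]_(x in D) (rnorm (f x) ^+ 2)%:E)%E.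
  by apply: eq_integral => x _; rewrite gee0_abs// lee_fin sqr_ge0.
split=> [] [mf fi]; split => //; last first.
  by have /integrableP[_] := fi; rewrite fE.
apply/integrableP; split; last by rewrite fE.
apply/measurable_EFinP.
rewrite (_ : (fun x => _) = (fun x => complex.Re (f x) ^+ 2 + complex.Im (f x) ^+ 2)).
  by case: mf => mr mi; apply: measurable_funD; exact: measurable_funX.
by apply/funext => x; rewrite rnorm2E.
Qed.

Lemma square_integrable_cst (c : R[i]) : (mu D < +oo)%E ->
  square_integrable (cst c).
Proof.
move=> muD; split; first by split; exact: measurable_cst.
rewrite (@integral_cst _ _ _ mu D mD (rnorm c ^+ 2)%:E); apply: lte_mul_pinfty => //.
by rewrite lee_fin sqr_ge0.
Qed.

Lemma cmeasurable_funM f g : cmeasurable_fun D f -> cmeasurable_fun D g ->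
  cmeasurable_fun D (fun x => f x * g x).
Proof.
move=> [fr fi] [gr gi]; split.
  rewrite (_ : (fun x => _) = (fun x => complex.Re (f x) * complex.Re (g x)
    - complex.Im (f x) * complex.Im (g x))).
    by apply: measurable_funB; exact: measurable_funM.
  by apply/funext => x; case: (f x) => a b; case: (g x).
rewrite (_ : (fun x => _) = (fun x => complex.Re (f x) * complex.Im (g x)
    + complex.Im (f x) * complex.Re (g x))).
  by apply: measurable_funD; exact: measurable_funM.
by apply/funext => x; case: (f x) => a b; case: (g x).
Qed.

Lemma cmeasurable_fun_conj f : cmeasurable_fun D f ->
  cmeasurable_fun D (fun x => (f x)^*).
Proof.
move=> [fr fi]; split.
  by rewrite (_ : (fun x => _) = (fun x => complex.Re (f x)))//;
    apply/funext => x; case: (f x).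
rewrite (_ : (fun x => _) = (fun x => - complex.Im (f x))).
  exact: measurableT_comp.
by apply/funext => x; case: (f x).
Qed.

Lemma cmeasurable_funD f g : cmeasurable_fun D f -> cmeasurable_fun D g ->
  cmeasurable_fun D (fun x => f x + g x).
Proof.
move=> [fr fi] [gr gi]; split.
  rewrite (_ : (fun x => _) = (fun x => complex.Re (f x) + complex.Re (g x))).
    exact: measurable_funD.
  by apply/funext => x; case: (f x) => a b; case: (g x).
rewrite (_ : (fun x => _) = (fun x => complex.Im (f x) + complex.Im (g x))).
  exact: measurable_funD.
by apply/funext => x; case: (f x) => a b; case: (g x).
Qed.

Lemma square_integrable_dom f (h : T -> R) : cmeasurable_fun D f ->
  mu.-integrable D (EFin \o h) ->
  (forall x, D x -> rnorm (f x) ^+ 2 <= h x) -> square_integrable f.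
Proof.
move=> [mr mi] ih fh; apply/square_integrableP; split=> //.
apply: (le_integrable mD _ _ ih).
  apply/measurable_EFinP.
  rewrite (_ : (fun x => _) =
      (fun x => complex.Re (f x) ^+ 2 + complex.Im (f x) ^+ 2)).
    by apply: measurable_funD; exact: measurable_funX.
  by apply/funext => x; rewrite rnorm2E.
move=> x Dx /=; rewrite lee_fin ger0_norm ?sqr_ge0//.
by rewrite (le_trans (fh _ Dx))// ler_norm.
Qed.

Lemma square_integrableD f g : square_integrable f -> square_integrable g ->
  square_integrable (fun x => f x + g x).
Proof.
move=> /square_integrableP[mf fi] /square_integrableP[mg gi].
apply: (@square_integrable_dom _
  (fun x => 2 * (rnorm (f x) ^+ 2) + 2 * (rnorm (g x) ^+ 2))).
- exact: cmeasurable_funD.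
- by have := integrableD mD (integrableZl mD 2 fi) (integrableZl mD 2 gi);
    apply: eq_integrable.
- move=> x _; rewrite !rnorm2E.
  case: (f x) => a b; case: (g x) => a' b' /=.
  rewrite -subr_ge0.
  rewrite (_ : _ - _ = (a - a') ^+ 2 + (b - b') ^+ 2).
    by rewrite addr_ge0 ?sqr_ge0.
  by ring.
Qed.

Lemma square_integrableM_bounded f g (M : R) : cmeasurable_fun D g ->
  (forall x, D x -> rnorm (g x) <= M) -> square_integrable f ->
  square_integrable (fun x => g x * f x).
Proof.
move=> mg gM /square_integrableP[mf fi].
apply: (@square_integrable_dom _ (fun x => M ^+ 2 * (rnorm (f x) ^+ 2))).
- exact: cmeasurable_funM.
- by have := integrableZl mD (M ^+ 2) fi; apply: eq_integrable.
- move=> x Dx.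
  have -> : rnorm (g x * f x) = rnorm (g x) * rnorm (f x).
    by apply: complexI; rewrite rmorphM /= !rnormE normrM.
  rewrite exprMn ler_wpM2r ?sqr_ge0//.
  have M0 : 0 <= M by rewrite (le_trans (rnorm_ge0 (g x)))// gM.
  by rewrite lerXn2r ?nnegrE ?rnorm_ge0// gM.
Qed.

Lemma square_integrableZ (a : R[i]) f : square_integrable f ->
  square_integrable (fun x => a * f x).
Proof.
by apply: (@square_integrableM_bounded f (cst a) (rnorm a)) => //; split.
Qed.

Lemma cintegrableM_conj f g : square_integrable f -> square_integrable g ->
  cintegrable mu D (fun x => f x * (g x)^*).
Proof.
move=> /square_integrableP[mf fi] /square_integrableP[mg gi].
have [mr mi] := cmeasurable_funM mf (cmeasurable_fun_conj mg).
have fgi := integrableD mD fi gi.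
split; apply: (le_integrable mD _ _ fgi).
- exact/measurable_EFinP.
- move=> x _ /=; rewrite lee_fin [leRHS]ger0_norm ?addr_ge0 ?sqr_ge0//.
  rewrite !rnorm2E; case: (f x) => a b; case: (g x) => a' b' /=.
  rewrite ler_norml.
  have := sqr_ge0 (a + a'); have := sqr_ge0 (a - a').
  have := sqr_ge0 (b + b'); have := sqr_ge0 (b - b').
  have := sqr_ge0 a; have := sqr_ge0 b.
  have := sqr_ge0 a'; have := sqr_ge0 b'.
  by move=> *; apply/andP; split; lra.
- exact/measurable_EFinP.
- move=> x _ /=; rewrite lee_fin [leRHS]ger0_norm ?addr_ge0 ?sqr_ge0//.
  rewrite !rnorm2E; case: (f x) => a b; case: (g x) => a' b' /=.
  rewrite ler_norml.
  have := sqr_ge0 (a + b'); have := sqr_ge0 (a - b').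
  have := sqr_ge0 (b + a'); have := sqr_ge0 (b - a').
  have := sqr_ge0 a; have := sqr_ge0 b.
  have := sqr_ge0 a'; have := sqr_ge0 b'.
  by move=> *; apply/andP; split; lra.
Qed.

End L2fun.

Section L2_type.
Context d (T : measurableType d) (R : realType).
Variables (mu : {measure set T -> \bar R}) (D : set T).

Definition sqint (mD : measurable D) : {pred T -> R[i]} :=
  fun f => `[< square_integrable mu D f >].

Variable mD : measurable D.

Lemma sqint_submod_closed : submod_closed (sqint mD).
Proof.
split=> [|a f g].
  apply/asboolP; split; first by split; exact: measurable_cst.
  rewrite (eq_integral (cst 0%E)) ?integral0// => x _.
  by rewrite rnorm2E /= expr0n /= addr0.
move=> /asboolP fi /asboolP gi; apply/asboolP.
have := square_integrableD mD (square_integrableZ mD a fi) gi; exact.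
Qed.

HB.instance Definition _ :=
  GRing.isSubmodClosed.Build _ _ (sqint mD) sqint_submod_closed.

Record L2fun := MkL2fun {
  l2val :> T -> R[i];
  l2valP : l2val \in sqint mD
}.

HB.instance Definition _ := [isSub for l2val].
HB.instance Definition _ := [Choice of L2fun by <:].
HB.instance Definition _ := [SubChoice_isSubLmodule of L2fun by <:].

Lemma L2funP (f : L2fun) : square_integrable mu D f.
Proof. by apply/asboolP; exact: l2valP. Qed.

Definition null_L2fun : {pred L2fun} :=
  fun f => `[< l2val f = cst 0 %[ae mu in D] >].

Lemma null_L2fun_zmod_closed : zmod_closed null_L2fun.
Proof.
split=> [|f g /asboolP f0 /asboolP g0]; apply/asboolP; first exact: aeW.
have -> : l2val (f - g) = l2val f - l2val g by exact: (raddfB val).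
apply: filterS2 f0 g0 => x f0 g0 Dx.
by rewrite -[LHS]/(l2val f x - l2val g x) f0// g0// subr0.
Qed.

HB.instance Definition _ :=
  GRing.isZmodClosed.Build _ null_L2fun null_L2fun_zmod_closed.

(* L^2(D): functions are defined on all of T, but only their values on D
   matter, up to equality almost everywhere on D. *)
Definition L2 : Type := Quotient.quot null_L2fun.

End L2_type.

Section L2_space.
Context d (T : measurableType d) (R : realType).
Variables (mu : {measure set T -> \bar R}) (D : set T) (mD : measurable D).
Local Notation L2fun := (L2fun mu mD).
Local Notation L2 := (L2 mu mD).
Local Open Scope quotient_scope.

HB.instance Definition _ := GRing.Zmodule.on L2.
HB.instance Definition _ := EqQuotient.on L2.

Definition L2class (f : L2fun) : L2 := \pi_(L2) f.

Lemma L2class_zmod_morphism : zmod_morphism L2class.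
Proof. by move=> f g; rewrite /L2class raddfB. Qed.

HB.instance Definition _ :=
  GRing.isZmodMorphism.Build _ _ L2class L2class_zmod_morphism.

Lemma L2class_repr (u : L2) : L2class (repr u) = u.
Proof. exact: reprK. Qed.

Lemma L2classP (f g : L2fun) :
  L2class f = L2class g <-> l2val f = l2val g %[ae mu in D].
Proof.
have subE : l2val (f - g) = l2val f - l2val g by exact: (raddfB val).
split=> [/eqP|fg].
  rewrite /L2class -Quotient.idealrBE => /asboolP; apply: filterS => x h Dx.
  have := h Dx; rewrite subE.
  by rewrite -[X in X = _]/(l2val f x - l2val g x) => /eqP; rewrite subr_eq0 => /eqP.
apply/eqP; rewrite /L2class -Quotient.idealrBE; apply/asboolP.
apply: filterS fg => x fg Dx; rewrite subE.
by rewrite -[LHS]/(l2val f x - l2val g x) fg// subrr.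
Qed.

Lemma l2valZ (a : R[i]) (f : L2fun) x : l2val (a *: f) x = a * l2val f x.
Proof. by rewrite (_ : l2val (a *: f) = a *: l2val f)//; exact: (linearZ_LR val). Qed.

Lemma l2valD (f g : L2fun) x : l2val (f + g) x = l2val f x + l2val g x.
Proof. by rewrite (_ : l2val (f + g) = l2val f + l2val g)//; exact: (raddfD val). Qed.

Lemma L2fun_ext (f g : L2fun) : (forall x, l2val f x = l2val g x) -> f = g.
Proof. by move=> fg; apply/val_inj/funext. Qed.

Definition L2scale (a : R[i]) (u : L2) : L2 := L2class (a *: repr u).

Lemma L2scaleE a f : L2scale a (L2class f) = L2class (a *: f).
Proof.
apply/L2classP; have /L2classP := L2class_repr (L2class f).
by apply: filterS => x fE Dx; rewrite !l2valZ fE.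
Qed.

Lemma L2scaleA a b u : L2scale a (L2scale b u) = L2scale (a * b) u.
Proof. by rewrite -(L2class_repr u) !L2scaleE scalerA. Qed.

Lemma L2scale1 : left_id 1 L2scale.
Proof. by move=> u; rewrite -(L2class_repr u) !L2scaleE scale1r. Qed.

Lemma L2scaleDr : right_distributive L2scale +%R.
Proof.
move=> a u v; rewrite -(L2class_repr u) -(L2class_repr v).
by rewrite -raddfD !L2scaleE scalerDr raddfD.
Qed.

Lemma L2scaleDl u : {morph L2scale^~ u : a b / a + b}.
Proof.
by move=> a b; rewrite -(L2class_repr u) !L2scaleE scalerDl raddfD.
Qed.

HB.instance Definition _ := GRing.Zmodule_isLmodule.Build R[i] L2
  L2scaleA L2scale1 L2scaleDr L2scaleDl.

Lemma L2class_scalable : scalable L2class.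
Proof. by move=> a f; rewrite -L2scaleE. Qed.

HB.instance Definition _ :=
  GRing.isScalable.Build R[i] L2fun L2 *:%R L2class L2class_scalable.

Definition L2inner (u v : L2) : R[i] :=
  cintegral mu D (fun x => repr u x * (repr v x)^*).

Lemma L2innerE f g : L2inner (L2class f) (L2class g) =
  cintegral mu D (fun x => l2val f x * (l2val g x)^*).
Proof.
rewrite /L2inner.
set f' := repr _; set g' := repr _.
have /L2classP ff : L2class f' = L2class f by rewrite L2class_repr.
have /L2classP gg : L2class g' = L2class g by rewrite L2class_repr.
have [/integrableP[r1 _] /integrableP[i1 _]] := cintegrableM_conj mD (L2funP f') (L2funP g').
have [/integrableP[r2 _] /integrableP[i2 _]] := cintegrableM_conj mD (L2funP f) (L2funP g).
rewrite /cintegral /Rintegral; congr (fine _ +i* fine _)%C.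
  apply: ae_eq_integral => //.
  by apply: filterS2 ff gg => x ff gg Dx; rewrite ff// gg.
apply: ae_eq_integral => //.
by apply: filterS2 ff gg => x ff gg Dx; rewrite ff// gg.
Qed.

Lemma L2inner_linearl v : linear_for *%R (L2inner ^~ v).
Proof.
move=> a u w; rewrite -(L2class_repr u) -(L2class_repr v) -(L2class_repr w).
rewrite -linearP !L2innerE.
rewrite -cintegralZ//; last exact: (cintegrableM_conj mD (L2funP _) (L2funP _)).
rewrite -cintegralD//.
- congr cintegral; apply/funext => x.
  by rewrite l2valD l2valZ mulrDl -mulrA.
- have := cintegrableM_conj mD (L2funP (a *: repr u)) (L2funP (repr v)).
  by under eq_fun do rewrite l2valZ -mulrA.
- exact: (cintegrableM_conj mD (L2funP _) (L2funP _)).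
Qed.

Lemma L2innerC u v : L2inner u v = (L2inner v u)^*.
Proof.
rewrite /L2inner -cintegral_conj//.
  congr cintegral; apply/funext => x.
  by rewrite rmorphM /= conjCK mulrC.
exact: (cintegrableM_conj mD (L2funP _) (L2funP _)).
Qed.

Lemma L2inner_linearr u : linear_for (Num.conj_op \; *%R) (L2inner u).
Proof.
move=> a v w; rewrite L2innerC (L2inner_linearl u) rmorphD rmorphM /=.
by rewrite -!L2innerC.
Qed.

HB.instance Definition _ := bilinear_isBilinear.Build R[i] L2 L2 R[i]
  *%R (Num.conj_op \; *%R) L2inner (conj L2inner_linearl L2inner_linearr).

Lemma L2inner_hermitian u v :
  L2inner u v = (-1) ^+ false * Num.conj_op (L2inner v u).
Proof. by rewrite expr0 mul1r -L2innerC. Qed.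

HB.instance Definition _ := isHermitianSesquilinear.Build R[i] L2 false
  Num.conj_op L2inner L2inner_hermitian.

Lemma L2inner_normE f : L2inner (L2class f) (L2class f) =
  (\int[mu]_(x in D) (rnorm (l2val f x) ^+ 2))%:C%C.
Proof.
rewrite L2innerE /cintegral; apply/eqP; rewrite eq_complex /=.
apply/andP; split; apply/eqP.
  by apply: eq_Rintegral => x _ /=; rewrite rnorm2E; case: (l2val f x) => a b /=; ring.
transitivity (\int[mu]_(x in D) (0 : R)); last by rewrite Rintegral_cst// mul0r.
by apply: eq_Rintegral => x _ /=; case: (l2val f x) => a b /=; ring.
Qed.

Lemma L2inner_gt0 u : u != 0 -> 0 < L2inner u u.
Proof.
move=> u0; rewrite -(L2class_repr u) L2inner_normE.
set f := repr u; rewrite ltcR lt_neqAle Rintegral_ge0 ?andbT => [|x _]; last first.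
  by rewrite sqr_ge0.
apply: contra u0 => /eqP/esym f0; apply/eqP.
rewrite -(L2class_repr u) -(raddf0 L2class); apply/L2classP.
have /square_integrableP[_ fi] := L2funP f.
have /integrableP[mf _] := fi.
have [h _] := ae_eq_integral_abs mu mD mf.
have : (\int[mu]_(x in D) `|(rnorm (f x) ^+ 2)%:E| = 0)%E.
  transitivity (\int[mu]_(x in D) (rnorm (f x) ^+ 2)%:E)%E.
    by apply: eq_integral => x _; rewrite gee0_abs// lee_fin sqr_ge0.
  rewrite -[LHS]fineK; last exact: integrable_fin_num.
  by rewrite -[fine _]/(\int[mu]_(x in D) (rnorm (f x) ^+ 2)) f0.
move=> /h; apply: filterS => x fx Dx.
have /eqP := fx Dx; rewrite eqe sqrf_eq0 => /eqP fx0.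
rewrite (_ : l2val (0 : L2fun) x = 0); last first.
  by have /(congr1 (@^~ x)) := raddf0 (val : L2fun -> (T -> R[i])).
by apply/eqP; rewrite -normr_eq0 -rnormE fx0.
Qed.

HB.instance Definition _ := isDotProduct.Build R[i] L2 L2inner L2inner_gt0.

End L2_space.

Section dot_triangle.
Variables (C : numClosedFieldType) (U : lmodType C).
Variable form : {dot U for (@Num.conj_op C)}.
Local Notation "''[' u , v ]" := (form u v) : ring_scope.
Local Notation "''[' u ]" := '[u, u] : ring_scope.

Lemma dot_CauchySchwarz u v : `|'[u, v]| ^+ 2 <= '[u] * '[v].
Proof.
have [->|v0] := eqVneq v 0; first by rewrite !raddf0 normr0 expr0n /= mulr0.
have vv : 0 < '[v] by rewrite neq0_dnorm_gt0.
pose a := '[u, v] / '[v].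
have ou : '[u - a *: v, v] = 0.
  by rewrite linearBl/= linearZl_LR/= divfK ?gt_eqF// subrr.
have : 0 <= '[u - a *: v] by exact: dnorm_ge0.
have -> : '[u - a *: v] = '[u] - a * '[v, u].
  have -> : '[u - a *: v] = '[u - a *: v, u] - a^* * '[u - a *: v, v].
    by rewrite [LHS]linearBr/= linearZr_LR.
  by rewrite ou mulr0 subr0 linearBl/= linearZl_LR.
rewrite subr_ge0 -(ler_pM2r vv) mulrAC divfK ?gt_eqF//.
have -> // : '[v, u] = '[u, v]^* by rewrite [LHS]hermC expr0 mul1r.
by rewrite -normCK.
Qed.

Lemma dot_triangle u v : sqrtC '[u + v] <= sqrtC '[u] + sqrtC '[v].
Proof.
have s0 w : 0 <= sqrtC '[w] by rewrite sqrtC_ge0 dnorm_ge0.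
rewrite -ler_sqr ?nnegrE ?addr_ge0// sqrrD !sqrtCK dnormD [leRHS]addrAC lerD2l.
have CS : `|'[u, v]| <= sqrtC '[u] * sqrtC '[v].
  rewrite -ler_sqr ?nnegrE ?mulr_ge0// exprMn !sqrtCK.
  exact: dot_CauchySchwarz.
have Rd : 'Re '[u, v] <= sqrtC '[u] * sqrtC '[v].
  exact: le_trans (leif_Re_Creal _).1 CS.
have -> : '[u, v] + '[u, v]^* = 'Re '[u, v] *+ 2.
  by rewrite ReE -mulr_natr divfK ?pnatr_eq0.
by rewrite lerMn2r.
Qed.

End dot_triangle.
Section L2_normed.
Context d (T : measurableType d) (R : realType).
Variables (mu : {measure set T -> \bar R}) (D : set T) (mD : measurable D).
Local Notation L2 := (L2 mu mD).

Definition L2norm (u : L2) : R[i] := sqrtC (L2inner u u).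

Lemma ler_L2normD u v : L2norm (u + v) <= L2norm u + L2norm v.
Proof. exact: dot_triangle. Qed.

Lemma L2normZ a u : L2norm (a *: u) = `|a| * L2norm u.
Proof.
rewrite /L2norm dnormZ sqrtCM ?nnegrE ?exprn_ge0 ?dnorm_ge0//.
by rewrite sqrCK.
Qed.

Lemma L2norm_eq0 u : L2norm u = 0 -> u = 0.
Proof. by move=> /eqP; rewrite sqrt_dnorm_eq0 => /eqP. Qed.

HB.instance Definition _ :=
  Lmodule_isNormed.Build R[i] L2 ler_L2normD L2normZ L2norm_eq0.

Lemma L2norm_inner (u : L2) : `|u| ^+ 2 = L2inner u u.
Proof. exact: sqrtCK. Qed.

HB.instance Definition _ := NormedModule_hasInner.Build R L2 L2norm_inner.

End L2_normed.

Section circle.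
Variable R : realType.

Definition circle : Type := [set z : R[i]^o | `|z| = 1].

HB.instance Definition _ := Topological.on circle.

Lemma circle1_subproof : (1 : R[i]^o) \in [set z : R[i]^o | `|z| = 1].
Proof. by rewrite inE /= normr1. Qed.

HB.instance Definition _ := isPointed.Build circle (SigSub circle1_subproof).

Definition borel_circle := g_sigma_algebraType (@open circle).

HB.instance Definition _ := Measurable.on borel_circle.

Definition circle_val (z : borel_circle) : R[i] := \val (z : circle).

Lemma norm_circle_val z : `|circle_val z| = 1.
Proof. by have := set_valP (z : circle). Qed.

Definition cis (t : R) : R[i] := (cos t +i* sin t)%C.

Lemma cis_subproof t : (cis t : R[i]^o) \in [set z : R[i]^o | `|z| = 1].
Proof. by rewrite inE /= normc_def /= cos2Dsin2 sqrtr1. Qed.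

Definition expi (t : measurableTypeR R) : borel_circle :=
  SigSub (cis_subproof (2 * pi * t)).

Lemma continuous_cis : continuous (cis : R -> R[i]^o).
Proof.
move=> t; apply/cvgrPdist_lt => -[e e'].
rewrite ltcE /= => /andP[/eqP -> e0] {e'}.
have e2 : 0 < e / 2 by rewrite divr_gt0.
near=> s.
have cs : `|cos t - cos s| < e / 2.
  by near: s; move/cvgrPdist_lt: (@continuous_cos R t); exact.
have ss : `|sin t - sin s| < e / 2.
  by near: s; move/cvgrPdist_lt: (@continuous_sin R t); exact.
rewrite normc_def /= ltcR (@le_lt_trans _ _ (`|cos t - cos s| + `|sin t - sin s|))//.
  rewrite -[leRHS]ger0_norm ?addr_ge0// -sqrtr_sqr ler_wsqrtr// [leRHS]sqrrD.
  rewrite !real_normK ?num_real// lerD2r lerDl.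
  by rewrite mulrn_wge0// mulr_ge0.
by rewrite [ltRHS]splitr ltrD.
Unshelve. all: by end_near. Qed.

Lemma measurable_expi : measurable_fun setT expi.
Proof.
apply: (@measurability _ _ _ (borel_circle : measurableType _) setT expi (@open circle) erefl).
move=> _ [_ [W oW <-]] <-; rewrite setTI.
apply: open_measurable.
have : open ((fun t : R => cis (2 * pi * t) : R[i]^o) @^-1` W).
  apply: open_comp => // t _.
  apply: (@continuous_comp R R R[i]^o ( *%R (2 * pi)) cis).
    exact: mulrl_continuous.
  exact: continuous_cis.
by [].
Qed.

HB.instance Definition _ := isMeasurableFun.Build _ _ _ _ expi measurable_expi.

(* Normalized arc length, transported from [0, 1[ by t |-> exp(2 pi i t). *)
Definition arc_length : set borel_circle -> \bar R :=
  pushforward (mrestr (@lebesgue_measure R) (measurable_itv `[0, 1[)) expi.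

Let arc_length0 : arc_length set0 = 0%E.
Proof. exact: measure0. Qed.

Let arc_length_ge0 A : (0 <= arc_length A)%E.
Proof. exact: measure_ge0. Qed.

Let arc_length_sigma_additive : semi_sigma_additive arc_length.
Proof. exact: measure_semi_sigma_additive. Qed.

HB.instance Definition _ := isMeasure.Build _ _ _ arc_length
  arc_length0 arc_length_ge0 arc_length_sigma_additive.

Lemma arc_lengthT : arc_length setT = 1%E.
Proof.
rewrite /arc_length /pushforward preimage_setT /mrestr setTI.
by rewrite lebesgue_measure_itv /= lte01 oppr0 addr0.
Qed.

HB.instance Definition _ := Measure_isProbability.Build _ _ _ arc_length arc_lengthT.
End circle.

Section multiplication_operator.
Variables (R : realType) (sigma : set (borel_circle R)).
Variable msigma : measurable sigma.
Local Notation mu := (@arc_length R).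

Definition L2_circle : Type := L2 mu msigma.

HB.instance Definition _ := InnerProduct.on L2_circle.

Lemma arc_length_lty (A : set (borel_circle R)) : measurable A ->
  (mu A < +oo)%E.
Proof.
move=> mA; rewrite (@le_lt_trans _ _ (mu setT))//.
  by apply: le_measure; rewrite ?inE.
by rewrite arc_lengthT ltry.
Qed.

Lemma one_sqint : (cst 1 : borel_circle R -> R[i]) \in sqint mu msigma.
Proof.
by apply/asboolP; apply: square_integrable_cst => //; exact: arc_length_lty.
Qed.

Definition one_L2 : L2_circle := L2class (MkL2fun one_sqint).

Lemma measurable_circle_continuous (f : R[i]^o -> R) :
  continuous f -> measurable_fun setT (fun z : borel_circle R => f (circle_val z)).
Proof.
move=> cf; apply: (measurability _ (RGenOpens.measurableE R)).
move=> _ [_ [a [b ->]] <-]; rewrite setTI.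
apply: sub_sigma_algebra.
exists (f @^-1` `]a, b[) => //.
by apply: open_comp => // x _; exact: cf.
Qed.

Lemma cmeasurable_circle_val : cmeasurable_fun sigma (@circle_val R).
Proof.
suff h (f : R[i]^o -> R) : (forall x y, `|f x - f y| <= rnorm (x - y : R[i])) ->
    measurable_fun sigma (fun z : borel_circle R => f (circle_val z)).
  have [r1 r2] : (forall x : R[i], `|complex.Re x| <= rnorm x) /\
                 (forall x : R[i], `|complex.Im x| <= rnorm x).
    split=> x; rewrite -(@ler_pXn2r _ 2) ?nnegrE ?rnorm_ge0// rnorm2E.
      by rewrite real_normK ?num_real// lerDl sqr_ge0.
    by rewrite real_normK ?num_real// lerDr sqr_ge0.
  split; apply: h => x y.
    by have := r1 (x - y); case: x y => a b [c e].
  by have := r2 (x - y); case: x y => a b [c e].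
move=> fl; suff cf : continuous f.
  by apply: measurable_funTS; exact: measurable_circle_continuous.
move=> x; apply/(@cvgrPdist_lt _ _ _ (nbhs (x : R[i]^o))) => e e0.
have e0' : 0 < e%:C%C by rewrite ltcR.
have : \forall y \near x, `|x - y| < e%:C%C.
  by move/cvgrPdist_lt: (@cvg_id _ (nbhs x)); exact.
by apply: filterS => y xy; rewrite (le_lt_trans (fl _ _))// -ltcR rnormE.
Qed.

Lemma mulcoord_sqint (f : L2fun mu msigma) :
  (fun z => circle_val z * f z) \in sqint mu msigma.
Proof.
apply/asboolP; apply: (square_integrableM_bounded msigma (M := 1)).
- exact: cmeasurable_circle_val.
- by move=> z _; rewrite -lecR rnormE norm_circle_val.
- exact: L2funP.
Qed.

Definition mulcoord_L2fun (f : L2fun mu msigma) : L2fun mu msigma :=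
  MkL2fun (mulcoord_sqint f).

Lemma mulcoord_L2funE f z : l2val (mulcoord_L2fun f) z = circle_val z * l2val f z.
Proof. by []. Qed.

Definition mulcoord (u : L2_circle) : L2_circle := L2class (mulcoord_L2fun (repr u)).

Lemma mulcoordE f : mulcoord (L2class f) = L2class (mulcoord_L2fun f).
Proof.
apply/L2classP; have /L2classP := L2class_repr (L2class f).
by apply: filterS => x fE Dx /=; rewrite fE.
Qed.

Lemma mulcoord_linear : linear mulcoord.
Proof.
move=> a u v; rewrite -(L2class_repr u) -(L2class_repr v).
rewrite -linearP !mulcoordE -linearP; congr L2class; apply: L2fun_ext => z.
by rewrite l2valD l2valZ !mulcoord_L2funE l2valD l2valZ mulrDr mulrCA.
Qed.

HB.instance Definition _ :=
  GRing.isLinear.Build R[i] L2_circle L2_circle *:%R mulcoord mulcoord_linear.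

Lemma norm_mulcoord u : `|mulcoord u| = `|u|.
Proof.
suff E : L2inner (mulcoord u) (mulcoord u) = L2inner u u by exact: (congr1 sqrtC E).
rewrite -(L2class_repr u) mulcoordE !L2inner_normE.
congr (_%:C)%C; apply: eq_Rintegral => z _ /=; congr (_ ^+ 2).
by apply: complexI; rewrite !rnormE normrM norm_circle_val mul1r.
Qed.

Lemma mulcoord_bounded : exists M : R[i], forall u, `|mulcoord u| <= M * `|u|.
Proof. by exists 1 => u; rewrite norm_mulcoord mul1r. Qed.

HB.instance Definition _ :=
  isBoundedOperator.Build R[i] L2_circle L2_circle mulcoord mulcoord_bounded.

End multiplication_operator.

Arguments mulcoord {R sigma} msigma u.

Section operators.
Variable R : realType.

(* Meaningful for bijective f only. *)
Definition operator_inverse (V W : normedModType R[i]) (f : V -> W) (y : W) : V :=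
  xget 0 (f @^-1` [set y]).

Lemma operator_inverseK (V W : normedModType R[i]) (f : V -> W) :
  bijective f -> cancel (operator_inverse f) f /\ cancel f (operator_inverse f).
Proof.
move=> bf; have fK : cancel (operator_inverse f) f.
  move=> y; have [g _ gK] := bf.
  by rewrite /operator_inverse; case: xgetP => [x _ //|/(_ (g y))]; case; exact: gK.
by split=> // x; apply: (bij_inj bf); rewrite fK.
Qed.

Definition similar (H1 H2 : innerProductType R)
    (T1 : boundedOperator H1 H1) (f1 : H1)
    (T2 : boundedOperator H2 H2) (f2 : H2) : Prop :=
  exists V : boundedOperator H1 H2,
    [/\ bijective V,
        forall g, T2 g = V (T1 (operator_inverse V g)) &
        f2 = V f1].

Definition operator_orbit (H : normedModType R[i]) (T : H -> H) (f0 : H)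
    (n : int) : H :=
  match n with
  | Posz k => iter k T f0
  | Negz k => iter k.+1 (operator_inverse T) f0
  end.

Definition frame (H : innerProductType R) (I : choiceType) (f : I -> H) : Prop :=
  exists A B : R, [/\ 0 < A, 0 < B & forall g : H,
    ((A * rnorm g ^+ 2)%:E <=
       \esum_(n in [set: I]) (rnorm (inner g (f n)) ^+ 2)%:E <=
     (B * rnorm g ^+ 2)%:E)%E].

Definition linear_span (H : lmodType R[i]) (A : set H) : set H :=
  [set x | exists n (c : 'I_n -> R[i]) (a : 'I_n -> H),
    (forall i, A (a i)) /\ x = \sum_(i < n) c i *: a i].

Definition separable (H : topologicalType) : Prop :=
  exists2 S : set H, countable S & dense S.

Definition infinite_dimensional (H : lmodType R[i]) : Prop :=
  forall A : set H, finite_set A -> linear_span A <> setT.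

Definition orthonormal_basis (H : innerProductType R) (I : choiceType)
    (e : I -> H) : Prop :=
  (forall m n, inner (e m) (e n) = (m == n)%:R) /\ dense (linear_span (range e)).

(* A Riesz basis is the image of an orthonormal basis under a bijective bounded
   operator. *)
Definition riesz_basis (H : innerProductType R) (I : choiceType)
    (f : I -> H) : Prop :=
  exists (e : I -> H) (U : boundedOperator H H),
    [/\ orthonormal_basis e, bijective U & forall n, f n = U (e n)].

Definition arc_eq (sigma tau : set (borel_circle R)) : Prop :=
  arc_length (sigma `+` tau) = 0%E.

(* (T, f0) is similar to (M_sigma, 1_sigma), with sigma Borel of positive
   measure. *)
Definition multiplication_model (H : innerProductType R)
    (T : boundedOperator H H) (f0 : H) (sigma : set (borel_circle R)) : Prop :=
  exists msigma : measurable sigma,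
    (0 < arc_length sigma)%E /\
    similar T f0 (mulcoord msigma) (one_L2 msigma).

End operators.

(* Main.v *)
(* Write f_n = T^n f_0.  Both conditions (i) and (ii) amount to: the f_n span a dense
   subspace, and the norm of a finite sum of c_n f_n is equivalent to the norm of the
   trigonometric polynomial of coefficients c_n in L^2(sigma).

   Given a frame, the upper bound yields a bounded synthesis operator S : L^2(circle) -> H
   sending z^n to f_n, and the lower bound makes S onto.  S intertwines multiplication by
   z and T, so N = ker S reduces multiplication by z.  Let phi be the component of 1
   orthogonal to N.  As z^n (1 - phi) lies in N for all n, all the Fourier coefficients of
   phi * conj(1 - phi) vanish, so phi is the indicator function of a set sigma, and
   similarly N consists of the functions vanishing on sigma.  Conversely, the norm
   equivalence for (ii) is the bounded inverse theorem.  Uniqueness of sigma follows by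
   approximating indicator functions by trigonometric polynomials, and a Riesz basis is
   exactly the case where the norm is equivalent to the one for sigma = the whole circle.

   An integrable function with zero Fourier coefficients is zero: the real functions g
   whose product with such functions again has zero coefficients form an algebra
   containing Re z and Im z and closed under bounded pointwise limits.  Iterating
   s |-> (3 s - s^3) / 2 shows that it contains sign(g) along with g, hence the indicators
   of discs, hence those of all Borel sets. *)

Require Import Defs.
From HB Require Import structures.
From mathcomp Require Import all_boot all_order all_algebra sesquilinear.
From mathcomp Require Import all_classical all_reals all_analysis.
From mathcomp Require Import measurable_realfun complex ring lra zify.

Set Implicit Arguments.
Unset Strict Implicit.
Unset Printing Implicit Defensive.

Import Order.TTheory GRing.Theory Num.Theory numFieldNormedType.Exports.

Local Open Scope classical_set_scope.
Local Open Scope ring_scope.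

(** * Complete normed spaces over the complex numbers *)

(** Families over the integers are read along the bijection [int_enum], and polynomials stand for
    finitely supported coefficient sequences. All operators then come from bounds on the finite sums
    [lc f p], through [extend_dense].

    The obstacle is that the characters are redundant in L^2(sigma) unless sigma is full: the norm
    there does not control the coefficients of a trigonometric polynomial, so the lower frame bound
    cannot be read off the norm equivalence. The cure is to approximate 1_sigma p on the whole
    circle, where Parseval's identity holds.

    The lower frame bound gives surjectivity by the frame algorithm: g minus B^-1 times a large
    enough finite part of the sum of <g, f_i> f_i has norm at most sqrt(1 - A/B) |g|, and iterating
    solves S u = g. Density of the characters in L^2(sigma) rests on orthogonal projection and the
    uniqueness of Fourier coefficients, not on a kernel or a Weierstrass argument. *)

Section rnorm_scalar.
Variable R : realType.
Implicit Types z w : R[i].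

Lemma Re_rnorm z : `|complex.Re z| <= rnorm z.
Proof.
rewrite -(@ler_pXn2r _ 2) ?nnegrE ?rnorm_ge0// rnorm2E.
by rewrite real_normK ?num_real// lerDl sqr_ge0.
Qed.

Lemma Im_rnorm z : `|complex.Im z| <= rnorm z.
Proof.
rewrite -(@ler_pXn2r _ 2) ?nnegrE ?rnorm_ge0// rnorm2E.
by rewrite real_normK ?num_real// lerDr sqr_ge0.
Qed.

Lemma rnormM z w : rnorm (z * w) = rnorm z * rnorm w.
Proof. by apply: complexI; rewrite rmorphM /= !rnormE normrM. Qed.

Lemma rnorm_conj z : rnorm z^* = rnorm z.
Proof. by apply: complexI; rewrite !rnormE norm_conjC. Qed.

Lemma mul_conj_rnorm z : z * z^* = (rnorm z ^+ 2)%:C%C.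
Proof. by rewrite -normCK rmorphXn /= rnormE. Qed.

Lemma conj_realC (t : R) : (t%:C%C : R[i])^* = t%:C%C.
Proof. exact: conjc_real. Qed.

End rnorm_scalar.

Section rnorm_lemmas.
Variables (R : realType) (V : normedModType R[i]).
Implicit Types x y z : V.

Lemma rnorm_leC x (c : R) : (rnorm x <= c) = (`|x| <= c%:C%C).
Proof. by rewrite -rnormE lecR. Qed.

Lemma rnorm_ltC x (c : R) : (rnorm x < c) = (`|x| < c%:C%C).
Proof. by rewrite -rnormE ltcR. Qed.

Lemma rnorm0 : rnorm (0 : V) = 0.
Proof. by rewrite /rnorm normr0. Qed.

Lemma rnorm_eq0 x : rnorm x = 0 -> x = 0.
Proof. by move=> x0; apply/eqP; rewrite -normr_eq0 -rnormE x0. Qed.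

Lemma rnormN x : rnorm (- x) = rnorm x.
Proof. by rewrite /rnorm normrN. Qed.

Lemma rnormBC x y : rnorm (x - y) = rnorm (y - x).
Proof. by rewrite -rnormN opprB. Qed.

Lemma rnormD x y : rnorm (x + y) <= rnorm x + rnorm y.
Proof. by rewrite -lecR rmorphD /= !rnormE ler_normD. Qed.

Lemma rnorm_triangle y x z : rnorm (x - z) <= rnorm (x - y) + rnorm (y - z).
Proof. by have := rnormD (x - y) (y - z); rewrite addrA subrK. Qed.

Lemma rnormZ (a : R[i]) x : rnorm (a *: x) = rnorm a * rnorm x.
Proof. by apply: complexI; rewrite rmorphM /= !rnormE normrZ. Qed.

Lemma rnormZr (a : R) x : 0 <= a -> rnorm (a%:C%C *: x) = a * rnorm x.
Proof.
move=> a0; rewrite rnormZ; congr (_ * _); apply: complexI.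
by rewrite rnormE ger0_norm// lecR.
Qed.

Lemma rnormD_le x y : rnorm x <= rnorm (x - y) + rnorm y.
Proof. by have := rnormD (x - y) y; rewrite subrK. Qed.

End rnorm_lemmas.

Section sequences.
Variable R : realType.

Definition scvg (V : normedModType R[i]) (u : nat -> V) (l : V) :=
  forall e : R, 0 < e -> exists N, forall n, (N <= n)%N -> rnorm (u n - l) < e.

Definition seq_complete (V : normedModType R[i]) := forall u : nat -> V,
  (forall e : R, 0 < e -> exists N, forall m n, (N <= m)%N -> (N <= n)%N ->
     rnorm (u m - u n) < e) -> exists l, scvg u l.

Lemma seq_complete_complete (V : completeNormedModType R[i]) : seq_complete V.
Proof.
move=> u uC; suff : cvg (u @ \oo).
  move=> /cvgrPdist_lt ul; exists (lim (u @ \oo)) => e e0.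
  have [|N _ NP] := ul e%:C%C; first by rewrite ltcR.
  by exists N => n /NP; rewrite rnormBC rnorm_ltC.
apply: cauchy_cvg; apply: cauchy_exP => -[e e'].
rewrite ltcE /= => /andP[/eqP -> e0] {e'}.
have [N NP] := uC _ e0; exists (u N), N => // n /= Nn.
by rewrite -ball_normE /= -rnorm_ltC NP.
Qed.

Lemma exp_small (q e : R) : 0 <= q < 1 -> 0 < e ->
  exists N, forall n, (N <= n)%N -> q ^+ n < e.
Proof.
move=> /andP[q0 q1] e0.
have : (fun n => q ^+ n : R) @ \oo --> (0 : R) by apply: cvg_expr; rewrite ger0_norm.
move=> /cvgrPdist_lt/(_ _ e0)[N _ NP]; exists N => n /NP.
by rewrite sub0r normrN ger0_norm// exprn_ge0.
Qed.

Lemma invS_small (e : R) : 0 < e -> exists N, forall n, (N <= n)%N -> n.+1%:R^-1 < e.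
Proof. by move=> e0; have [N _ NP] := near_infty_natSinv_lt (PosNum e0); exists N => n /NP. Qed.

Lemma le_eps (x y : R) : (forall e, 0 < e -> x <= y + e) -> x <= y.
Proof. by move=> h; apply/ler_addgt0Pr. Qed.

Lemma rnorm_eps0 (V : normedModType R[i]) (x : V) :
  (forall e : R, 0 < e -> rnorm x <= e) -> x = 0.
Proof.
move=> h; apply: rnorm_eq0; apply/eqP; rewrite eq_le rnorm_ge0 andbT.
by apply: le_eps => e /h; rewrite add0r.
Qed.

Lemma scvg_geometric (V : normedModType R[i]) (u : nat -> V) (K q : R) :
  seq_complete V -> 0 <= K -> 0 <= q < 1 ->
  (forall n, rnorm (u n.+1 - u n) <= K * q ^+ n) ->
  exists l, scvg u l /\ forall n, rnorm (l - u n) <= K * q ^+ n / (1 - q).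
Proof.
move=> cV K0 /andP[q0 q1] du.
have q1' : 0 < 1 - q by rewrite subr_gt0.
have step n k : rnorm (u (n + k)%N - u n) <= K * q ^+ n / (1 - q).
  (* The exact sum of k terms of the geometric series; the weaker bound would not pass through the
     induction. *)
  apply: (@le_trans _ _ (K * q ^+ n / (1 - q) * (1 - q ^+ k))); last first.
    rewrite ler_piMr ?gerBl ?exprn_ge0//.
    by rewrite divr_ge0 ?mulr_ge0 ?exprn_ge0// ltW.
  elim: k => [|k IH]; first by rewrite addn0 subrr rnorm0 expr0 subrr mulr0.
  apply: le_trans (rnorm_triangle (u (n + k)%N) _ _) _.
  rewrite addnS; have := lerD (du (n + k)%N) IH; move/le_trans; apply.
  rewrite exprD exprS le_eqVlt; apply/orP; left; apply/eqP.
  by field; rewrite gt_eqF.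
have Csmall e : 0 < e -> exists N, forall n, (N <= n)%N -> K * q ^+ n / (1 - q) < e.
  move=> e0; have K1 : 0 < K + 1 by rewrite ltr_wpDl.
  have [||N NP] := @exp_small q (e * (1 - q) / (K + 1)); [by rewrite q0| |].
    by rewrite divr_gt0// mulr_gt0.
  exists N => n /NP; rewrite ltr_pdivlMr// ltr_pdivrMr// => h.
  apply: le_lt_trans h; rewrite mulrC ler_wpM2l ?exprn_ge0//; lra.
have [|l ul] := cV u.
  move=> e e0; have [|N NP] := Csmall (e / 2); first by rewrite divr_gt0.
  exists N => m n Nm Nn; apply: le_lt_trans (rnorm_triangle (u N) _ _) _.
  rewrite [ltRHS]splitr ltrD//.
    by rewrite -(subnKC Nm) (le_lt_trans (step _ _))// NP.
  by rewrite rnormBC -(subnKC Nn) (le_lt_trans (step _ _))// NP.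
exists l; split=> // n; apply: le_eps => e e0; have [N NP] := ul _ e0.
apply: le_trans (rnorm_triangle (u (n + N)%N) _ _) _.
by rewrite addrC lerD ?step// rnormBC ltW// NP// leq_addl.
Qed.

End sequences.

Section operators_theory.
Variable R : realType.
Implicit Types X Y : normedModType R[i].

(** The constant of a bounded operator lives in R[i]; the inequality at a nonzero vector forces it
    to be real, and adding 1 to its modulus makes the new constant positive. *)
Lemma linear_rnorm_bound X Y (V : boundedOperator X Y) :
  exists2 M : R, 0 < M & forall x, rnorm (V x) <= M * rnorm x.
Proof.
have [M MP] := @bounded_operatorP _ _ _ V.
exists (rnorm M + 1) => [|x]; first by rewrite ltr_wpDl ?rnorm_ge0.
rewrite rnorm_leC rmorphM /= rnormE rmorphD /= rnormE (le_trans (MP x))//.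
have [->|x0] := eqVneq x 0; first by rewrite normr0 !mulr0.
have Mr : M \is Num.real.
  have : 0 <= M * `|x| by rewrite (le_trans _ (MP x)).
  by rewrite pmulr_lge0 ?normr_gt0// => /ger0_real.
by rewrite ler_wpM2r// (le_trans (real_ler_norm Mr))// lerDl.
Qed.

(* Iterating [x] on the residual gives a geometric series; this is the second half
   of the proof of the open mapping theorem. *)
Lemma approx_onto X Y (S : {linear X -> Y}) (M c q : R) :
  seq_complete X -> 0 <= c -> 0 <= q < 1 ->
  (forall x, rnorm (S x) <= M * rnorm x) ->
  (forall y, exists x, rnorm x <= c * rnorm y /\ rnorm (y - S x) <= q * rnorm y) ->
  forall y, exists x, S x = y /\ rnorm x <= c / (1 - q) * rnorm y.
Proof.
move=> cX c0 q01 SM /choice[h hP] y.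
pose r n := iter n (fun z => z - S (h z)) y.
have rE n : rnorm (r n) <= q ^+ n * rnorm y.
  elim: n => [|n IH]; first by rewrite expr0 mul1r.
  rewrite exprS -mulrA; apply: le_trans (hP (r n)).2 _.
  by rewrite ler_wpM2l//; case/andP: q01.
pose s n := \sum_(k < n) h (r k).
have sE n : S (s n) = y - r n.
  elim: n => [|n IH]; first by rewrite /s big_ord0 raddf0 subrr.
  by rewrite /s big_ord_recr raddfD /= [S (\sum__ _)]IH /= opprB addrA addrAC.
have [|||x [sx xs]] := @scvg_geometric R X s (c * rnorm y) q cX.
- by rewrite mulr_ge0 ?rnorm_ge0.
- by [].
- move=> n; rewrite /s big_ord_recr /= [X in X - _]addrC addrK.
  apply: le_trans (hP _).1 _; rewrite -mulrA ler_wpM2l// mulrC; exact: rE.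
exists x; split; last first.
  by have := xs 0%N; rewrite /s big_ord0 subr0 expr0 mulr1 mulrAC.
have q1 : 0 < 1 - q by case/andP: q01 => _; rewrite subr_gt0.
apply/eqP; rewrite -subr_eq0; apply/eqP; apply: rnorm_eps0 => e e0.
have M1 : 0 < `|M| + 1 by rewrite ltr_wpDl.
have y1 : 0 < rnorm y + 1 by rewrite ltr_wpDl ?rnorm_ge0.
have [|N1 N1P] := sx (e / 2 / (`|M| + 1)); first by rewrite !divr_gt0.
have [|N2 N2P] := exp_small q01 (e := e / 2 / (rnorm y + 1)).
  by rewrite !divr_gt0.
pose n := maxn N1 N2.
apply: le_trans (rnorm_triangle (S (s n)) _ _) _; rewrite [leRHS]splitr lerD//.
  rewrite -raddfB; apply: le_trans (SM _) _.
  have /ltW := N1P n (leq_maxl _ _); rewrite ler_pdivlMr// mulrC rnormBC.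
  apply: le_trans; rewrite ler_wpM2r ?rnorm_ge0//.
  by rewrite (le_trans (ler_norm _))// lerDl.
rewrite sE addrAC subrr sub0r rnormN (le_trans (rE n))//.
have /ltW := N2P n (leq_maxr _ _); rewrite ler_pdivlMr//; apply: le_trans.
rewrite ler_wpM2l ?lerDl// exprn_ge0//; by case/andP: q01.
Qed.

End operators_theory.

Section bounded_inverse.
Variables (R : realType) (X Y : normedModType R[i]).

(* Baire category: otherwise nested balls, the n-th one missing the image of the ball
   of radius n, shrink to a point outside the range of [V]. *)
Lemma somewhere_dense_ball (V : X -> Y) : seq_complete Y -> (forall y, exists x, V x = y) ->
  exists (n : nat) (y0 : Y) (r : R), 0 < r /\
    forall y, rnorm (y - y0) < r -> forall e : R, 0 < e ->
      exists x, rnorm x <= n%:R /\ rnorm (y - V x) < e.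
Proof.
move=> cY ontoV; apply: contrapT => nV.
(* Here [a] is a stage number with the centre and radius of a ball. The positivity of the radius
   sits under the existential so that [choice] yields a total step function. *)
have step (a : nat * (Y * R)) : exists b : Y * R, 0 < a.2.2 ->
    [/\ 0 < b.2, rnorm (b.1 - a.2.1) <= a.2.2 / 2, b.2 <= a.2.2 / 2 &
        forall x, rnorm x <= a.1%:R -> b.2 < rnorm (b.1 - V x)].
  have [r0|r0] := ltP 0 a.2.2; last by exists a.2; lra.
  apply: contrapT => na; apply: nV; exists a.1, a.2.1, (a.2.2 / 2).
  split=> [|y ya e e0]; first by rewrite divr_gt0.
  apply: contrapT => nx; apply: na; exists (y, Num.min (e / 2) (a.2.2 / 2)) => _ /=.
  split=> [||| x xn].
  - by rewrite lt_min !divr_gt0.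
  - exact: ltW.
  - by rewrite ge_min lexx orbT.
  - rewrite gt_min; apply/orP; left; rewrite ltNge; apply/negP => le.
    by apply: nx; exists x; split=> //; apply: le_lt_trans le _; rewrite ltr_pdivrMr// mulr_natr; lra.
have [f fP] := choice step.
pose p := fix p n := if n is m.+1 then f (m, p m) else (0 : Y, 1 : R).
have p0 n : 0 < (p n).2 by elim: n => [|n IH] //=; have [] := fP (n, p n) IH.
have pS n := fP (n, p n) (p0 n).
have p2 n : (p n).2 <= 2^-1 ^+ n.
  elim: n => [|n IH]; first by rewrite expr0.
  have [_ _ h _] := pS n; rewrite exprSr; apply: le_trans h _.
  by rewrite ler_wpM2r.
have pB n k : rnorm ((p (n + k)%N).1 - (p n).1) <= (p n).2 - (p (n + k)%N).2.
  elim: k => [|k IH]; first by rewrite addn0 !subrr rnorm0.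
  apply: le_trans (rnorm_triangle (p (n + k)%N).1 _ _) _.
  have [_ h1 h2 _] := pS (n + k)%N; rewrite addnS /= in h1 h2 *; lra.
have pB' n k : rnorm ((p (n + k)%N).1 - (p n).1) <= (p n).2.
  by apply: le_trans (pB n k) _; rewrite gerBl ltW.
have [|l pl] := cY (fun n => (p n).1).
  move=> e e0; have [||N NP] := @exp_small R 2^-1 (e / 2).
  - by rewrite invr_ge0 invf_lt1// ler0n ltr1n.
  - by rewrite divr_gt0.
  exists N => m n Nm Nn; apply: le_lt_trans (rnorm_triangle (p N).1 _ _) _.
  rewrite [ltRHS]splitr; apply: ltrD.
    by rewrite -(subnKC Nm); apply: le_lt_trans (pB' _ _) (le_lt_trans (p2 _) (NP _ _)).
  by rewrite rnormBC -(subnKC Nn); apply: le_lt_trans (pB' _ _) (le_lt_trans (p2 _) (NP _ _)).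
have lB n : rnorm ((p n).1 - l) <= (p n).2.
  apply: le_eps => e /pl[N NP].
  apply: le_trans (rnorm_triangle (p (n + N)%N).1 _ _) _.
  by apply: lerD; [rewrite rnormBC; exact: pB'|apply/ltW/NP; rewrite leq_addl].
(* A preimage of the limit has norm at most some n, but [l] lies in the ball of index n + 1, which
   misses the image of the ball of radius n. *)
have [x Vx] := ontoV l.
have xn : rnorm x <= (Num.bound (rnorm x))%:R by rewrite ltW// archi_boundP// rnorm_ge0.
have [_ _ _ /(_ x xn)] := pS (Num.bound (rnorm x)).
by rewrite Vx ltNge => /negP; apply; exact: (lB (Num.bound (rnorm x)).+1).
Qed.

(** Subtracting approximate preimages of y0 and of y0 + t y, for y0 the centre of a ball given by
    [somewhere_dense_ball], produces an approximate preimage of t y. Scaled back, it leaves at most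
    half of y, and [approx_onto] iterates. *)
Lemma bounded_inverse (V : boundedOperator X Y) :
  seq_complete X -> seq_complete Y -> bijective V ->
  exists2 c : R, 0 < c & forall x, rnorm x <= c * rnorm (V x).
Proof.
move=> cX cY bV; have [g gK Kg] := bV.
have [|n [y0 [r [r0 nP]]]] := somewhere_dense_ball (V := V) cY.
  by move=> y; exists (g y).
have [M M0 MP] := linear_rnorm_bound V.
have c0 : 0 <= 4 * n%:R / r :> R by rewrite divr_ge0 ?mulr_ge0// ltW.
have half01 : 0 <= (2^-1 : R) < 1 by rewrite invr_ge0 invf_lt1// ler0n ltr1n.
have := @approx_onto R X Y V M (4 * n%:R / r) 2^-1 cX c0 half01 MP.
set Q := (X in (X -> _) -> _) => onto.
have {}onto : forall y, exists x, V x = y /\ rnorm x <= (4 * n%:R / r) / (1 - 2^-1) * rnorm y.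
  apply: onto => y.
  have [->|y_neq0] := eqVneq y 0.
    by exists 0; rewrite raddf0 subr0 !rnorm0 !mulr0.
  have ny0 : 0 < rnorm y.
    rewrite lt_neqAle rnorm_ge0 andbT; apply: contra y_neq0 => /eqP/esym y0'.
    by apply/eqP; apply: rnorm_eq0.
  (* This makes t y of norm r / 2, inside the ball. Two errors of r / 8, divided by t, amount to |y|
     / 2; two preimages of norm at most n, divided by t, amount to (4 n / r) |y|. *)
  pose t := r / (2 * rnorm y).
  have t0 : 0 < t by rewrite divr_gt0// mulr_gt0.
  have r8 : 0 < r / 8 by rewrite divr_gt0.
  have [|x1 [x1n x1P]] := nP (t%:C%C *: y + y0) _ _ r8.
    rewrite addrK rnormZr ?(ltW t0)// /t invfM mulrA mulfVK ?gt_eqF//.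
    by rewrite ltr_pdivrMr// mulr_natr; lra.
  have [|x2 [x2n x2P]] := nP y0 _ _ r8; first by rewrite subrr rnorm0.
  have tV0 : 0 <= t^-1 by rewrite invr_ge0 ltW.
  have tE : t^-1 = 2 * rnorm y / r by rewrite /t invf_div.
  have tn : t^-1 * r = 2 * rnorm y by rewrite tE divfK// gt_eqF.
  exists ((t^-1)%:C%C *: (x1 - x2)); split.
    rewrite rnormZr//.
    have x12 : rnorm (x1 - x2) <= 2 * n%:R.
      have := rnormD x1 (- x2); rewrite rnormN; lra.
    apply: le_trans (ler_wpM2l tV0 x12) _; rewrite tE le_eqVlt; apply/orP; left; apply/eqP.
    by field; rewrite gt_eqF.
  have yE : y = (t^-1)%:C%C *: (t%:C%C *: y).
    by rewrite scalerA -rmorphM /= mulVf ?gt_eqF// scale1r.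
  rewrite linearZ /= {1}yE -scalerBr rnormZr// raddfB /=.
  have h : rnorm (t%:C%C *: y - (V x1 - V x2)) <= r / 4.
    have -> : t%:C%C *: y - (V x1 - V x2) = (t%:C%C *: y + y0 - V x1) - (y0 - V x2).
      by rewrite !opprB [RHS]addrC [RHS]addrA [t%:C%C *: y + y0]addrC [in RHS]addrA subrK addrA [V x2 + _]addrC.
    have := rnormD (t%:C%C *: y + y0 - V x1) (- (y0 - V x2)); rewrite rnormN; lra.
  apply: le_trans (ler_wpM2l tV0 h) _; lra.
exists (4 * n%:R / r / (1 - 2^-1) + 1).
  rewrite ltr_wpDl// divr_ge0// subr_ge0; lra.
move=> x; have [x' [VE x'P]] := onto (V x).
rewrite -(can_inj gK VE) VE (le_trans x'P)// ler_wpM2r ?rnorm_ge0//; lra.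
Qed.

End bounded_inverse.

Section extension.
Variables (R : realType) (P : lmodType R[i]) (X Y : normedModType R[i]).

Definition dense_range (Z : normedModType R[i]) (a : P -> Z) :=
  forall (z : Z) (e : R), 0 < e -> exists p, rnorm (z - a p) < e.

Lemma dense_linear_eq (a : P -> X) (S S' : {linear X -> Y}) (M : R) :
  dense_range a -> 0 < M -> (forall x, rnorm (S x) <= M * rnorm x) ->
  (forall x, rnorm (S' x) <= M * rnorm x) ->
  (forall p, S (a p) = S' (a p)) -> forall x, S x = S' x.
Proof.
move=> da M0 MP M'P SS' x; apply/eqP; rewrite -subr_eq0; apply/eqP; apply: rnorm_eps0 => e e0.
have [|p pP] := da x (e / (M + M)); first by rewrite divr_gt0// addr_gt0.
have -> : S x - S' x = S (x - a p) - S' (x - a p).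
  by rewrite [S (_ - _)]raddfB [S' (_ - _)]raddfB /= SS' opprB addrA subrK.
apply: le_trans (rnormD _ _) _; rewrite rnormN.
apply: le_trans (lerD (MP _) (M'P _)) _; rewrite -mulrDl mulrC -ler_pdivlMr ?ltW//.
by rewrite addr_gt0.
Qed.

(** [P] carries no norm and [a] need not be injective: the bound alone makes [b p] depend only on
    [a p], and continuously so. *)
Lemma extend_dense (a : {linear P -> X}) (b : {linear P -> Y}) (C : R) :
  dense_range a -> seq_complete Y -> (forall p, rnorm (b p) <= C * rnorm (a p)) ->
  exists S : boundedOperator X Y,
    (forall p, S (a p) = b p) /\ (forall x, rnorm (S x) <= C * rnorm x).
Proof.
move=> da cY Cab.
(* The operator is built with [|C|]; the bound with C itself is then recovered by density. *)
wlog C0 : C Cab / 0 <= C.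
  move=> h; have [S [SE _]] := h `|C| (fun p => le_trans (Cab p)
    (ler_wpM2r (rnorm_ge0 _) (ler_norm _))) (normr_ge0 _).
  exists S; split=> // x; apply: le_eps => e e0.
  have [M M0 MP] := linear_rnorm_bound S.
  have MC : 0 < M + `|C| by rewrite ltr_pwDl.
  have [|p pP] := da x (e / (M + `|C|)); first by rewrite divr_gt0.
  apply: le_trans (rnormD_le _ (S (a p))) _; rewrite -raddfB /= SE.
  have h1 := MP (x - a p); have h2 := Cab p.
  have h3 : C * rnorm (a p) <= C * rnorm x + `|C| * rnorm (x - a p).
    have : C * (rnorm (a p) - rnorm x) <= `|C| * rnorm (x - a p).
      apply: le_trans (ler_norm _) _; rewrite normrM ler_wpM2l// ler_norml.
      by have := rnormD_le x (a p); have := rnormD_le (a p) x; rewrite (rnormBC (a p)); lra.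
    by rewrite mulrBr; lra.
  move: pP; rewrite ltr_pdivlMr// mulrDr [_ * M]mulrC [_ * `|C|]mulrC; lra.
(* The closure of the graph of [a p |-> b p]. *)
pose G x y := forall e : R, 0 < e -> exists p, rnorm (x - a p) < e /\ rnorm (y - b p) < e.
have Gbound x y : G x y -> rnorm y <= C * rnorm x.
  move=> Gxy; apply: le_eps => e e0.
  have [|p [px py]] := Gxy (e / (C + 1)); first by rewrite divr_gt0// ltr_wpDl.
  have h1 := rnormD_le y (b p); have h2 := rnormD_le (a p) x; rewrite rnormBC in h2.
  have h3 := Cab p; have h4 := ler_wpM2l C0 h2.
  have h5 := ler_wpM2l C0 (ltW px).
  have -> : e = (C + 1) * (e / (C + 1)) by rewrite mulrC divfK// gt_eqF// ltr_wpDl.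
  move: h4 h5; rewrite mulrDr mulrDl mul1r; lra.
have Glin k x y x' y' : G x y -> G x' y' -> G (k *: x + x') (k *: y + y').
  move=> Gx Gx' e e0.
  have k1 : 0 < rnorm k + 1 by rewrite ltr_wpDl ?rnorm_ge0.
  have [|p [px py]] := Gx (e / 2 / (rnorm k + 1)); first by rewrite !divr_gt0.
  have [|p' [px' py']] := Gx' (e / 2); first by rewrite divr_gt0.
  exists (k *: p + p'); rewrite [a _]linearP [b _]linearP.
  have linB (Z : normedModType R[i]) (z z' w w' : Z) :
    k *: z + z' - (k *: w + w') = k *: (z - w) + (z' - w').
    by rewrite scalerBr opprD addrACA.
  rewrite !linB.
  have aux (Z : normedModType R[i]) (z z' : Z) : rnorm z < e / 2 / (rnorm k + 1) ->
      rnorm z' < e / 2 -> rnorm (k *: z + z') < e.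
    move=> h h'; apply: le_lt_trans (rnormD _ _) _; rewrite rnormZ [ltRHS]splitr.
    apply: ler_ltD => //; move: h; rewrite ltr_pdivlMr// => /ltW; apply: le_trans.
    by rewrite mulrC ler_wpM2l ?rnorm_ge0// lerDl.
  by split; apply: aux.
have Guniq x y y' : G x y -> G x y' -> y = y'.
  move=> Gy Gy'; have := Glin (-1) _ _ _ _ Gy Gy'; rewrite !scaleN1r addNr => /Gbound.
  rewrite rnorm0 mulr0 => h; apply/esym/eqP; rewrite -subr_eq0 addrC; apply/eqP.
  by apply: rnorm_eq0; apply/eqP; rewrite eq_le h rnorm_ge0.
have Gtot x : exists y, G x y.
  have /choice[p pP] : forall n : nat, exists p, rnorm (x - a p) < n.+1%:R^-1.
    by move=> n; apply: da; rewrite invr_gt0.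
  have small e : 0 < e -> exists N, forall n, (N <= n)%N -> rnorm (x - a (p n)) < e.
    by move=> /invS_small[N NP]; exists N => n /NP; apply: lt_trans (pP n).
  have [|y yP] := cY (fun n => b (p n)).
    move=> e e0; have [|N NP] := small (e / 2 / (C + 1)).
      by rewrite !divr_gt0// ltr_wpDl.
    exists N => m n /NP hm /NP hn; rewrite -raddfB /=; apply: le_lt_trans (Cab _) _.
    have : rnorm (a (p m - p n)) < e / (C + 1).
      rewrite raddfB /=; apply: le_lt_trans (rnorm_triangle x _ _) _.
      rewrite rnormBC; apply: lt_le_trans (ltrD hm hn) _.
      by rewrite -mulrDl -splitr.
    rewrite ltr_pdivlMr ?ltr_wpDl// => h; apply: le_lt_trans h.
    by rewrite mulrC ler_wpM2l ?rnorm_ge0// lerDl.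
  exists y => e e0; have [N NP] := small _ e0; have [N' NP'] := yP _ e0.
  exists (p (maxn N N')); rewrite NP ?leq_maxl//; split=> //.
  by rewrite rnormBC NP'// leq_maxr.
have [f fP] := choice Gtot.
have flin : linear f.
  by move=> k x x'; apply: (Guniq _ _ _ (fP _)); exact: Glin.
have fbound : exists M : R[i], forall x, `|f x| <= M * `|x|.
  by exists C%:C%C => x; rewrite -!rnormE -rmorphM /= lecR; exact: Gbound.
pose S : boundedOperator X Y := HB.pack f (GRing.isLinear.Build _ _ _ _ f flin)
  (isBoundedOperator.Build _ _ _ f fbound).
exists S; split=> [p|x]; last exact: Gbound.
apply: (Guniq _ _ _ (fP _)) => e e0; exists p.
by rewrite !subrr !rnorm0.
Qed.

End extension.

Lemma bounded_op_cancel (R : realType) (P : lmodType R[i]) (X Y : normedModType R[i])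
    (a : P -> X) (S : boundedOperator X Y) (S' : boundedOperator Y X) :
  dense_range a -> (forall p, S' (S (a p)) = a p) -> cancel S S'.
Proof.
move=> da SS'.
have [M M0 MP] := linear_rnorm_bound S; have [M' M'0 M'P] := linear_rnorm_bound S'.
have MM0 : 0 <= M' * M by rewrite mulr_ge0// ltW.
apply: (@dense_linear_eq _ _ _ _ a (S' \o S) idfun (M' * M + 1)) => //.
- by rewrite ltr_wpDl.
- move=> x; apply: le_trans (M'P _) _; apply: (@le_trans _ _ (M' * M * rnorm x)).
    by rewrite -mulrA ler_wpM2l ?(ltW M'0)//; exact: (MP x).
  by rewrite ler_wpM2r ?rnorm_ge0// lerDl.
- by move=> x; rewrite -[leLHS]mul1r ler_wpM2r ?rnorm_ge0// lerDr.
Qed.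

(** * Inner product spaces *)

Section inner_theory.
Variables (R : realType) (H : innerProductType R).
Implicit Types x y z : H.

Lemma innerDl x y z : inner (x + y) z = inner x z + inner y z.
Proof. exact: linearDl. Qed.

Lemma innerBl x y z : inner (x - y) z = inner x z - inner y z.
Proof. exact: linearBl. Qed.

Lemma innerZl (a : R[i]) x y : inner (a *: x) y = a * inner x y.
Proof. exact: linearZl_LR. Qed.

Lemma innerC x y : inner x y = (inner y x)^*.
Proof. by rewrite [LHS]hermC expr0 mul1r. Qed.

Lemma inner0l x : inner 0 x = 0.
Proof. exact: linear0l. Qed.

Lemma inner0r x : inner x 0 = 0.
Proof. by rewrite innerC inner0l rmorph0. Qed.

Lemma innerDr x y z : inner x (y + z) = inner x y + inner x z.
Proof. by rewrite innerC innerDl rmorphD /= -!innerC. Qed.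

Lemma innerBr x y z : inner x (y - z) = inner x y - inner x z.
Proof. by rewrite innerC innerBl rmorphB /= -!innerC. Qed.

Lemma innerZr (a : R[i]) x y : inner x (a *: y) = a^* * inner x y.
Proof. by rewrite innerC innerZl rmorphM /= -!innerC. Qed.

Lemma inner_suml n (a : 'I_n -> R[i]) (v : 'I_n -> H) y :
  inner (\sum_(i < n) a i *: v i) y = \sum_(i < n) a i * inner (v i) y.
Proof.
elim: n a v => [|n IH] a v; first by rewrite !big_ord0 inner0l.
by rewrite !big_ord_recr /= innerDl innerZl IH.
Qed.

Lemma inner_rnorm x : inner x x = (rnorm x ^+ 2)%:C%C.
Proof. by rewrite rmorphXn /= rnormE normr_inner. Qed.

Lemma rnorm_sq x : rnorm x ^+ 2 = complex.Re (inner x x).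
Proof. by rewrite inner_rnorm. Qed.

Lemma rnormD_sq x y :
  rnorm (x + y) ^+ 2 = rnorm x ^+ 2 + rnorm y ^+ 2 + 2 * complex.Re (inner x y).
Proof.
rewrite rnorm_sq innerDl !innerDr !raddfD /= -!rnorm_sq [inner y x]innerC.
by case: (inner x y) => a b /=; ring.
Qed.

Lemma rnormB_sq x y :
  rnorm (x - y) ^+ 2 = rnorm x ^+ 2 + rnorm y ^+ 2 - 2 * complex.Re (inner x y).
Proof.
rewrite rnormD_sq rnormN -scaleN1r innerZr rmorphN1 mulN1r raddfN /=.
by rewrite mulrN.
Qed.

Lemma inner_CS x y : rnorm (inner x y) <= rnorm x * rnorm y.
Proof.
rewrite -(@ler_pXn2r _ 2) ?nnegrE ?mulr_ge0 ?rnorm_ge0//.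
rewrite exprMn -lecR [leRHS]rmorphM /= -!inner_rnorm rmorphXn /= rnormE.
exact: dot_CauchySchwarz.
Qed.

Lemma rnormB_scale (t : R) x y :
  rnorm (x - (t%:C%C * inner x y) *: y) ^+ 2 = rnorm x ^+ 2
    - (2 * t - t ^+ 2 * rnorm y ^+ 2) * rnorm (inner x y) ^+ 2.
Proof.
rewrite rnormB_sq rnormZ innerZr rmorphM /= -mulrA [_^* * inner _ _]mulrC mul_conj_rnorm.
rewrite conj_realC -rmorphM /= rnormM exprMn exprMn.
have -> : rnorm (t%:C%C : R[i]) ^+ 2 = t ^+ 2 by rewrite rnorm2E /= expr0n addr0.
by ring.
Qed.

(** By the parallelogram law a minimizing sequence for the distance from x to N is Cauchy. Its limit
    leaves an orthogonal residual, since moving it along a non-orthogonal direction would bring it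
    closer to x. *)
Lemma projection (N : set H) (x : H) : seq_complete H -> N 0 ->
  (forall (a : R[i]) y z, N y -> N z -> N (a *: y + z)) ->
  (forall y, (forall e : R, 0 < e -> exists z, N z /\ rnorm (y - z) < e) -> N y) ->
  exists2 n, N n & forall m, N m -> inner (x - n) m = 0.
Proof.
move=> cH N0 Nlin Ncl.
pose D := [set rnorm (x - n) | n in N]; pose d := inf D.
have Dlb : has_lbound D by exists 0 => _ [n _ <-]; exact: rnorm_ge0.
have D0 : D !=set0 by exists (rnorm (x - 0)), 0.
have dle n : N n -> d <= rnorm (x - n) by move=> Nn; apply: ge_inf => //; exists n.
have d0 : 0 <= d by apply: lb_le_inf => // _ [n _ <-]; exact: rnorm_ge0.
have /choice[u uP] : forall k : nat, exists n, N n /\ rnorm (x - n) < d + k.+1%:R^-1.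
  move=> k; have k0 : 0 < k.+1%:R^-1 :> R by rewrite invr_gt0.
  by have [_ [n Nn <-] h] := inf_adherent k0 (conj D0 Dlb); exists n.
have par y z : N y -> N z ->
    rnorm (y - z) ^+ 2 <= 2 * rnorm (x - y) ^+ 2 + 2 * rnorm (x - z) ^+ 2 - 4 * d ^+ 2.
  move=> Ny Nz; pose w := 2^-1%:C%C *: (y + z).
  have Nw : N w.
    rewrite /w scalerDr; apply: (Nlin) => //.
    by rewrite -[_ *: z]addr0; apply: (Nlin).
  have E1 : y - z = (x - z) - (x - y) by rewrite opprB [RHS]addrC addrA subrK.
  have E2 : (x - z) + (x - y) = (2%:C)%C *: (x - w).
    rewrite scalerBr scalerA -rmorphM /= mulfV ?pnatr_eq0// scale1r.
    by rewrite addrACA -opprD [z + y]addrC rmorphD /= scalerDl scale1r.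
  have := rnormD_sq (x - z) (x - y); rewrite E2 rnormZr//.
  have := rnormB_sq (x - z) (x - y); rewrite -E1 => -> h.
  have := dle _ Nw; rewrite -(@ler_pXn2r _ 2) ?nnegrE ?rnorm_ge0//.
  by rewrite exprMn in h; lra.
have small e : 0 < e -> exists M, forall n, (M <= n)%N -> rnorm (x - u n) < d + e.
  move=> /invS_small[M MP]; exists M => n /MP h.
  by apply: lt_trans (uP n).2 _; rewrite ltrD2l.
have [|l ul] := cH u.
  (* Points of N within d + t of x are, by [par], at squared distance at most 4 (d + t)^2 - 4 d^2 =
     8 d t + 4 t^2 from each other, which is below e^2 for this t <= 1. *)
  move=> e e0; pose t := Num.min 1 (e ^+ 2 / (8 * d + 8)).
  have t0 : 0 < t.
    by rewrite lt_min ltr01 divr_gt0 ?exprn_gt0// ltr_wpDl// mulr_ge0.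
  have t1 : t <= 1 by rewrite ge_min lexx.
  have te : t * (8 * d + 8) <= e ^+ 2.
    rewrite -ler_pdivlMr; last by rewrite ltr_wpDl// mulr_ge0.
    by rewrite ge_min lexx orbT.
  have [M MP] := small t t0; exists M => m n /MP hm /MP hn.
  rewrite -(@ltr_pXn2r _ 2) ?nnegrE ?rnorm_ge0 ?(ltW e0)//.
  apply: le_lt_trans (par _ _ (uP m).1 (uP n).1) _.
  have sq r : 0 <= r -> r < d + t -> r ^+ 2 < (d + t) ^+ 2.
    by move=> r0 rd; rewrite ltr_pXn2r ?nnegrE// addr_ge0// ltW.
  have h1 := sq _ (rnorm_ge0 _) hm; have h2 := sq _ (rnorm_ge0 _) hn.
  have tt : t ^+ 2 <= t by rewrite expr2 ler_piMr// ltW.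
  have td : 0 <= t * d by rewrite mulr_ge0// ltW.
  by rewrite sqrrD mulr2n in h1 h2; lra.
have Nl : N l.
  apply: Ncl => e /ul[M MP]; exists (u M); split; first exact: (uP M).1.
  by rewrite rnormBC MP.
have ld : rnorm (x - l) <= d.
  apply: le_eps => e e0; have e2 : 0 < e / 2 by rewrite divr_gt0.
  have [M MP] := small _ e2; have [M' MP'] := ul _ e2.
  have := MP (maxn M M') (leq_maxl _ _); have := MP' (maxn M M') (leq_maxr _ _).
  by have := rnorm_triangle (u (maxn M M')) x l; lra.
exists l => // m Nm; apply: (@rnorm_eq0 _ R[i]^o).
(* With this t the gain 2 t - t^2 |m|^2 of [rnormB_scale] equals t + t^2, which is positive for
   every m, zero included. *)
pose t := (rnorm m ^+ 2 + 1)^-1.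
have m1 : 0 < rnorm m ^+ 2 + 1 by rewrite ltr_wpDl ?sqr_ge0.
have t0 : 0 < t by rewrite invr_gt0.
have Nlm : N ((t%:C%C * inner (x - l) m) *: m + l) by apply: (Nlin).
have := le_trans ld (dle _ Nlm).
rewrite -(@ler_pXn2r _ 2) ?nnegrE ?rnorm_ge0// opprD addrA addrAC rnormB_scale.
have -> : 2 * t - t ^+ 2 * rnorm m ^+ 2 = t + t ^+ 2.
  by rewrite /t; field; rewrite gt_eqF.
rewrite lerBrDr gerDl pmulr_rle0 ?addr_gt0 ?exprn_gt0// => h.
by apply/eqP; rewrite -sqrf_eq0 eq_le h sqr_ge0.
Qed.

End inner_theory.

(** * Finite linear combinations, Bessel bounds and Gram-Schmidt *)

Section linear_combinations.
Variables (R : realType) (V : lmodType R[i]).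

(* Polynomials serve as finitely supported scalar sequences. *)
Definition lc (v : nat -> V) (p : {poly R[i]}) : V := \sum_(i < size p) p`_i *: v i.

Lemma lcE n v (p : {poly R[i]}) : (size p <= n)%N -> lc v p = \sum_(i < n) p`_i *: v i.
Proof.
move=> pn; rewrite /lc (big_ord_widen n (fun i => p`_i *: v i))// big_mkcond /=.
by apply: eq_bigr => i _; case: ltnP => // h; rewrite nth_default// scale0r.
Qed.

Lemma lc_linear v : linear (lc v).
Proof.
move=> a p q; pose n := maxn (size p) (size q).
rewrite (@lcE n v p) ?leq_maxl// (@lcE n v q) ?leq_maxr// (@lcE n); last first.
  by rewrite (leq_trans (size_polyD _ _))// geq_max leq_maxr andbT (leq_trans (size_scale_leq _ _))// leq_maxl.
rewrite scaler_sumr -big_split /=; apply: eq_bigr => i _.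
by rewrite coefD coefZ scalerDl scalerA.
Qed.

HB.instance Definition _ v := GRing.isLinear.Build _ _ _ _ (lc v) (lc_linear v).

Lemma lcXn (v : nat -> V) n : lc v 'X^n = v n.
Proof.
rewrite /lc size_polyXn big_ord_recr /= coefXn eqxx scale1r big1 ?add0r// => i _.
by rewrite coefXn ltn_eqF// scale0r.
Qed.

Lemma lc_poly v n (c : nat -> R[i]) : lc v (\poly_(i < n) c i) = \sum_(i < n) c i *: v i.
Proof.
rewrite (@lcE n) ?size_poly//; apply: eq_bigr => i _.
by rewrite coef_poly ltn_ord.
Qed.

Lemma eq_lc v w : v =1 w -> lc v =1 lc w.
Proof. by move=> vw p; apply: eq_bigr => i _; rewrite vw. Qed.

Lemma lc_closed (P : set V) v : P 0 ->
  (forall (a : R[i]) y z, P y -> P z -> P (a *: y + z)) ->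
  (forall i, P (v i)) -> forall p, P (lc v p).
Proof.
move=> P0 Plin Pv p; rewrite /lc; elim: (size p) => [|n IH]; first by rewrite big_ord0.
by rewrite big_ord_recr /= addrC; apply: Plin.
Qed.

End linear_combinations.

Lemma linear_lc (R : realType) (V W : lmodType R[i]) (S : {linear V -> W}) (v : nat -> V) (p : {poly R[i]}) :
  S (lc v p) = lc (S \o v) p.
Proof. by rewrite /lc linear_sum; apply: eq_bigr => i _; rewrite linearZ. Qed.

Section l2norm.
Variable R : realType.

Definition l2sq (p : {poly R[i]}) : R := \sum_(i < size p) rnorm p`_i ^+ 2.

Lemma l2sq_poly n (c : nat -> R[i]) : l2sq (\poly_(i < n) c i) = \sum_(i < n) rnorm (c i) ^+ 2.
Proof.
rewrite /l2sq; set p := \poly_(i < n) c i.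
rewrite (big_ord_widen n (fun i => rnorm p`_i ^+ 2)) ?size_poly// big_mkcond /=.
apply: eq_bigr => i _; rewrite /p coef_poly ltn_ord; case: ltnP => // h.
have : p`_i = 0 by rewrite nth_default.
by rewrite /p coef_poly ltn_ord => ->; rewrite (@rnorm0 _ R[i]^o) expr0n.
Qed.

Definition orthonormal_seq (H : innerProductType R) (e : nat -> H) :=
  forall m n, inner (e m) (e n) = (m == n)%:R.

Variable H : innerProductType R.

Lemma orthonormal_lc_inner (e : nat -> H) (p : {poly R[i]}) k : orthonormal_seq e -> (k < size p)%N ->
  inner (lc e p) (e k) = p`_k.
Proof.
move=> oe kp; rewrite /lc inner_suml (bigD1 (Ordinal kp))//= oe eqxx mulr1.
by rewrite big1 ?addr0// => i ik; rewrite oe (negbTE (_ : i != k :> nat)) ?mulr0.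
Qed.

Lemma rnorm_lc_orthonormal (e : nat -> H) (p : {poly R[i]}) : orthonormal_seq e -> rnorm (lc e p) ^+ 2 = l2sq p.
Proof.
move=> oe; apply: complexI; rewrite -inner_rnorm {1}/lc inner_suml rmorph_sum /=.
apply: eq_bigr => i _; rewrite -mul_conj_rnorm; congr (_ * _).
by rewrite innerC orthonormal_lc_inner.
Qed.

(** Write h for the sum and |h|^2 as the real part of the sum of p_i <f_i, h>. AM-GM with weights B
    / 2 and 1 / (2 B) leaves |h|^2 / 2 on the right, by the Bessel bound, and this is absorbed. *)
Lemma synthesis_bound (f : nat -> H) (B : R) : 0 < B ->
  (forall n g, \sum_(i < n) rnorm (inner g (f i)) ^+ 2 <= B * rnorm g ^+ 2) ->
  forall p, rnorm (lc f p) ^+ 2 <= B * l2sq p.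
Proof.
move=> B0 fB p; set h := lc f p.
have hE : rnorm h ^+ 2 = \sum_(i < size p) complex.Re (p`_i * inner (f i) h).
  by rewrite rnorm_sq {1}/h /lc inner_suml raddf_sum.
have : \sum_(i < size p) complex.Re (p`_i * inner (f i) h) <=
   \sum_(i < size p) (B / 2 * rnorm p`_i ^+ 2 + (2 * B)^-1 * rnorm (inner h (f i)) ^+ 2).
  apply: ler_sum => i _; apply: le_trans (ler_norm _) _; apply: le_trans (Re_rnorm _) _.
  rewrite rnormM innerC rnorm_conj; set a := rnorm _; set b := rnorm _.
  rewrite -subr_ge0 (_ : _ - _ = (2 * B)^-1 * (B * a - b) ^+ 2).
    by rewrite mulr_ge0 ?sqr_ge0// invr_ge0 mulr_ge0// ltW.
  by field; rewrite gt_eqF.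
rewrite -hE big_split /= -!mulr_sumr -/(l2sq p) => h1.
have B2 : 0 <= (2 * B)^-1 by rewrite invr_ge0 mulr_ge0// ltW.
have := ler_wpM2l B2 (fB (size p) h).
have -> : (2 * B)^-1 * (B * rnorm h ^+ 2) = rnorm h ^+ 2 / 2 by field; rewrite gt_eqF.
lra.
Qed.

(** One step of the frame algorithm with relaxation parameter t. The cross term is explicit because
    <g, lc f p> is exactly [l2sq p] when p consists of the coefficients <g, f_i>. *)
Lemma frame_step (f : nat -> H) (g : H) n (t : R) :
  let p := \poly_(i < n) inner g (f i) in
  rnorm (g - t%:C%C *: lc f p) ^+ 2 =
  rnorm g ^+ 2 - 2 * t * l2sq p + t ^+ 2 * rnorm (lc f p) ^+ 2.
Proof.
move=> p; rewrite rnormB_sq rnormZ innerZr exprMn.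
have -> : rnorm (t%:C%C : R[i]) ^+ 2 = t ^+ 2 by rewrite rnorm2E /= expr0n addr0.
have -> : inner g (lc f p) = (l2sq p)%:C%C.
  rewrite innerC lc_poly inner_suml l2sq_poly rmorph_sum rmorph_sum /=.
  apply: eq_bigr => i _; rewrite rmorphM /= -(innerC g (f i)) mulrC; exact: mul_conj_rnorm.
by rewrite conj_realC -rmorphM /=; ring.
Qed.

(** At t = 1 / B the residual of [frame_step] has squared norm at most |g|^2 - l2sq p / B, and it is
    nonnegative. Together with [synthesis_bound], this is the equality of the norms of an operator
    and its adjoint. *)
Lemma analysis_bound (f : nat -> H) (B : R) : 0 < B ->
  (forall p, rnorm (lc f p) ^+ 2 <= B * l2sq p) ->
  forall n g, \sum_(i < n) rnorm (inner g (f i)) ^+ 2 <= B * rnorm g ^+ 2.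
Proof.
move=> B0 fB n g; pose p := \poly_(i < n) inner g (f i).
rewrite -(l2sq_poly n (fun i => inner g (f i))) -/p mulrC -ler_pdivrMr//.
have := frame_step f g n B^-1; rewrite -/p /= => E.
have : 0 <= rnorm (g - B^-1%:C%C *: lc f p) ^+ 2 by rewrite sqr_ge0.
have h := ler_wpM2l (sqr_ge0 B^-1) (fB p).
rewrite E; suff : B^-1 ^+ 2 * (B * l2sq p) = l2sq p / B by move: h; lra.
by field; rewrite gt_eqF.
Qed.

End l2norm.

Section gram_schmidt.
Variables (R : realType) (H : innerProductType R) (v : nat -> H).

Lemma finite_projection n (x : H) :
  exists p : {poly R[i]}, (size p <= n)%N /\ forall i, (i < n)%N -> inner (x - lc v p) (v i) = 0.
Proof.
elim: n x => [|n IH] x; first by exists 0; rewrite size_poly0.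
have [p [pn pP]] := IH x; have [q [qn qP]] := IH (v n).
(* The new direction, orthogonal to the earlier vectors. If v_n depends on them then w = 0, and
   orthogonality to w holds whatever k is. *)
pose w := v n - lc v q; pose k := inner (x - lc v p) w / inner w w.
exists (p + k *: ('X^n - q)); split.
  rewrite (leq_trans (size_polyD _ _))// geq_max (leq_trans pn)//=.
  rewrite (leq_trans (size_scale_leq _ _))// (leq_trans (size_polyD _ _))//.
  by rewrite geq_max size_polyXn leqnn size_polyN (leq_trans qn).
have -> : x - lc v (p + k *: ('X^n - q)) = (x - lc v p) - k *: w.
  by rewrite raddfD /= linearZ /= raddfB /= lcXn opprD addrA.
have wi i : (i < n)%N -> inner (x - lc v p - k *: w) (v i) = 0.
  by move=> i_n; rewrite innerBl innerZl pP// qP// mulr0 subr0.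
move=> i; rewrite ltnS leq_eqVlt => /orP[/eqP ->|]; last exact: wi.
have -> : v n = w + lc v q by rewrite /w subrK.
rewrite innerDr.
have -> : inner (x - lc v p - k *: w) (lc v q) = 0.
  rewrite innerC /lc inner_suml big1 ?rmorph0// => j _.
  by rewrite innerC wi ?rmorph0 ?mulr0// (leq_trans (ltn_ord j)).
rewrite addr0 innerBl innerZl /k; have [->|w0] := eqVneq w 0; first by rewrite !inner0r mulr0 subrr.
rewrite divfK ?subrr//; by apply: contra w0; rewrite dnorm_eq0.
Qed.

(** Freeness keeps each residual nonzero, so it can be normalized: a zero residual would equate X^n
    with a polynomial of size at most n. Density passes to e because strong induction expresses each
    v_n through e. *)
Lemma gram_schmidt : (forall p, lc v p = 0 -> p = 0) -> dense_range (lc v) ->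
  exists e : nat -> H, orthonormal_seq e /\ dense_range (lc e).
Proof.
move=> vfree vdense.
have /choice[q qP] := fun n => finite_projection n (v n).
pose w n := v n - lc v (q n).
have w0 n : w n != 0.
  apply/eqP => wn0; have : lc v ('X^n - q n) = 0 by rewrite raddfB /= lcXn.
  move=> /vfree/eqP; rewrite subr_eq0 => /eqP XE.
  by have := (qP n).1; rewrite -XE size_polyXn ltnn.
have nw n : 0 < rnorm (w n).
  rewrite lt_neqAle rnorm_ge0 andbT; apply: contra (w0 n) => /eqP/esym h.
  by apply/eqP; apply: rnorm_eq0.
pose e n := (rnorm (w n))^-1%:C%C *: w n.
have we n : w n = (rnorm (w n))%:C%C *: e n.
  by rewrite /e scalerA -rmorphM /= mulfV ?gt_eqF// scale1r.
have oe_lt m n : (m < n)%N -> inner (e m) (e n) = 0.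
  move=> mn; rewrite innerZl innerZr innerC.
  suff -> : inner (w n) (w m) = 0 by rewrite rmorph0 !mulr0.
  rewrite {2}/w innerBr (qP n).2// sub0r innerC /lc inner_suml big1 ?rmorph0 ?oppr0// => j _.
  rewrite innerC (qP n).2 ?rmorph0 ?mulr0//.
  exact: leq_trans (leq_trans (ltn_ord j) (qP m).1) (ltnW mn).
exists e; split.
  move=> m n; case: (ltngtP m n) => [/oe_lt//|nm|->].
    by rewrite innerC oe_lt// rmorph0.
  rewrite inner_rnorm /e rnormZr ?invr_ge0 ?rnorm_ge0//.
  by rewrite mulVf ?gt_eqF// expr1n.
have ev n : exists p, v n = lc e p.
  elim/ltn_ind: n => n IH.
  have [p pE] : exists p, lc v (q n) = lc e p.
    rewrite /lc; have : forall k, (k <= n)%N -> exists p, \sum_(i < k) (q n)`_i *: v i = lc e p.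
      elim=> [|k IHk] kn; first by exists 0; rewrite big_ord0 raddf0.
      have [p pE] := IHk (ltnW kn); have [p' p'E] := IH k kn.
      by exists (p + (q n)`_k *: p'); rewrite big_ord_recr /= pE p'E raddfD /= linearZ.
    by apply; exact: (qP n).1.
  exists ((rnorm (w n))%:C%C *: 'X^n + p).
  by rewrite raddfD /= linearZ /= lcXn -we -pE subrK.
move=> x d /(vdense x)[p pd].
have [p' p'E] : exists p', lc v p = lc e p'.
  apply: (@lc_closed _ _ [set x | exists p', x = lc e p']) => //=.
  - by exists 0; rewrite raddf0.
  - by move=> a _ _ [r ->] [s ->]; exists (a *: r + s); rewrite linearP.
by exists p'; rewrite -p'E.
Qed.

End gram_schmidt.

(** * Completeness of L^2 *)

Section complete_C.
Variable R : realType.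

Lemma seq_complete_C : seq_complete (R[i]^o : normedModType R[i]).
Proof.
move=> u uC.
have rC (f : R[i] -> R) : (forall x y, `|f x - f y| <= rnorm (x - y)) ->
    exists l : R, forall e : R, 0 < e -> exists N, forall n, (N <= n)%N -> `|f (u n) - l| < e.
  move=> fl; suff /cvgrPdist_lt h : cvg ((f \o u) @ \oo).
    exists (lim ((f \o u) @ \oo)) => e /h[N _ NP]; exists N => n /NP.
    by rewrite distrC.
  apply: cauchy_cvg; apply: cauchy_exP => e e0; have [N NP] := uC _ e0.
  exists (f (u N)), N => // n /= Nn; rewrite /ball /=.
  by apply: le_lt_trans (fl _ _) _; apply: NP.
have [|a aP] := rC (@complex.Re R).
  by move=> x y; rewrite -raddfB; exact: Re_rnorm.
have [|b bP] := rC (@complex.Im R).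
  by move=> x y; rewrite -raddfB; exact: Im_rnorm.
exists (a +i* b)%C => e e0; have e2 : 0 < e / 2 by rewrite divr_gt0.
have [N NP] := aP _ e2; have [N' NP'] := bP _ e2.
exists (maxn N N') => n; rewrite geq_max => /andP[/NP h /NP' h'].
rewrite -(@ltr_pXn2r _ 2) ?nnegrE ?rnorm_ge0 ?(ltW e0)// rnorm2E !raddfB /=.
rewrite -(@ltr_pXn2r _ 2) ?nnegrE// ?ltW// real_normK ?num_real// in h.
rewrite -(@ltr_pXn2r _ 2) ?nnegrE// ?ltW// real_normK ?num_real// in h'.
by move: h h'; rewrite expr_div_n; have : 0 < e ^+ 2 by [rewrite exprn_gt0|]; lra.
Qed.

End complete_C.

Section L2_complete.
Context d (T : measurableType d) (R : realType).
Variables (mu : {measure set T -> \bar R}) (D : set T) (mD : measurable D).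
Local Notation L2 := (L2 mu mD).

Lemma cmeasurable_rnorm2 (f : T -> R[i]) : cmeasurable_fun D f ->
  measurable_fun D (fun x => rnorm (f x) ^+ 2).
Proof.
move=> [mr mi]; rewrite (_ : (fun x => _) = (fun x => complex.Re (f x) ^+ 2 + complex.Im (f x) ^+ 2)).
  by apply: measurable_funD; exact: measurable_funX.
by apply/funext => x; rewrite rnorm2E.
Qed.

Lemma rnorm_L2class (f : L2fun mu mD) :
  (\int[mu]_(x in D) (rnorm (f x) ^+ 2)%:E)%E = (rnorm (L2class f : L2) ^+ 2)%:E.
Proof.
have -> : rnorm (L2class f : L2) ^+ 2 = \int[mu]_(x in D) (rnorm (f x) ^+ 2).
  by apply: complexI; rewrite -L2inner_normE -L2norm_inner rmorphXn /= rnormE.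
have /square_integrableP[_ fi] := L2funP f.
rewrite /Rintegral fineK//; exact: integrable_fin_num.
Qed.

Lemma l2valB (f g : L2fun mu mD) x : l2val (f - g) x = l2val f x - l2val g x.
Proof. by rewrite (_ : l2val (f - g) = l2val f - l2val g)//; exact: (raddfB val). Qed.

(** Riesz-Fischer: a rapidly convergent subsequence converges almost everywhere and in norm, and the
    Cauchy condition carries the limit over to the whole sequence. *)
Lemma L2_complete : seq_complete L2.
Proof.
move=> u uC.
have /choice[N NP] : forall k, exists N, forall m n, (N <= m)%N -> (N <= n)%N ->
    rnorm (u m - u n) < 8^-1 ^+ k.+1.
  by move=> k; apply: uC; rewrite exprn_gt0// invr_gt0.
(* Partial sums make the indices nondecreasing while keeping them above [N k]. *)
pose n k := (\sum_(j < k.+1) N j)%N.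
have Nn k : (N k <= n k)%N by rewrite /n big_ord_recr leq_addl.
have nS k : (n k <= n k.+1)%N by rewrite [leqRHS]/n big_ord_recr leq_addr.
pose f k : L2fun mu mD := repr (u (n k)).
have fE k : u (n k) = L2class (f k) by rewrite L2class_repr.
(* Since [|u (n (k+1)) - u (n k)| < 8^-(k+1)], the weights [4 ^ k] keep the sum
   integrable, and where it is finite the sequence [f k x] converges geometrically. *)
pose h k x : R := 4 ^+ k * rnorm (f k.+1 x - f k x) ^+ 2.
have h0 k x : 0 <= h k x by rewrite mulr_ge0 ?sqr_ge0 ?exprn_ge0.
have mh k : measurable_fun D (h k).
  apply: measurable_funM; first exact: measurable_cst.
  have [+ _] := L2funP (f k.+1 - f k); move=> /cmeasurable_rnorm2.
  by under eq_fun do rewrite l2valB.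
(* Since 4^k 8^-(k+1) <= 2^-(k+1); this form of the bound is the one that [epsilon_trick0] sums to
   1. *)
have ih k : (\int[mu]_(x in D) (h k x)%:E <= (1 / (2 ^ k.+1)%:R)%:E)%E.
  under eq_integral do rewrite EFinM.
  rewrite ge0_integralZl_EFin ?exprn_ge0//; first last.
  - apply/measurable_EFinP; have [+ _] := L2funP (f k.+1 - f k); move=> /cmeasurable_rnorm2.
    by under eq_fun do rewrite l2valB.
  - by move=> x _; rewrite lee_fin sqr_ge0.
  have -> : (\int[mu]_(x in D) (rnorm (f k.+1 x - f k x) ^+ 2)%:E)%E =
      (rnorm (u (n k.+1) - u (n k)) ^+ 2)%:E.
    rewrite !fE -raddfB -rnorm_L2class; apply: eq_integral => x _.
    by rewrite l2valB.
  rewrite -EFinM lee_fin.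
  have r := NP k _ _ (leq_trans (Nn k) (nS k)) (Nn k).
  have r2 : rnorm (u (n k.+1) - u (n k)) ^+ 2 <= 8^-1 ^+ k.+1.
    rewrite expr2; apply: le_trans (ler_wpM2l (rnorm_ge0 _) (ltW r)) _.
    apply: ler_piMl; first by rewrite exprn_ge0// invr_ge0.
    by apply: le_trans (ltW r) _; rewrite exprn_ile1 ?invr_ge0// invf_le1// ler1n.
  apply: le_trans (ler_wpM2l _ r2) _; first by rewrite exprn_ge0.
  rewrite natrX div1r -exprVn exprS [leRHS]exprS mulrCA -exprMn.
  have -> : 4 / 8 = 2^-1 :> R by lra.
  by rewrite ler_wpM2r ?exprn_ge0 ?invr_ge0// lef_pV2 ?posrE// ler_nat.
pose s x : \bar R := (\sum_(k <oo) (h k x)%:E)%E.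
have s0 x : (0 <= s x)%E by apply: nneseries_ge0 => k _ _; rewrite lee_fin.
have ms : measurable_fun D s.
  apply: ge0_emeasurable_sum => [k x _ _|k _]; first by rewrite lee_fin.
  exact/measurable_EFinP.
have is1 : (\int[mu]_(x in D) s x <= 1%:E)%E.
  rewrite /s integral_nneseries//; last 2 first.
  - by move=> k; exact/measurable_EFinP.
  - by move=> k x _; rewrite lee_fin.
  apply: le_trans (epsilon_trick0 xpredT ler01); apply: lee_nneseries => [i _ _|i _].
    by apply: integral_ge0 => x _; rewrite lee_fin.
  exact: ih.
have int_s : mu.-integrable D s.
  apply/integrableP; split=> //; under eq_integral do rewrite gee0_abs//.
  exact: le_lt_trans is1 (ltry _).
have s_fin := integrable_ae mD int_s.
pose E := D `&` [set x | s x \is a fin_num].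
have mE : measurable E by exact: emeasurable_fin_num.
(* From h_k <= s, consecutive terms differ by at most sqrt(s x) 2^-k, and the tail of the geometric
   series doubles this. The value 0 off E makes g on D a pointwise limit of the functions 1_E f_k,
   hence measurable. *)
have lim_ex x : exists l : R[i], (E x -> scvg (fun k => f k x : R[i]^o) l /\
   forall k, rnorm (l - f k x) ^+ 2 <= 4 * 4^-1 ^+ k * fine (s x)) /\ (~ E x -> l = 0).
  have [[Dx fx]|nEx] := pselect (E x); last by exists 0.
  pose M := fine (s x); have M0 : 0 <= M by rewrite /M fine_ge0.
  have hM k : h k x <= M.
    rewrite -lee_fin /M fineK//; apply: le_trans (nneseries_lim_ge k.+1 _).
      by rewrite big_nat_recr//= leeDr// sume_ge0// => i _; rewrite lee_fin.
    by move=> i _ _; rewrite lee_fin.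
  pose K := Num.sqrt M.
  have [||k|l [fl lP]] := @scvg_geometric R R[i]^o (fun k => f k x) K 2^-1 (@seq_complete_C R).
  - exact: sqrtr_ge0.
  - by rewrite invr_ge0 invf_lt1// ler0n ltr1n.
  - rewrite -(@ler_pXn2r _ 2) ?nnegrE ?rnorm_ge0 ?mulr_ge0 ?exprn_ge0 ?sqrtr_ge0 ?invr_ge0//.
    rewrite exprMn sqr_sqrtr// -exprM mulnC exprM.
    have -> : (2^-1 ^+ 2 : R) = 4^-1 by lra.
    by rewrite exprVn ler_pdivlMr ?exprn_gt0// mulrC; exact: hM.
  exists l; split; last by move=> /(_ (conj Dx fx)).
  move=> _; split=> // k; have := lP k.
  rewrite -(@ler_pXn2r _ 2) ?nnegrE ?rnorm_ge0 ?divr_ge0 ?mulr_ge0 ?exprn_ge0 ?sqrtr_ge0 ?invr_ge0//; last lra.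
  move=> /le_trans; apply; rewrite expr_div_n exprMn sqr_sqrtr// -exprM mulnC exprM.
  have -> : (2^-1 ^+ 2 : R) = 4^-1 by lra.
  have -> : ((1 - 2^-1) ^+ 2 : R) = 4^-1 by lra.
  by rewrite invrK -/M; lra.
have [g gP] := choice lim_ex.
have mg : cmeasurable_fun D g.
  have aux (p : R[i] -> R) : (forall z w, `|p z - p w| <= rnorm (z - w)) -> p 0 = 0 ->
      (forall k, measurable_fun D (fun x => p (f k x))) -> measurable_fun D (fun x => p (g x)).
    move=> pl p0 mf; apply: (@measurable_fun_cvg _ _ _ _ (fun k x => \1_E x * p (f k x))).
      by move=> k; apply: measurable_funM => //; exact: measurable_indic.
    move=> x Dx; have [gE gnE] := gP x; have [Ex|nEx] := pselect (E x).
      rewrite indicE mem_set//; apply/cvgrPdist_lt => e e0.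
      have [N' NP'] := (gE Ex).1 e e0; exists N' => // m /= /NP'.
      by rewrite mul1r; apply: le_lt_trans; rewrite distrC.
    by rewrite indicE memNset// gnE// p0; under eq_fun do rewrite mul0r; exact: cvg_cst.
  split; apply: aux => //.
  - by move=> z w; rewrite -raddfB; exact: Re_rnorm.
  - by move=> k; have [[]] := L2funP (f k).
  - by move=> z w; rewrite -raddfB; exact: Im_rnorm.
  - by move=> k; have [[]] := L2funP (f k).
have gf k : (\int[mu]_(x in D) (rnorm (g x - f k x) ^+ 2)%:E <= (4 * 4^-1 ^+ k)%:E)%E.
  have c0 : 0 <= 4 * 4^-1 ^+ k :> R by rewrite mulr_ge0// exprn_ge0// invr_ge0.
  apply: (@le_trans _ _ (\int[mu]_(x in D) ((4 * 4^-1 ^+ k)%:E * s x))%E); last first.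
    by rewrite ge0_integralZl_EFin// -[leRHS]mule1 lee_wpmul2l ?lee_fin.
  apply: ae_ge0_le_integral => //.
  - by move=> x _; rewrite lee_fin sqr_ge0.
  - apply/measurable_EFinP/cmeasurable_rnorm2.
    have [mf _] := L2funP (f k).
    have := cmeasurable_funD mg (cmeasurable_funM (f := cst (-1)) _ mf) => /=.
    rewrite (_ : (fun x => _) = (fun x => g x - f k x)); last first.
      by apply/funext => x /=; rewrite mulN1r.
    by apply; split; exact: measurable_cst.
  - by move=> x _; rewrite mule_ge0 ?lee_fin.
  - exact: measurable_funeM.
  - apply: filterS s_fin => x sx Dx.
    rewrite -[s x]fineK ?sx// -EFinM lee_fin.
    by apply: ((gP x).1 _).2; split=> //; exact: sx.
have g_sq k : (fun x => g x - f k x) \in sqint mu mD.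
  apply/asboolP; split; last exact: le_lt_trans (gf k) (ltry _).
  have [mf _] := L2funP (f k).
  have := cmeasurable_funD mg (cmeasurable_funM (f := cst (-1)) _ mf) => /=.
  rewrite (_ : (fun x => _) = (fun x => g x - f k x)); last first.
    by apply/funext => x /=; rewrite mulN1r.
  by apply; split; exact: measurable_cst.
have g_sq' : g \in sqint mu mD.
  have := rpredD (g_sq 0%N) (l2valP (f 0%N)).
  by rewrite (_ : _ + _ = g)//; apply/funext => x; rewrite -[LHS]/(g x - f 0%N x + f 0%N x) subrK.
pose G : L2fun mu mD := MkL2fun g_sq'.
exists (L2class G) => e e0.
have GE k : rnorm (u (n k) - L2class G) ^+ 2 <= 4 * 4^-1 ^+ k.
  rewrite rnormBC fE -raddfB -lee_fin -rnorm_L2class; apply: le_trans (gf k).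
  by rewrite le_eqVlt; apply/orP; left; apply/eqP/eq_integral => x _; rewrite l2valB.
have [||k1 k1P] := @exp_small R 4^-1 ((e / 2) ^+ 2 / 4).
- by rewrite invr_ge0 invf_lt1// ler0n ltr1n.
- by rewrite divr_gt0// exprn_gt0// divr_gt0.
have [||k2 k2P] := @exp_small R 8^-1 (e / 2).
- by rewrite invr_ge0 invf_lt1// ler0n ltr1n.
- by rewrite divr_gt0.
pose k := maxn k1 k2.
exists (N k) => m Nm; apply: le_lt_trans (rnorm_triangle (u (n k)) _ _) _.
rewrite [ltRHS]splitr; apply: ltrD.
  apply: lt_trans (NP k _ _ Nm (Nn k)) (k2P _ _).
  by rewrite (leq_trans (leq_maxr k1 k2)).
rewrite -(@ltr_pXn2r _ 2) ?nnegrE ?rnorm_ge0 ?divr_ge0 ?(ltW e0)//.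
apply: le_lt_trans (GE k) _.
by have := k1P k (leq_maxl _ _); rewrite ltr_pdivlMr// mulrC.
Qed.

End L2_complete.

(** * Uniqueness of Fourier coefficients on the circle *)

Section bounded_multiples.
Context d (T : measurableType d) (R : realType).
Variables (mu : {measure set T -> \bar R}) (D : set T) (mD : measurable D).

Lemma integrable_bounded_mul (h g : T -> R) (M : R) : measurable_fun D h ->
  (forall x, D x -> `|h x| <= M) -> mu.-integrable D (EFin \o g) ->
  mu.-integrable D (EFin \o (fun x => h x * g x)).
Proof.
move=> mh hM ig.
have hb : [bounded h x | x in D].
  exists M; split; first exact: num_real.
  by move=> N MN x Dx; apply: le_trans (hM x Dx) (ltW MN).
by have := integrableMr mD mh hb ig; apply: eq_integrable.
Qed.

Lemma cintegrable_bounded_mul (w u : T -> R[i]) (M : R) : cmeasurable_fun D w ->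
  (forall x, D x -> rnorm (w x) <= M) -> cintegrable mu D u ->
  cintegrable mu D (fun x => w x * u x).
Proof.
move=> [mr mi] wM [ur ui].
have rM x : D x -> `|complex.Re (w x)| <= M.
  by move=> Dx; exact: le_trans (Re_rnorm _) (wM x Dx).
have iM x : D x -> `|complex.Im (w x)| <= M.
  by move=> Dx; exact: le_trans (Im_rnorm _) (wM x Dx).
split.
- have := integrableB mD (integrable_bounded_mul mr rM ur) (integrable_bounded_mul mi iM ui).
  by apply: eq_integrable => // x _ /=; case: (w x); case: (u x).
- have := integrableD mD (integrable_bounded_mul mr rM ui) (integrable_bounded_mul mi iM ur).
  by apply: eq_integrable => // x _ /=; case: (w x); case: (u x).
Qed.

Lemma Rintegral_bounded_cvg0 (g_ : nat -> T -> R) (g v : T -> R) (M : R) :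
  (forall k, measurable_fun D (g_ k)) -> (forall k x, D x -> `|g_ k x| <= M) ->
  (forall x, D x -> g_ ^~ x @ \oo --> g x) ->
  mu.-integrable D (EFin \o v) -> (forall k, \int[mu]_(x in D) (g_ k x * v x) = 0) ->
  \int[mu]_(x in D) (g x * v x) = 0.
Proof.
move=> mg gM gg iv g0.
have mv : measurable_fun D v by have /integrableP[/measurable_EFinP] := iv.
have mg' : measurable_fun D g by exact: measurable_fun_cvg gg.
have iMv : mu.-integrable D (fun x => (`|M| * `|v x|)%:E).
  have := integrableZl mD `|M| (integrable_abse iv).
  by apply: eq_integrable.
have [||||_ _] := @dominated_convergence _ _ _ mu D mD
  (fun k x => (g_ k x * v x)%:E) (fun x => (g x * v x)%:E) (fun x => (`|M| * `|v x|)%:E) _ _ _ iMv.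
- by move=> k; apply/measurable_EFinP; exact: measurable_funM.
- by apply/measurable_EFinP; exact: measurable_funM.
- apply: aeW => x Dx; apply: cvg_EFin; first exact: nearW.
  by apply: cvgM; [exact: gg|exact: cvg_cst].
- apply: aeW => x k Dx; rewrite /= lee_fin normrM ler_wpM2r//.
  by apply: le_trans (gM k x Dx) (ler_norm _).
rewrite /Rintegral; have -> : (fun k => \int[mu]_(x in D) (g_ k x * v x)%:E)%E = cst 0%E.
  apply/funext => k; have := g0 k; rewrite /Rintegral => h.
  rewrite -[LHS]fineK ?h//; apply: integrable_fin_num => //.
  apply: integrable_bounded_mul => //; exact: gM.
move=> /cvg_lim; rewrite lim_cst// => <- //.
Qed.

End bounded_multiples.

Section fourier_uniqueness.
Variable R : realType.
Local Notation mu := (@arc_length R).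
Local Notation C := (borel_circle R).

Lemma cmeasurable_circle_pow (n : int) : cmeasurable_fun setT (fun z : C => circle_val z ^ n).
Proof.
have nat_pow (k : nat) : cmeasurable_fun setT (fun z : C => circle_val z ^+ k).
  elim: k => [|k IH].
    by under eq_fun do rewrite expr0; split; exact: measurable_cst.
  by under eq_fun do rewrite exprS; apply: cmeasurable_funM => //; exact: cmeasurable_circle_val.
case: n => k; first exact: nat_pow.
rewrite (_ : (fun z => _) = (fun z : C => (circle_val z ^+ k.+1)^*)).
  by apply: cmeasurable_fun_conj; exact: nat_pow.
apply/funext => z; rewrite NegzE -exprnN invC_norm normrX norm_circle_val.
by rewrite !expr1n invr1 mul1r.
Qed.

Lemma norm_circle_pow (z : C) (n : int) : `|circle_val z ^ n| = 1.
Proof.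
case: n => k; first by rewrite normrX norm_circle_val expr1n.
by rewrite NegzE -exprnN normfV normrX norm_circle_val expr1n invr1.
Qed.

Lemma rnorm_circle_pow (z : C) (n : int) : rnorm (circle_val z ^ n) = 1.
Proof. by apply: complexI; rewrite rnormE norm_circle_pow. Qed.

Lemma circle_val_neq0 (z : C) : circle_val z != 0.
Proof. by rewrite -normr_eq0 norm_circle_val oner_eq0. Qed.

Lemma conj_circle_val (z : C) : (circle_val z)^* = circle_val z ^ (-1).
Proof. by rewrite exprN1 invC_norm norm_circle_val expr1n invr1 mul1r. Qed.

Lemma conj_circle_pow (z : C) (n : int) : (circle_val z ^ n)^* = circle_val z ^ (- n).
Proof.
by rewrite -invr_expz invC_norm norm_circle_pow expr1n invr1 mul1r.
Qed.

Definition fourier_null (u : C -> R[i]) :=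
  cintegrable mu setT u /\
  forall n : int, cintegral mu setT (fun z => circle_val z ^ n * u z) = 0.

Definition fourier_multiplier (g : C -> R) :=
  [/\ measurable_fun setT g, exists M, forall z, `|g z| <= M &
      forall u, fourier_null u -> fourier_null (fun z => (g z)%:C%C * u z)].

Lemma fourier_null_cintegrable_pow u n : fourier_null u ->
  cintegrable mu setT (fun z => circle_val z ^ n * u z).
Proof.
move=> [iu _]; apply: (@cintegrable_bounded_mul _ _ _ _ _ measurableT _ _ 1) => //.
  exact: cmeasurable_circle_pow.
by move=> z _; rewrite rnorm_circle_pow.
Qed.

Lemma fourier_nullD u v : fourier_null u -> fourier_null v -> fourier_null (u \+ v).
Proof.
have iD f g : cintegrable mu setT f -> cintegrable mu setT g -> cintegrable mu setT (f \+ g).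
  move=> [fr fi] [gr gi]; split.
    have := integrableD measurableT fr gr; apply: eq_integrable => // x _ /=.
    by case: (f x); case: (g x).
  have := integrableD measurableT fi gi; apply: eq_integrable => // x _ /=.
  by case: (f x); case: (g x).
move=> Zu Zv; have [iu u0] := Zu; have [iv v0] := Zv; split=> [|n]; first exact: iD.
rewrite (_ : (fun z => _) = (fun z => circle_val z ^ n * u z) \+ (fun z => circle_val z ^ n * v z)).
  by rewrite cintegralD// ?u0 ?v0 ?addr0//; exact: fourier_null_cintegrable_pow.
by apply/funext => z /=; rewrite mulrDr.
Qed.

Lemma fourier_nullZ (a : R[i]) u : fourier_null u -> fourier_null (fun z => a * u z).
Proof.
move=> Zu; have [iu u0] := Zu; split=> [|n].
  apply: (@cintegrable_bounded_mul _ _ _ _ _ measurableT _ _ (rnorm a)) => //.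
under eq_fun do rewrite mulrCA.
by rewrite cintegralZ// ?u0 ?mulr0//; exact: fourier_null_cintegrable_pow.
Qed.

Lemma fourier_null_pow (k : int) u : fourier_null u -> fourier_null (fun z => circle_val z ^ k * u z).
Proof.
move=> Zu; split=> [|n]; first exact: fourier_null_cintegrable_pow.
under eq_fun do rewrite mulrA -expfzDr ?circle_val_neq0//.
exact: Zu.2.
Qed.

Lemma eq_fourier_null u v : u =1 v -> fourier_null u -> fourier_null v.
Proof. by move=> /funext ->. Qed.

Lemma fourier_multiplier_cst (a : R) : fourier_multiplier (cst a).
Proof.
split; first exact: measurable_cst; first by exists `|a|.
by move=> u; exact: (fourier_nullZ a%:C%C).
Qed.

Lemma fourier_multiplierM g h : fourier_multiplier g -> fourier_multiplier h ->
  fourier_multiplier (fun z => g z * h z).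
Proof.
move=> [mg [M gM] Zg] [mh [N hN] Zh]; split; first exact: measurable_funM.
  by exists (M * N) => z; rewrite normrM ler_pM.
move=> u /Zh/Zg; apply: eq_fourier_null => z.
by rewrite mulrA -rmorphM.
Qed.

Lemma fourier_multiplierD g h : fourier_multiplier g -> fourier_multiplier h ->
  fourier_multiplier (fun z => g z + h z).
Proof.
move=> [mg [M gM] Zg] [mh [N hN] Zh]; split; first exact: measurable_funD.
  by exists (M + N) => z; rewrite (le_trans (ler_normD _ _))// lerD.
move=> u Zu; have := fourier_nullD (Zg _ Zu) (Zh _ Zu); apply: eq_fourier_null => z.
by rewrite /= -mulrDl -rmorphD.
Qed.

Lemma fourier_multiplierB g h : fourier_multiplier g -> fourier_multiplier h ->
  fourier_multiplier (fun z => g z - h z).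
Proof.
move=> Mg Mh; have := fourier_multiplierD Mg (fourier_multiplierM (fourier_multiplier_cst (-1)) Mh).
by rewrite (_ : (fun z => _) = (fun z => g z - h z))//; apply/funext => z; rewrite mulN1r.
Qed.

Lemma measurable_Re_circle : measurable_fun setT (fun z : C => complex.Re (circle_val z)).
Proof. by have [] := @cmeasurable_circle_val R setT. Qed.

Lemma measurable_Im_circle : measurable_fun setT (fun z : C => complex.Im (circle_val z)).
Proof. by have [] := @cmeasurable_circle_val R setT. Qed.

Lemma circle_sqr (z : C) : complex.Re (circle_val z) ^+ 2 + complex.Im (circle_val z) ^+ 2 = 1.
Proof.
rewrite -rnorm2E; suff -> : rnorm (circle_val z) = 1 by rewrite expr1n.
by apply: complexI; rewrite rnormE norm_circle_val.
Qed.

(** On the circle Re z = (z + z^-1) / 2, and multiplying by a power of z only shifts the Fourier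
    coefficients. The next lemma uses Im z = (z - z^-1) / (2 i) in the same way, with 1 / (2 i)
    written as i / -2. *)
Lemma fourier_multiplier_Re : fourier_multiplier (fun z => complex.Re (circle_val z)).
Proof.
split; first exact: measurable_Re_circle.
  exists 1 => z; rewrite -(@ler_pXn2r _ 2) ?nnegrE// real_normK ?num_real// expr1n.
  by rewrite -(circle_sqr z) lerDl sqr_ge0.
move=> u Zu; have := fourier_nullZ 2^-1 (fourier_nullD (fourier_null_pow 1 Zu) (fourier_null_pow (-1) Zu)).
apply: eq_fourier_null => z; rewrite /= -mulrDl mulrA; congr (_ * _).
rewrite -conj_circle_val expr1z; case: (circle_val z) => a b.
have -> : ((a +i* b)%C^* : R[i]) = (a -i* b)%C by [].
apply: (@mulfI _ 2); first by rewrite pnatr_eq0.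
by rewrite mulrA mulfV ?pnatr_eq0// mul1r mulr_natl mulr2n; apply/eqP; rewrite eq_complex /= subrr addr0 !eqxx.
Qed.

Lemma fourier_multiplier_Im : fourier_multiplier (fun z => complex.Im (circle_val z)).
Proof.
split; first exact: measurable_Im_circle.
  exists 1 => z; rewrite -(@ler_pXn2r _ 2) ?nnegrE// real_normK ?num_real// expr1n.
  by rewrite -(circle_sqr z) lerDr sqr_ge0.
move=> u Zu; have := fourier_nullZ ('i%C / -2) (fourier_nullD (fourier_null_pow 1 Zu)
  (fourier_nullZ (-1) (fourier_null_pow (-1) Zu))).
apply: eq_fourier_null => z; rewrite /= mulrA -mulrDl mulrA; congr (_ * _).
rewrite -conj_circle_val expr1z; case: (circle_val z) => a b.
have -> : ((a +i* b)%C^* : R[i]) = (a -i* b)%C by [].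
apply: (@mulfI _ (-2)); first by rewrite oppr_eq0 pnatr_eq0.
rewrite mulrA [_ / _]mulrC mulrA mulfV ?oppr_eq0 ?pnatr_eq0// mul1r mulN1r.
rewrite mulNr mulr_natl mulr2n; apply/eqP; rewrite eq_complex /=.
by apply/andP; split; apply/eqP; ring.
Qed.

Lemma fourier_multiplier_lim (g_ : nat -> C -> R) (g : C -> R) (M : R) :
  (forall k, fourier_multiplier (g_ k)) -> (forall k z, `|g_ k z| <= M) ->
  (forall z, g_ ^~ z @ \oo --> g z) -> fourier_multiplier g.
Proof.
move=> Mg gM gg.
have mg : measurable_fun setT g.
  by apply: (@measurable_fun_cvg _ _ _ _ g_) => // k; have [] := Mg k.
have gM' z : `|g z| <= M.
  have h : (fun k => `|g_ k z|) @ \oo --> `|g z| by apply: cvg_norm; exact: gg.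
  by rewrite -(cvg_lim _ h)//; apply: limr_le; [exact: cvgP h|exact: nearW].
split=> //; first by exists M.
move=> u Zu; have [iu u0] := Zu; split=> [|n].
  apply: (@cintegrable_bounded_mul _ _ _ _ _ measurableT (fun z => (g z)%:C%C) _ M) => //.
  move=> z _; rewrite (_ : rnorm _ = `|g z|)//.
  by apply: complexI; rewrite rnormE normc_def /= expr0n addr0 sqrtr_sqr.
under eq_fun do rewrite mulrCA.
have [ihr ihi] := fourier_null_cintegrable_pow n Zu.
have key k : cintegral mu setT (fun z => (g_ k z)%:C%C * (circle_val z ^ n * u z)) = 0.
  have [_ _ /(_ u Zu)[_ /(_ n)]] := Mg k.
  by under eq_fun do rewrite mulrCA.
apply/eqP; rewrite eq_complex /=; apply/andP; split; apply/eqP.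
  transitivity (\int[mu]_(x in setT) (g x * complex.Re (circle_val x ^ n * u x))).
    by apply: eq_Rintegral => z _; case: (_ * u z) => a b /=; rewrite mul0r subr0.
  apply: (@Rintegral_bounded_cvg0 _ _ _ _ _ measurableT g_ _ _ M) => //.
    by move=> k; have [] := Mg k.
  move=> k; have /eqP := key k; rewrite eq_complex => /andP[/eqP /= h _]; rewrite -[RHS]h.
  by apply: eq_Rintegral => z _; case: (_ * u z) => a b /=; rewrite mul0r subr0.
transitivity (\int[mu]_(x in setT) (g x * complex.Im (circle_val x ^ n * u x))).
  by apply: eq_Rintegral => z _; case: (_ * u z) => a b /=; rewrite mul0r addr0.
apply: (@Rintegral_bounded_cvg0 _ _ _ _ _ measurableT g_ _ _ M) => //.
  by move=> k; have [] := Mg k.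
move=> k; have /eqP := key k; rewrite eq_complex => /andP[_ /eqP /= h]; rewrite -[RHS]h.
by apply: eq_Rintegral => z _; case: (_ * u z) => a b /=; rewrite mul0r addr0.
Qed.

End fourier_uniqueness.

(** * From the sign function to the indicators of Borel sets *)

Section sign_iteration.
Variable R : realType.

(* Odd, with fixed points -1, 0 and 1, and attracting ]0, 1] to 1: its iterates are
   polynomials converging to the sign function on [-1, 1]. *)
Definition sg_step (s : R) : R := (3 * s - s ^+ 3) / 2.

(** For 0 < t <= 1 the iterates w never decrease, and 1 - sg_step w = (1 - w) (1 - (w + w^2) / 2),
    so that the distance to 1 shrinks at each step by a factor at most 1 - t / 2. Oddness settles
    negative values. *)
Lemma sg_step_cvg (s : R) : `|s| <= 1 -> (fun n => iter n sg_step s) @ \oo --> Num.sg s.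
Proof.
have pos (t : R) : 0 < t <= 1 -> (fun n => iter n sg_step t) @ \oo --> (1 : R).
  move=> /andP[t0 t1].
  have bnd n : t <= iter n sg_step t <= 1 /\ 1 - iter n sg_step t <= (1 - t / 2) ^+ n.
    elim: n => [|n [/andP[lo hi] IH]]; first by rewrite lexx t1 expr0 gerBl ltW.
    rewrite iterS; set w := iter n sg_step t in lo hi IH *.
    have w0 : 0 < w by exact: lt_le_trans lo.
    have E : 1 - sg_step w = (1 - w) * ((1 - w) * (2 + w) / 2) by rewrite /sg_step; field.
    have w1 : 0 <= 1 - w by rewrite subr_ge0.
    have f0 : 0 <= (1 - w) * (2 + w) / 2 by rewrite !mulr_ge0// ?addr_ge0// ?ltW// invr_gt0.
    have f1 : (1 - w) * (2 + w) / 2 <= 1 - t / 2.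
      have : 0 <= w ^+ 2 by rewrite sqr_ge0.
      by rewrite expr2; lra.
    split.
      apply/andP; split.
        apply: le_trans lo _; have E' : sg_step w - w = w * ((1 - w) * (1 + w)) / 2.
          by rewrite /sg_step; field.
        rewrite -subr_ge0 E' divr_ge0// mulr_ge0 ?(ltW w0)// mulr_ge0// addr_ge0// ltW//.
      by rewrite -subr_ge0 E mulr_ge0.
    by rewrite E exprSr ler_pM.
  apply/cvgrPdist_lt => e e0.
  have [||N NP] := @exp_small R (1 - t / 2) e; [lra|by []|].
  exists N => // n /= /NP; apply: le_lt_trans; have [/andP[_ h] h'] := bnd n.
  by rewrite ger0_norm// subr_ge0.
have odd (t : R) n : iter n sg_step (- t) = - iter n sg_step t.
  by elim: n => //= n ->; rewrite /sg_step; field.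
move=> s1; have [s0|s0|->] := ltgtP s 0.
- rewrite ltr0_sg// -[s]opprK; under eq_fun do rewrite odd.
  by apply: cvgN; apply: pos; rewrite oppr_gt0 s0/= -ltr0_norm.
- by rewrite gtr0_sg//; apply: pos; rewrite s0 -(gtr0_norm s0).
- rewrite sgr0 (_ : (fun n => _) = cst 0); first exact: cvg_cst.
  by apply/funext; elim=> //= n ->; rewrite /sg_step expr0n mulr0 subrr mul0r.
Qed.

Lemma sg_step_bound (s : R) n : `|s| <= 1 -> `|iter n sg_step s| <= 1.
Proof.
move=> s1; elim: n => //= n; set w := iter n sg_step s => w1.
rewrite /sg_step ler_norml; move: w1; rewrite ler_norml => /andP[h1 h2].
have a1 : 0 <= (1 - w) * ((1 - w) * (2 + w)) by rewrite !mulr_ge0//; lra.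
have a2 : 0 <= (1 + w) * ((1 + w) * (2 - w)) by rewrite !mulr_ge0//; lra.
have e1 : (1 - w) * ((1 - w) * (2 + w)) = 2 - (3 * w - w ^+ 3) by ring.
have e2 : (1 + w) * ((1 + w) * (2 - w)) = 2 + (3 * w - w ^+ 3) by ring.
by rewrite e1 in a1; rewrite e2 in a2; apply/andP; split; lra.
Qed.

End sign_iteration.

Section borel_multipliers.
Variable R : realType.
Local Notation mu := (@arc_length R).
Local Notation C := (borel_circle R).

Lemma fourier_multiplier_gt0 (g : C -> R) : fourier_multiplier g ->
  fourier_multiplier (\1_[set z | 0 < g z]).
Proof.
move=> Mg; have [_ [M gM] _] := Mg.
pose K := `|M| + 1; have K0 : 0 < K by rewrite ltr_wpDl.
pose h z := K^-1 * g z.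
have Mh : fourier_multiplier h by apply: (fourier_multiplierM (fourier_multiplier_cst _)).
have h1 z : `|h z| <= 1.
  rewrite normrM gtr0_norm ?invr_gt0// mulrC ler_pdivrMr// mul1r.
  by apply: le_trans (gM z) _; rewrite /K (le_trans (ler_norm M))// lerDl.
have Miter n : fourier_multiplier (fun z => iter n (@sg_step R) (h z)).
  elim: n => //= n IH; rewrite (_ : (fun z => _) = (fun z => 2^-1 *
    (3 * iter n (@sg_step R) (h z) - iter n (@sg_step R) (h z) * (iter n (@sg_step R) (h z)
      * iter n (@sg_step R) (h z))))).
    apply: fourier_multiplierM; first exact: fourier_multiplier_cst.
    apply: fourier_multiplierB.
      by apply: fourier_multiplierM => //; exact: fourier_multiplier_cst.
    by do 2 apply: fourier_multiplierM => //.
  by apply/funext => z; rewrite /sg_step mulrC.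
have Msg : fourier_multiplier (fun z => Num.sg (h z)).
  apply: (@fourier_multiplier_lim _ _ _ 1 Miter).
    by move=> k z; exact: sg_step_bound.
  by move=> z; exact: sg_step_cvg.
(* The polynomial (s^2 + s) / 2 takes the values 0, 0, 1 at s = -1, 0, 1. *)
rewrite (_ : \1__ = (fun z => 2^-1 * (Num.sg (h z) * Num.sg (h z) + Num.sg (h z)))).
  apply: fourier_multiplierM; first exact: fourier_multiplier_cst.
  by apply: fourier_multiplierD => //; exact: fourier_multiplierM.
apply/funext => z; rewrite indicE /h sgrM (gtr0_sg (_ : 0 < K^-1)) ?invr_gt0// mul1r.
have [gz|gz|gz] := ltgtP (g z) 0.
- by rewrite memNset/= ?ltr0_sg//; [lra|rewrite /= ltNge (ltW gz)].
- by rewrite mem_set//= gtr0_sg//; lra.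
- by rewrite memNset/= gz ?sgr0 ?ltxx//; lra.
Qed.

Definition multiplier_set (A : set C) := fourier_multiplier (\1_A).

Lemma multiplier_setC A : multiplier_set A -> multiplier_set (~` A).
Proof.
move=> MA; rewrite /multiplier_set (_ : \1__ = (fun z => 1 - \1_A z)).
  by apply: fourier_multiplierB => //; exact: fourier_multiplier_cst.
apply/funext => z; rewrite !indicE in_setC; case: (z \in A) => /=; lra.
Qed.

(** The indicator of a finite union is 1 minus the product of the 1 - 1_(A k), a polynomial in
    multipliers. These indicators are bounded by 1 and stationary at every point. *)
Lemma multiplier_bigcup (A : nat -> set C) : (forall k, multiplier_set (A k)) ->
  multiplier_set (\bigcup_k A k).
Proof.
move=> MA; pose B n := \prod_(k < n) (1 - \1_(A k) : C -> R).
pose p n (z : C) : R := 1 - \prod_(k < n) (1 - \1_(A k) z).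
have pE n z : p n z = \1_(\bigcup_(k in [set k | (k < n)%N]) A k) z.
  rewrite /p indicE; have [[k /= kn Akz]|nA] := pselect ((\bigcup_(k in [set k | (k < n)%N]) A k) z).
    rewrite mem_set; last by exists k.
    by rewrite (bigD1 (Ordinal kn))//= indicE mem_set// subrr mul0r subr0.
  rewrite memNset// big1 ?subrr// => k _; rewrite indicE memNset ?subr0// => Az.
  by apply: nA; exists k => /=.
have Mp n : fourier_multiplier (p n).
  apply: fourier_multiplierB; first exact: fourier_multiplier_cst.
  elim: n => [|n IH].
    by under eq_fun do rewrite big_ord0; exact: fourier_multiplier_cst.
  under eq_fun do rewrite big_ord_recr /=; apply: fourier_multiplierM => //.
  by apply: fourier_multiplierB; [exact: fourier_multiplier_cst|exact: MA].
apply: (@fourier_multiplier_lim _ _ _ 1 Mp).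
  by move=> n z; rewrite pE indicE ger0_norm// lern1 leq_b1.
move=> z; have [[k _ Akz]|nA] := pselect ((\bigcup_k A k) z).
  rewrite indicE mem_set; last by exists k.
  apply/cvgrPdist_lt => e e0; exists k.+1 => // n /= kn.
  by rewrite pE indicE mem_set ?subrr ?normr0//; exists k.
rewrite indicE memNset//; apply/cvgrPdist_lt => e e0; exists 0%N => // n _.
rewrite pE indicE memNset ?subrr ?normr0// => -[k _ Ak]; apply: nA; by exists k.
Qed.

Lemma circle_open_ball (U : set C) (z : C) : open (U : set (circle R)) -> U z ->
  exists2 e : R, 0 < e & forall w : C, rnorm (circle_val w - circle_val z) < e -> U w.
Proof.
move=> [W oW <-] Wz.
have /nbhs_ballP[[e e'] /=] : nbhs (circle_val z : R[i]^o) W by exact: open_nbhs_nbhs.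
rewrite ltcE /= => /andP[/eqP -> e0] {e'} eW.
exists e => // w wz; apply: eW; rewrite -ball_normE /= -rnormE ltcR.
by rewrite (@rnormBC R R[i]^o).
Qed.

Lemma open_multiplier (U : set C) : open (U : set (circle R)) -> multiplier_set U.
Proof.
move=> oU.
(* Discs with rational centre and radius 1 / (k + 1), written as positivity sets for
   [fourier_multiplier_gt0]. They are countably many; those not inside U are replaced by the empty
   set. *)
pose B (q : rat * rat * nat) := [set w : C | 0 < (q.2.+1%:R^-1) ^+ 2 -
  ((complex.Re (circle_val w) - ratr q.1.1) ^+ 2 + (complex.Im (circle_val w) - ratr q.1.2) ^+ 2)].
pose A n := if unpickle n is Some q then (if `[< B q `<=` U >] then B q else set0) else set0.
have AE q : A (pickle q) = if `[< B q `<=` U >] then B q else set0 by rewrite /A pickleK.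
have -> : U = \bigcup_n A n.
  apply/seteqP; split => [z Uz|z [n _]]; last first.
    by rewrite /A; case: unpickle => [q|//]; case: ifPn => [/asboolP|//]; exact.
  have [e e0 eU] := circle_open_ball oU Uz.
  have [|k kP] := @invS_small R (e / 2); first by rewrite divr_gt0.
  have {kP} ke := kP k (leqnn k); set r := k.+1%:R^-1 in ke.
  have r0 : 0 < r by rewrite invr_gt0.
  pose x := complex.Re (circle_val z); pose y := complex.Im (circle_val z).
  (* An error below r^2 / 2 in each squared coordinate puts z in the disc; all points of the disc
     are then within 2 r < e of z. *)
  have [a] : exists a : rat, (x - ratr a) ^+ 2 < r ^+ 2 / 2.
    have /rat_in_itvoo[a] : x - r / 2 < x + r / 2 by lra.
    rewrite inE /= => /itvP h; exists a.
    have h1 : x - r / 2 < ratr a by rewrite h.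
    have h2 : ratr a < x + r / 2 by rewrite h.
    have : `|x - ratr a| < r / 2 by rewrite ltr_norml; apply/andP; split; lra.
    rewrite -(@ltr_pXn2r _ 2) ?nnegrE ?divr_ge0 ?(ltW r0)// real_normK ?num_real//.
    by have : 0 < r ^+ 2 by [rewrite exprn_gt0|]; lra.
  have [b] : exists b : rat, (y - ratr b) ^+ 2 < r ^+ 2 / 2.
    have /rat_in_itvoo[b] : y - r / 2 < y + r / 2 by lra.
    rewrite inE /= => /itvP h; exists b.
    have h1 : y - r / 2 < ratr b by rewrite h.
    have h2 : ratr b < y + r / 2 by rewrite h.
    have : `|y - ratr b| < r / 2 by rewrite ltr_norml; apply/andP; split; lra.
    rewrite -(@ltr_pXn2r _ 2) ?nnegrE ?divr_ge0 ?(ltW r0)// real_normK ?num_real//.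
    by have : 0 < r ^+ 2 by [rewrite exprn_gt0|]; lra.
  move=> yb xa; exists (pickle (a, b, k)); [by []|rewrite AE].
  rewrite asboolT; first by rewrite /B /= -/r -/x -/y; lra.
  move=> w; rewrite /B /= -/r => wB; apply: eU.
  rewrite -(@ltr_pXn2r _ 2) ?nnegrE ?rnorm_ge0 ?(ltW e0)// rnorm2E !raddfB /= -/x -/y.
  have er : (2 * r) ^+ 2 < e ^+ 2.
    by rewrite ltr_pXn2r ?nnegrE ?(ltW e0) ?mulr_ge0 ?(ltW r0)//; lra.
  move: wB er yb xa; set x' := complex.Re _; set y' := complex.Im _.
  set a' := ratr a; set b' := ratr b.
  have sx : (x' - x) ^+ 2 <= 2 * (x' - a') ^+ 2 + 2 * (x - a') ^+ 2.
    rewrite -subr_ge0 (_ : _ - _ = (x' + x - 2 * a') ^+ 2) ?sqr_ge0//; ring.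
  have sy : (y' - y) ^+ 2 <= 2 * (y' - b') ^+ 2 + 2 * (y - b') ^+ 2.
    rewrite -subr_ge0 (_ : _ - _ = (y' + y - 2 * b') ^+ 2) ?sqr_ge0//; ring.
  by rewrite exprMn; lra.
apply: multiplier_bigcup => n; rewrite /A; case: unpickle => [q|]; last first.
  rewrite /multiplier_set indic0; exact: fourier_multiplier_cst.
case: ifPn => _; last by rewrite /multiplier_set indic0; exact: fourier_multiplier_cst.
apply: fourier_multiplier_gt0; apply: fourier_multiplierB; first exact: fourier_multiplier_cst.
have sq h : fourier_multiplier h -> fourier_multiplier (fun z => h z ^+ 2).
  by move=> Mh; under eq_fun do rewrite expr2; exact: fourier_multiplierM.
apply: fourier_multiplierD; apply: (sq); apply: fourier_multiplierB;
  first [exact: fourier_multiplier_cst | exact: fourier_multiplier_Re | exact: fourier_multiplier_Im].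
Qed.

Lemma measurable_multiplier (A : set C) : measurable A -> multiplier_set A.
Proof.
apply: smallest_sub; last by move=> U; exact: open_multiplier.
split.
- by rewrite /multiplier_set indic0; exact: fourier_multiplier_cst.
- by move=> B MB; rewrite setTD; exact: multiplier_setC.
- by move=> F MF; exact: multiplier_bigcup.
Qed.

(** The coefficient of index 0 of 1_A u is the integral of u over A; once all indicators are
    multipliers, u has zero integral over every Borel set. *)
Lemma fourier_uniqueness (u : C -> R[i]) : fourier_null u -> {ae mu, forall z, u z = 0}.
Proof.
move=> Zu; have [[ur ui] _] := Zu.
have key A : measurable A ->
    \int[mu]_(z in A) complex.Re (u z) = 0 /\ \int[mu]_(z in A) complex.Im (u z) = 0.
  move=> mA; have [_ _ /(_ u Zu)[_ /(_ 0)]] := measurable_multiplier mA.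
  under eq_fun do rewrite expr0z mul1r.
  move=> /eqP; rewrite eq_complex /= => /andP[/eqP h1 /eqP h2].
  split; rewrite Rintegral_mkcond; [rewrite -[RHS]h1|rewrite -[RHS]h2];
    apply: eq_Rintegral => z _; rewrite patchE indicE; case: (z \in A); case: (u z) => a b /=; rewrite /= ?mul1r ?mul0r ?subr0 ?addr0//.
have zero (f : C -> R) : mu.-integrable setT (EFin \o f) ->
    (forall A, measurable A -> \int[mu]_(z in A) f z = 0) -> {ae mu, forall z, f z = 0}.
  move=> intf f0.
  have h : ae_eq mu setT (EFin \o f) (cst 0%E).
    apply: integral_ae_eq => // E _ mE.
    rewrite integral0 -[LHS]fineK; first by rewrite -[fine _]/(\int[mu]_(z in E) f z) f0.
    by apply: integrable_fin_num => //; apply: integrableS intf.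
  by move: h; apply: filterS => t ft; have [] := ft Logic.I.
have hr := zero _ ur (fun A mA => (key A mA).1).
have hi := zero _ ui (fun A mA => (key A mA).2).
by move: hr hi; apply: filterS2 => t; case: (u t) => a b /= -> ->.
Qed.

End borel_multipliers.

(** * Moments of the arc length measure *)

Section circle_moments.
Variable R : realType.
Local Notation mu := (@arc_length R).
Local Notation C := (borel_circle R).
Local Notation leb := (@lebesgue_measure R).

(** Arc length is the image of Lebesgue measure on [0, 1[. The endpoint 1, which is null, is added
    so that the fundamental theorem of calculus applies; boundedness supplies the integrability for
    the change of variables. *)
Lemma integral_circle (f : C -> R) (M : R) : measurable_fun setT f ->
  (forall z, `|f z| <= M) ->
  (\int[mu]_(z in setT) (f z)%:E = \int[leb]_(t in `[0%R, 1%R]) (f (expi t))%:E)%E.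
Proof.
move=> mf fM.
pose I01 : set (measurableTypeR R) := `[0, 1[%classic.
have mI : measurable I01 by exact: measurable_itv.
pose nu : {measure set (measurableTypeR R) -> \bar R} := mrestr leb (measurable_itv `[0%R, 1%R[).
have nuE A : nu A = leb (A `&` I01) by [].
have mfe : measurable_fun setT (fun t => f (expi t)).
  by apply: (measurableT_comp mf); exact: measurable_expi.
have nuT : (nu setT < +oo)%E.
  by rewrite nuE setTI lebesgue_measure_itv /= lte01 -EFinB subr0 ltry.
have ife : nu.-integrable setT (EFin \o (fun t => f (expi t))).
  apply: measurable_bounded_integrable => //.
  exists M; split; first exact: num_real.
  by move=> N MN x _; apply: le_trans (fM _) (ltW MN).
have -> : (\int[mu]_(z in setT) (f z)%:E = \int[nu]_(t in setT) (f (expi t))%:E)%E.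
  have mfE : measurable_fun setT (EFin \o f) by exact/measurable_EFinP.
  exact: (@integral_pushforward _ _ _ _ _ _ (@measurable_expi R) nu setT (EFin \o f) mfE ife measurableT).
rewrite (@negligible_integral _ _ _ nu setT (~` I01)) ?setTD ?setCK//; last 2 first.
- exact: measurableC.
- by rewrite nuE setICl measure0.
rewrite -integral_itv_bndo_bndc; last first.
  by apply/measurable_EFinP; exact: measurable_funS mfe.
apply: eq_measure_integral => A mA AI.
by rewrite nuE setIidl.
Qed.

Lemma cisD (x y : R) : cis (x + y) = cis x * cis y.
Proof. by rewrite /cis cosD sinD; apply/eqP; rewrite eq_complex /= eqxx/= addrC. Qed.

Lemma cisX (x : R) n : cis x ^+ n = cis (n%:R * x).
Proof.
elim: n => [|n IH]; first by rewrite expr0 mul0r /cis cos0 sin0.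
by rewrite exprS IH -cisD -natr1 mulrDl mul1r addrC.
Qed.

Lemma cis2pi (n : nat) : cis (n%:R * (2 * pi)) = 1 :> R[i].
Proof.
rewrite -cisX (_ : cis (2 * pi) = 1) ?expr1n//.
by rewrite /cis mulr_natl cos2pi sin2pi.
Qed.

Lemma is_derive_lin (c t : R) : is_derive t 1 (fun t : R => c * t) c.
Proof.
have := @is_deriveZ R R^o R^o id c t 1 1 (is_derive_id _ _).
by rewrite /GRing.scale /= mulr1.
Qed.

Lemma integral_derive01 (f F : R -> R) : continuous f ->
  (forall t : R, is_derive t 1 F (f t)) ->
  (\int[leb]_(t in `[0%R, 1%R]) (f t)%:E = (F 1)%:E - (F 0)%:E)%E.
Proof.
move=> cf dF.
have dF' t : derivable F t 1 by case: (dF t).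
have cF t : {for t, continuous F} by apply/differentiable_continuous/derivable1_diffP.
apply: continuous_FTC2 => //.
- exact: continuous_subspaceT.
- split=> [x _||]; first exact: dF'.
    by apply: cvg_at_right_filter; exact: cF.
  by apply: cvg_at_left_filter; exact: cF.
- by move=> x _; rewrite derive1E; case: (dF x).
Qed.

Lemma continuous_comp_lin (f : R -> R) (c : R) : continuous f -> continuous (fun t => f (c * t)).
Proof.
move=> cf t; apply: (@continuous_comp R R R ( *%R c) f); last exact: cf.
exact: mulrl_continuous.
Qed.

(** The real and imaginary parts pull back to cos (c t) and sin (c t) with c = 2 pi (n + 1), whose
    primitives agree at 0 and 1. *)
Lemma circle_moment_nat (n : nat) :
  cintegral mu setT (fun z : C => circle_val z ^+ n.+1) = 0.
Proof.
have bnd (p : R[i] -> R) : (forall z, `|p z| <= rnorm z) ->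
    forall z : C, `|p (circle_val z ^+ n.+1)| <= 1.
  by move=> pz z; rewrite -(rnorm_circle_pow z n.+1); exact: pz.
have [mr mi] := @cmeasurable_circle_pow R n.+1%:Z.
pose c : R := n.+1%:R * (2 * pi).
have c0 : c != 0 by rewrite gt_eqF// !mulr_gt0// pi_gt0.
have powE t : circle_val (expi t : C) ^ n.+1%:Z = cis (c * t).
  by rewrite -exprnP -[circle_val _]/(cis (2 * pi * t)) cisX mulrA.
have c1 : cos (c * 1) = 1 :> R /\ sin (c * 1) = 0 :> R.
  by rewrite mulr1; have := cis2pi n.+1; rewrite -/c => -[].
have Re0 : \int[mu]_(z in setT) complex.Re (circle_val z ^+ n.+1) = 0.
  rewrite /Rintegral (integral_circle mr (M := 1)); last first.
    by apply: bnd => z; exact: Re_rnorm.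
  under eq_integral do rewrite powE /=.
  have dF (t : R) : is_derive t 1 (fun t => c^-1 * sin (c * t)) (cos (c * t)).
    have h := @is_derive1_comp R (@sin R) (fun t => c * t) t _ _ (is_derive_sin _) (is_derive_lin c t).
    have := @is_deriveZ R R^o R^o _ c^-1 t 1 _ h.
    by rewrite /GRing.scale /= mulrCA mulVf// mulr1.
  rewrite (integral_derive01 (continuous_comp_lin (c := c) (@continuous_cos R)) dF).
  by rewrite c1.2 !mulr0 sin0 mulr0 subee.
have Im0 : \int[mu]_(z in setT) complex.Im (circle_val z ^+ n.+1) = 0.
  rewrite /Rintegral (integral_circle mi (M := 1)); last first.
    by apply: bnd => z; exact: Im_rnorm.
  under eq_integral do rewrite powE /=.
  have dF (t : R) : is_derive t 1 (fun t => - c^-1 * cos (c * t)) (sin (c * t)).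
    have h := @is_derive1_comp R (@cos R) (fun t => c * t) t _ _ (is_derive_cos _) (is_derive_lin c t).
    apply: is_derive_eq (@is_deriveZ R R^o R^o _ (- c^-1) t 1 _ h) _.
    by rewrite /GRing.scale /=; field.
  rewrite (integral_derive01 (continuous_comp_lin (c := c) (@continuous_sin R)) dF).
  by rewrite c1.1 mulr0 cos0 subee.
by rewrite /cintegral Re0 Im0.
Qed.

Lemma circle_moment (n : int) :
  cintegral mu setT (fun z : C => circle_val z ^ n) = (n == 0)%:R.
Proof.
have int_pow k : cintegrable mu setT (fun z : C => circle_val z ^ k).
  have := @cintegrable_bounded_mul _ _ _ mu setT measurableT (fun z : C => circle_val z ^ k)
    (cst 1) 1 (@cmeasurable_circle_pow R k).
  under eq_fun do rewrite mulr1; apply.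
    by move=> z _; rewrite rnorm_circle_pow.
  split; apply: measurable_bounded_integrable => //=; rewrite ?arc_lengthT ?ltry//.
    by exists 1; split=> // x x1 z _ /=; rewrite normr1 ltW.
  by exists 1; split=> // x x1 z _ /=; rewrite normr0 ltW// (lt_trans ltr01).
case: n => [[|n]|n].
- under eq_fun do rewrite expr0z.
  rewrite /cintegral /= !Rintegral_cst//= [X in fine X]arc_lengthT /= mul1r mul0r.
  by [].
- exact: circle_moment_nat.
- rewrite (_ : (fun z => _) = (fun z : C => (circle_val z ^ n.+1%:Z)^*)).
    rewrite (cintegral_conj measurableT (int_pow n.+1)).
    by rewrite [cintegral _ _ _]circle_moment_nat rmorph0.
  by apply/funext => z; rewrite conj_circle_pow.
Qed.

End circle_moments.

(** * Orbits, frames and Riesz bases indexed by the integers *)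

Section int_enumeration.

(** The order 0, -1, 1, -2, 2, ... That index 0 goes to 0 matters: the constant polynomial 1 then
    stands for the function 1, and the term of index 0 of an orbit is f_0. *)
Definition int_enum (k : nat) : int := if odd k then Negz k./2 else Posz k./2.

Definition int_rank (m : int) : nat :=
  match m with Posz n => n.*2 | Negz n => n.*2.+1 end.

Lemma int_rankK : cancel int_rank int_enum.
Proof.
case=> n; rewrite /int_enum /=; first by rewrite odd_double doubleK.
by rewrite odd_double /= uphalf_double.
Qed.

Lemma int_enumK : cancel int_enum int_rank.
Proof.
move=> k; rewrite /int_enum; case: ifPn => ok /=; last by rewrite even_halfK.
by rewrite -[RHS]odd_double_half ok.
Qed.

Lemma int_enum_bij : set_bij [set: nat] [set: int] int_enum.
Proof.
split=> //.
- by move=> m n _ _; exact: (can_inj int_enumK).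
- by move=> m _; exists (int_rank m) => //; exact: int_rankK.
Qed.

End int_enumeration.

Section orbits.
Variable R : realType.

Lemma orbit_intertwine (X Y : normedModType R[i]) (T : X -> X) (T' : Y -> Y) (S : X -> Y) x n :
  bijective T -> bijective T' -> (forall x, S (T x) = T' (S x)) ->
  S (operator_orbit T x n) = operator_orbit T' (S x) n.
Proof.
move=> bT bT' ST.
have [TK KT] := operator_inverseK bT; have [T'K KT'] := operator_inverseK bT'.
have SI y : S (operator_inverse T y) = operator_inverse T' (S y).
  by apply: (bij_inj bT'); rewrite T'K -ST TK.
case: n => n; rewrite /operator_orbit.
  by elim: n => //= n <-; rewrite ST.
by elim: n.+1 => //= k <-; rewrite SI.
Qed.

End orbits.

Section int_families.
Variables (R : realType) (H : innerProductType R) (F : int -> H).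
Let f := F \o int_enum.

Lemma esum_int (a : int -> \bar R) : (forall n, 0 <= a n)%E ->
  (\esum_(n in [set: int]) a n = \sum_(k <oo) a (int_enum k))%E.
Proof.
by move=> a0; rewrite (@reindex_esum _ _ _ _ _ _ a int_enum_bij) nneseries_esumT.
Qed.

(** Halving the lower bound lets a finite partial sum reach it: the full sum, at least A |g|^2,
    exceeds A |g|^2 / 2 strictly unless g = 0, where the empty sum suffices. *)
Lemma frame_nat : frame F -> exists A B : R, [/\ 0 < A, 0 < B & forall g : H,
  (forall n, \sum_(i < n) rnorm (inner g (f i)) ^+ 2 <= B * rnorm g ^+ 2) /\
  exists n, A * rnorm g ^+ 2 <= \sum_(i < n) rnorm (inner g (f i)) ^+ 2].
Proof.
move=> [A [B [A0 B0 AB]]]; exists (A / 2), B; split=> [||g]; [by rewrite divr_gt0|by []|].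
pose a n : \bar R := (rnorm (inner g (F n)) ^+ 2)%:E.
have a0 n : (0 <= a n)%E by rewrite lee_fin sqr_ge0.
have sumE n : (\sum_(0 <= i < n) a (int_enum i))%E = (\sum_(i < n) rnorm (inner g (f i)) ^+ 2)%:E.
  by rewrite big_mkord sumEFin.
have /andP[] := AB g; rewrite (esum_int a0) => lo hi; split=> [n|].
  rewrite -lee_fin -sumE; apply: le_trans hi.
  exact: nneseries_lim_ge.
apply: contrapT => /forallNP h.
have g0 : 0 < rnorm g ^+ 2.
  rewrite lt_neqAle sqr_ge0 andbT; apply/negP => /eqP g0.
  by apply: (h 0%N); rewrite -g0 mulr0 big_ord0.
have : (\sum_(k <oo) a (int_enum k) <= (A / 2 * rnorm g ^+ 2)%:E)%E.
  apply: lime_le; first by apply: is_cvg_nneseries => n _ _; exact: a0.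
  apply: nearW => n; rewrite sumE lee_fin; apply/ltW; rewrite ltNge; apply/negP; exact: h.
move=> /(le_trans lo); rewrite lee_fin ler_pM2r//; lra.
Qed.

Lemma nat_frame (A B : R) : 0 < A -> 0 < B -> (forall g : H,
  (forall n, \sum_(i < n) rnorm (inner g (f i)) ^+ 2 <= B * rnorm g ^+ 2) /\
  exists n, A * rnorm g ^+ 2 <= \sum_(i < n) rnorm (inner g (f i)) ^+ 2) -> frame F.
Proof.
move=> A0 B0 AB; exists A, B; split=> // g.
pose a n : \bar R := (rnorm (inner g (F n)) ^+ 2)%:E.
have a0 n : (0 <= a n)%E by rewrite lee_fin sqr_ge0.
have sumE n : (\sum_(0 <= i < n) a (int_enum i))%E = (\sum_(i < n) rnorm (inner g (f i)) ^+ 2)%:E.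
  by rewrite big_mkord sumEFin.
have [hi [n lo]] := AB g; rewrite (esum_int a0); apply/andP; split.
  apply: le_trans (nneseries_lim_ge n _); first by rewrite sumE lee_fin.
  by move=> k _ _; exact: a0.
apply: lime_le; first by apply: is_cvg_nneseries => k _ _; exact: a0.
by apply: nearW => k; rewrite sumE lee_fin.
Qed.

Lemma linear_span_range : linear_span (range F) = range (lc f).
Proof.
apply/seteqP; split=> [_ [n [c [a [aF ->]]]]|_ [p _ <-]]; last first.
  exists (size p), (fun i => p`_i), (fun i => f i); split=> [i|//].
  by exists (int_enum i).
have /choice[m mP] : forall i, exists m, F m = a i by move=> i; have [m _] := aF i; exists m.
exists (\sum_(i < n) c i *: 'X^(int_rank (m i))) => //.
rewrite linear_sum; apply: eq_bigr => i _; rewrite linearZ /= lcXn /f /=.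
by rewrite int_rankK mP.
Qed.

Lemma dense_linear_span : dense (linear_span (range F)) <-> dense_range (lc f).
Proof.
rewrite linear_span_range; split=> [dF x e e0|dF O [x Ox] oO].
  have [|y [yB [p _ pE]]] := dF (ball x e%:C%C) _ (ball_open _ _).
    by exists x; apply: ballxx; rewrite ltcR.
  by exists p; rewrite pE rnorm_ltC; move: yB; rewrite -ball_normE.
have /nbhs_ballP[[e e'] /=] : nbhs x O by exact: open_nbhs_nbhs.
rewrite ltcE /= => /andP[/eqP -> e0] {e'} eO.
have [p pP] := dF x e e0; exists (lc f p); split; last by exists p.
by apply: eO; rewrite -ball_normE /= -rnorm_ltC.
Qed.

End int_families.

Section riesz.
Variables (R : realType) (H : innerProductType R) (F : int -> H).
Hypothesis cH : seq_complete H.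
Let f := F \o int_enum.

Lemma lc_comp_op (U : boundedOperator H H) (e : nat -> H) (p : {poly R[i]}) :
  lc (U \o e) p = U (lc e p).
Proof. exact/esym/(linear_lc U). Qed.

Lemma riesz_basis_bounds : riesz_basis F -> exists a b : R, [/\ 0 < a, 0 < b &
  forall p, a * l2sq p <= rnorm (lc f p) ^+ 2 <= b * l2sq p].
Proof.
move=> [e [U [[oe de] bU FU]]].
pose e' := e \o int_enum.
have oe' : orthonormal_seq e'.
  by move=> m n; rewrite /e' /= oe (inj_eq (can_inj int_enumK)).
have fE p : lc f p = U (lc e' p).
  by rewrite -lc_comp_op; apply: eq_lc => k; rewrite /f /= FU.
have [M M0 MP] := linear_rnorm_bound U.
have [c c0 cP] := bounded_inverse cH cH bU.
exists (c^-1 ^+ 2), (M ^+ 2); split; rewrite ?exprn_gt0 ?invr_gt0// => p.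
rewrite fE -(rnorm_lc_orthonormal p oe') -!exprMn.
apply/andP; split; rewrite ler_pXn2r ?nnegrE ?mulr_ge0 ?rnorm_ge0 ?invr_ge0 ?(ltW c0) ?(ltW M0)//.
by rewrite mulrC ler_pdivrMr// mulrC.
Qed.

(** The lower bound makes f free, so Gram-Schmidt provides some orthonormal basis e. The operator
    [U] is not the triangular change of basis: it sends e_k to f_k, and since |lc e p|^2 = l2sq p
    the two bounds make it and its inverse bounded. *)
Lemma bounds_riesz_basis (a b : R) : 0 < a -> 0 < b -> dense_range (lc f) ->
  (forall p, a * l2sq p <= rnorm (lc f p) ^+ 2 <= b * l2sq p) -> riesz_basis F.
Proof.
move=> a0 b0 df fab.
have l2_ge0 p : 0 <= l2sq p :> R by apply: sumr_ge0 => i _; rewrite sqr_ge0.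
have free p : lc f p = 0 -> p = 0.
  move=> p0; have /andP[+ _] := fab p; rewrite p0 rnorm0 expr0n /= pmulr_rle0// => h.
  have {h} : l2sq p = 0 by apply/eqP; rewrite eq_le h l2_ge0.
  move/eqP; rewrite psumr_eq0; last by move=> i _; rewrite sqr_ge0.
  move=> /allP h; apply/polyP => i; rewrite coef0; have [ip|ip] := ltnP i (size p).
    have := h (Ordinal ip) (mem_index_enum _); rewrite sqrf_eq0 => /eqP.
    by move=> /(@rnorm_eq0 R R[i]^o).
  by rewrite nth_default.
have [e [oe de]] := gram_schmidt free df.
have eE p := rnorm_lc_orthonormal p oe.
have sq (x y k : R) : 0 <= x -> 0 <= y -> 0 < k -> x ^+ 2 <= k * y ^+ 2 -> x <= Num.sqrt k * y.
  move=> x0 y0 k0 h; rewrite -(@ler_pXn2r _ 2) ?nnegrE ?mulr_ge0 ?sqrtr_ge0//.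
  by rewrite exprMn sqr_sqrtr// ltW.
have [|U [UE _]] := @extend_dense _ _ H H (lc e) (lc f) (Num.sqrt b) de cH.
  by move=> p; apply: (sq); rewrite ?rnorm_ge0// eE; case/andP: (fab p).
have [|W [WE _]] := @extend_dense _ _ H H (lc f) (lc e) (Num.sqrt a^-1) df cH.
  move=> p; apply: (sq); rewrite ?rnorm_ge0 ?invr_gt0// eE mulrC ler_pdivlMr//.
  by rewrite mulrC; case/andP: (fab p).
have UW : cancel W U by apply: (bounded_op_cancel df) => p; rewrite WE UE.
have WU : cancel U W by apply: (bounded_op_cancel de) => p; rewrite UE WE.
exists (e \o int_rank), U; split.
- split; first by move=> m n; rewrite /= oe (inj_eq (can_inj int_rankK)).
  apply/dense_linear_span => x d /(de x)[p pd]; exists p.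
  rewrite (_ : lc _ p = lc e p)//; apply: eq_lc => k.
  by rewrite /= int_enumK.
- by exists W.
- by move=> m; have := UE 'X^(int_rank m); rewrite /= !lcXn /f /= int_rankK => ->.
Qed.

End riesz.

(** * Characters in L^2(sigma) *)

Section characters.
Variables (R : realType) (sigma : set (borel_circle R)) (msigma : measurable sigma).
Local Notation mu := (@arc_length R).
Local Notation C := (borel_circle R).
Local Notation L2s := (L2_circle msigma).
Local Notation fs := (L2fun mu msigma).
Local Notation M := (mulcoord msigma).

Lemma zpow_sqint (n : int) (f : fs) : (fun z => circle_val z ^ n * f z) \in sqint mu msigma.
Proof.
apply/asboolP; apply: (square_integrableM_bounded msigma (M := 1)); last exact: L2funP.
- have [mr mi] := @cmeasurable_circle_pow R n.
  by split; apply: measurable_funTS.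
- by move=> z _; rewrite rnorm_circle_pow.
Qed.

Definition zpow_L2fun (n : int) (f : fs) : fs := MkL2fun (zpow_sqint n f).

Lemma mulcoord_class (f : fs) : M (L2class f) = L2class (zpow_L2fun 1 f).
Proof.
rewrite mulcoordE; congr L2class; apply: L2fun_ext => z.
by rewrite mulcoord_L2funE /= expr1z.
Qed.

Lemma zpow_L2fun_add m n f : zpow_L2fun m (zpow_L2fun n f) = zpow_L2fun (m + n) f.
Proof.
by apply: L2fun_ext => z /=; rewrite mulrA expfzDr// circle_val_neq0.
Qed.

Lemma zpow_L2fun0 f : zpow_L2fun 0 f = f.
Proof. by apply: L2fun_ext => z /=; rewrite expr0z mul1r. Qed.

Lemma mulcoord_inj : injective M.
Proof.
move=> u v uv; apply/eqP; rewrite -subr_eq0 -normr_eq0 -norm_mulcoord raddfB /=.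
by rewrite uv subrr normr0.
Qed.

Lemma mulcoord_bij : bijective M.
Proof.
pose g (u : L2s) : L2s := L2class (zpow_L2fun (-1) (repr u)).
have Mg : cancel g M.
  move=> u; rewrite /g mulcoord_class zpow_L2fun_add addrN zpow_L2fun0.
  exact: L2class_repr.
by exists g => // u; apply: mulcoord_inj; rewrite Mg.
Qed.

Lemma mulcoord_orbitE (f : fs) (n : int) :
  operator_orbit M (L2class f : L2s) n = L2class (zpow_L2fun n f).
Proof.
have [MK _] := operator_inverseK mulcoord_bij.
have IE g : operator_inverse M (L2class g : L2s) = L2class (zpow_L2fun (-1) g).
  by apply: mulcoord_inj; rewrite MK mulcoord_class zpow_L2fun_add addrN zpow_L2fun0.
case: n => n; rewrite /operator_orbit.
  elim: n => [|n IH]; first by rewrite zpow_L2fun0.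
  by rewrite iterS IH mulcoord_class zpow_L2fun_add.
elim: n => [|n IH]; first by rewrite /= IE.
by rewrite iterS IH IE zpow_L2fun_add; congr (L2class (zpow_L2fun _ f)); rewrite !NegzE; lia.
Qed.

Lemma inner_orbit (f g : fs) (n : int) :
  inner (L2class f : L2s) (operator_orbit M (L2class g : L2s) n) =
  cintegral mu sigma (fun z => circle_val z ^ (- n) * (f z * (g z)^*)).
Proof.
rewrite mulcoord_orbitE [LHS]L2innerE; congr cintegral; apply/funext => z /=.
by rewrite rmorphM /= conj_circle_pow mulrCA.
Qed.

(** The inner products are the Fourier coefficients of f conj(g), extended by 0 off sigma:
    orthogonality to a whole orbit becomes the vanishing of a pointwise product. *)
Lemma fourier_ae0 (f g : fs) :
  (forall n, inner (L2class f : L2s) (operator_orbit M (L2class g : L2s) n) = 0) ->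
  {ae mu, forall z, sigma z -> f z * (g z)^* = 0}.
Proof.
move=> fg0.
pose u z := (\1_sigma z : R)%:C%C * (f z * (g z)^*).
have Re_u (h : C -> R[i]) : (fun z => complex.Re ((\1_sigma z : R)%:C%C * h z)) =
    (fun z => complex.Re (h z)) \_ sigma.
  apply/funext => z; rewrite patchE indicE; case: (z \in sigma); case: (h z) => a b /=.
    by rewrite mul1r mul0r subr0.
  by rewrite !mul0r subr0.
have Im_u (h : C -> R[i]) : (fun z => complex.Im ((\1_sigma z : R)%:C%C * h z)) =
    (fun z => complex.Im (h z)) \_ sigma.
  apply/funext => z; rewrite patchE indicE; case: (z \in sigma); case: (h z) => a b /=.
    by rewrite mul1r mul0r addr0.
  by rewrite !mul0r addr0.
have int_u : cintegrable mu setT u.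
  have [ir ii] := cintegrableM_conj msigma (L2funP f) (L2funP g); split.
    have /(integrable_mkcond _ msigma) := ir; apply: eq_integrable => // z _.
    by rewrite patchE /u indicE; case: (z \in sigma); case: (_ * _^*) => a b /=;
      rewrite !mul0r subr0 ?mul1r.
  have /(integrable_mkcond _ msigma) := ii; apply: eq_integrable => // z _.
  by rewrite patchE /u indicE; case: (z \in sigma); case: (_ * _^*) => a b /=;
    rewrite !mul0r addr0 ?mul1r.
have Zu : fourier_null u.
  split=> // n; have := fg0 (- n); rewrite inner_orbit opprK => <-.
  rewrite /cintegral; congr (_ +i* _)%C; rewrite [RHS]Rintegral_mkcond.
    by rewrite -Re_u; apply: eq_Rintegral => z _; rewrite mulrCA.
  by rewrite -Im_u; apply: eq_Rintegral => z _; rewrite mulrCA.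
have := fourier_uniqueness Zu; apply: filterS => z + sz.
by rewrite /u indicE mem_set// mul1r.
Qed.

Lemma L2_circle_complete : seq_complete L2s.
Proof. exact: L2_complete. Qed.

Definition echar (k : nat) : L2s := operator_orbit M (one_L2 msigma) (int_enum k).

(** The residual of the projection onto the closed span is orthogonal to the orbit of the function
    1, and [fourier_ae0] with g = 1 makes it vanish. *)
Lemma echar_dense : dense_range (lc echar).
Proof.
pose N := [set x : L2s | forall e : R, 0 < e -> exists p, rnorm (x - lc echar p) < e].
have Nlc p : N (lc echar p) by move=> e e0; exists p; rewrite subrr rnorm0.
suff NT x : N x by move=> x e; exact: NT.
have [|||n Nn nP] := @projection _ L2s N x L2_circle_complete.
- by rewrite -(raddf0 (lc echar)); exact: Nlc.
- move=> a y z Ny Nz e e0.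
  have a1 : 0 < rnorm a + 1 by rewrite ltr_wpDl ?rnorm_ge0.
  have [|p pP] := Ny (e / 2 / (rnorm a + 1)); first by rewrite !divr_gt0.
  have [|q qP] := Nz (e / 2); first by rewrite divr_gt0.
  exists (a *: p + q); rewrite linearP opprD addrACA -scalerBr.
  apply: le_lt_trans (rnormD _ _) _; rewrite rnormZ [ltRHS]splitr.
  apply: ler_ltD => //; move: pP; rewrite ltr_pdivlMr// => /ltW; apply: le_trans.
  by rewrite mulrC ler_wpM2l ?rnorm_ge0// lerDl.
- move=> y yN e e0; have e2 : 0 < e / 2 by rewrite divr_gt0.
  have [z [Nz yz]] := yN _ e2; have [p pz] := Nz _ e2.
  exists p; apply: le_lt_trans (rnorm_triangle z _ _) _.
  by rewrite [ltRHS]splitr ltrD.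
have /fourier_ae0 h : forall k, inner (L2class (repr (x - n)) : L2s) (operator_orbit M (one_L2 msigma) k) = 0.
  move=> k; rewrite L2class_repr; apply: nP.
  by have := Nlc 'X^(int_rank k); rewrite lcXn /echar int_rankK.
suff : x - n = 0 by move=> /eqP; rewrite subr_eq0 => /eqP ->.
rewrite -[x - n]L2class_repr -(raddf0 (@L2class _ _ _ mu sigma msigma)); apply/L2classP.
move: h; apply: filterS => z + sz => /(_ sz); rewrite /= rmorph1 mulr1 => ->.
by have /(congr1 (@^~ z)) := raddf0 (val : fs -> (C -> R[i])).
Qed.

End characters.

(** * Trigonometric polynomials and their norms over subsets of the circle *)

Section trigonometric.
Variable R : realType.
Local Notation mu := (@arc_length R).
Local Notation C := (borel_circle R).

Definition trigval (p : {poly R[i]}) (z : C) : R[i] :=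
  \sum_(i < size p) p`_i * circle_val z ^ int_enum i.

Lemma trigvalB p q z : trigval (p - q) z = trigval p z - trigval q z.
Proof.
have E r : trigval r z = lc (fun k => circle_val z ^ int_enum k : R[i]^o) r by [].
by rewrite !E raddfB.
Qed.

Lemma lc_orbitE (sigma : set C) (msigma : measurable sigma) (f g : L2fun mu msigma) p :
  (forall z, g z = trigval p z * f z) ->
  lc (fun k => operator_orbit (mulcoord msigma) (L2class f : L2_circle msigma) (int_enum k)) p =
  L2class g :> L2_circle msigma.
Proof.
move=> gE.
have -> : g = lc (fun k => zpow_L2fun (int_enum k) f) p.
  apply: L2fun_ext => z; rewrite gE /trigval /lc.
  have valE n (c : 'I_n -> R[i]) (v : 'I_n -> L2fun mu msigma) :
      l2val (\sum_(i < n) c i *: v i) z = \sum_(i < n) c i * v i z.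
    elim: n c v => [|n IH] c v; last first.
      by rewrite !big_ord_recr; rewrite [LHS]l2valD [X in _ + X = _]l2valZ IH.
    by rewrite !big_ord0; have /(congr1 (@^~ z)) := raddf0 (val : L2fun mu msigma -> (C -> R[i])).
  by rewrite valE mulr_suml; apply: eq_bigr => i _; rewrite mulrA.
rewrite [RHS](linear_lc (@L2class _ _ _ mu sigma msigma)).
by apply: eq_lc => k; rewrite mulcoord_orbitE.
Qed.

Lemma cmeasurable_trigval p : cmeasurable_fun setT (trigval p).
Proof.
rewrite /trigval; elim: (size p) => [|n IH].
  rewrite (_ : (fun z => _) = cst 0); first by split; exact: measurable_cst.
  by apply/funext => z; rewrite big_ord0.
rewrite (_ : (fun z => _) = (fun z : C => \sum_(i < n) p`_i * circle_val z ^ int_enum i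
   + p`_n * circle_val z ^ int_enum n)); last first.
  by apply/funext => z; rewrite big_ord_recr.
apply: cmeasurable_funD => //; apply: (@cmeasurable_funM _ _ _ _ (cst p`_n)).
  by split; exact: measurable_cst.
exact: cmeasurable_circle_pow.
Qed.

Lemma trigval_bound p z : rnorm (trigval p z) <= \sum_(i < size p) rnorm p`_i.
Proof.
rewrite /trigval; elim: (size p) => [|n IH]; first by rewrite !big_ord0 (@rnorm0 _ R[i]^o).
rewrite !big_ord_recr /=; apply: le_trans (@rnormD _ R[i]^o _ _) _.
by rewrite lerD// rnormM rnorm_circle_pow mulr1.
Qed.

Lemma trigM_sqint (sigma : set C) (msigma : measurable sigma) p (f : L2fun mu msigma) :
  (fun z => trigval p z * f z) \in sqint mu msigma.
Proof.
apply/asboolP; apply: (square_integrableM_bounded msigma); last exact: L2funP.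
- by have [mr mi] := cmeasurable_trigval p; split; exact: measurable_funTS.
- by move=> z _; exact: trigval_bound.
Qed.

Lemma lc_echarE (sigma : set C) (msigma : measurable sigma) p (g : L2fun mu msigma) :
  l2val g = trigval p -> lc (echar msigma) p = L2class g.
Proof. by move=> gE; apply: lc_orbitE => z; rewrite gE /= mulr1. Qed.

Lemma rnorm_lc_echar (sigma : set C) (msigma : measurable sigma) p :
  (\int[mu]_(z in sigma) (rnorm (trigval p z) ^+ 2)%:E)%E =
  (rnorm (lc (echar msigma) p) ^+ 2)%:E.
Proof.
have gE : l2val (MkL2fun (trigM_sqint p (MkL2fun (one_sqint msigma)))) = trigval p.
  by apply/funext => z /=; rewrite mulr1.
by rewrite (lc_echarE gE) -rnorm_L2class gE.
Qed.

(* The norm of the trigonometric polynomial [p] in L^2(sigma), depending on the set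
   [sigma] but not on a proof of its measurability. *)
Definition trig_norm (sigma : set C) (p : {poly R[i]}) : R :=
  Num.sqrt (\int[mu]_(z in sigma) (rnorm (trigval p z) ^+ 2)).

Lemma trig_norm_ge0 sigma p : 0 <= trig_norm sigma p.
Proof. exact: sqrtr_ge0. Qed.

Lemma rnorm_trig_measurable (p : {poly R[i]}) (D : set C) :
  measurable_fun D (fun z => (rnorm (trigval p z) ^+ 2)%:E).
Proof.
apply/measurable_EFinP; apply: cmeasurable_rnorm2.
by have [mr mi] := cmeasurable_trigval p; split; exact: measurable_funTS.
Qed.

Lemma trig_normE (sigma : set C) (msigma : measurable sigma) p :
  rnorm (lc (echar msigma) p) = trig_norm sigma p.
Proof.
have h : \int[mu]_(z in sigma) (rnorm (trigval p z) ^+ 2) = rnorm (lc (echar msigma) p) ^+ 2.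
  by rewrite /Rintegral rnorm_lc_echar.
by rewrite /trig_norm h sqrtr_sqr ger0_norm// rnorm_ge0.
Qed.

Lemma trig_norm_sq (sigma : set C) p : measurable sigma ->
  (\int[mu]_(z in sigma) (rnorm (trigval p z) ^+ 2)%:E)%E = (trig_norm sigma p ^+ 2)%:E.
Proof. by move=> msigma; rewrite -(trig_normE msigma) -rnorm_lc_echar. Qed.

Lemma trig_norm_subset (sigma tau : set C) p : measurable sigma -> measurable tau ->
  sigma `<=` tau -> trig_norm sigma p <= trig_norm tau p.
Proof.
move=> ms mt st; rewrite -(@ler_pXn2r _ 2) ?nnegrE ?trig_norm_ge0// -lee_fin.
rewrite -!trig_norm_sq//; apply: ge0_subset_integral => //.
  exact: rnorm_trig_measurable.
by move=> z _; rewrite lee_fin sqr_ge0.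
Qed.

Lemma echar_orthonormal : orthonormal_seq (echar (@measurableT _ C)).
Proof.
move=> m n; rewrite /echar /one_L2 [X in inner X _]mulcoord_orbitE inner_orbit /=.
under eq_fun do rewrite /= rmorph1 !mulr1 -expfzDr ?circle_val_neq0//.
rewrite circle_moment addrC subr_eq0; congr (nat_of_bool _)%:R.
exact: (inj_eq (can_inj int_enumK)).
Qed.

(** Parseval's identity, from the orthonormality of the characters on the full circle. *)
Lemma trig_normT p : trig_norm setT p ^+ 2 = l2sq p.
Proof. by rewrite -(trig_normE measurableT) (rnorm_lc_orthonormal _ echar_orthonormal). Qed.

Lemma indic_trig_sqint (A : set C) (p : {poly R[i]}) : measurable A ->
  (fun z => (\1_A z : R)%:C%C * trigval p z) \in sqint mu (@measurableT _ C).
Proof.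
move=> mA; have := trigM_sqint p (MkL2fun (one_sqint (@measurableT _ C))).
set f := (fun z => trigval p z * _) => f_sq.
have /asboolP h := f_sq; apply/asboolP.
have -> : (fun z => (\1_A z : R)%:C%C * trigval p z) = (fun z => (\1_A z : R)%:C%C * f z).
  by apply/funext => z; rewrite /f /= mulr1.
apply: (square_integrableM_bounded measurableT (M := 1)) => //.
  split=> /=; last exact: measurable_cst.
  exact: measurable_indic.
move=> z _; have -> : rnorm ((\1_A z : R)%:C%C : R[i]) = `|\1_A z : R|.
  by apply: complexI; rewrite rnormE normc_def /= expr0n addr0 sqrtr_sqr.
by rewrite indicE ger0_norm// lern1 leq_b1.
Qed.

(** A cut-off: q is close to p on A and small off A, in the norm of the full circle, where the
    coefficients of q are under control. *)
Lemma indic_trig_approx (A : set C) (mA : measurable A) (p : {poly R[i]}) (e : R) : 0 < e ->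
  exists q, (\int[mu]_z (rnorm ((\1_A z : R)%:C%C * trigval p z - trigval q z) ^+ 2)%:E < (e ^+ 2)%:E)%E.
Proof.
move=> e0; pose y : L2_circle (@measurableT _ C) := L2class (MkL2fun (indic_trig_sqint p mA)).
have [q yq] := echar_dense y e0; exists q.
have gE : l2val (MkL2fun (trigM_sqint q (MkL2fun (one_sqint (@measurableT _ C))))) = trigval q.
  by apply/funext => z /=; rewrite mulr1.
rewrite (lc_echarE gE) -raddfB in yq.
rewrite -(@ltr_pXn2r _ 2) ?nnegrE ?rnorm_ge0 ?(ltW e0)// -lte_fin -rnorm_L2class in yq.
move: yq; apply: le_lt_trans; rewrite le_eqVlt; apply/orP; left; apply/eqP.
by apply: eq_integral => z _; rewrite l2valB gE.
Qed.

End trigonometric.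

(** * Frames and multiplication operators *)

Section equivalent_norms.
Variable R : realType.
Local Notation mu := (@arc_length R).
Local Notation C := (borel_circle R).

(* [f k |-> z ^ (int_enum k)] extends to an isomorphism of the closed spans, in V and
   in L^2(sigma). *)
Definition equinormed (V : normedModType R[i]) (f : nat -> V) (sigma : set C) :=
  exists a b : R, [/\ 0 < a, 0 < b & forall p,
    a * trig_norm sigma p <= rnorm (lc f p) <= b * trig_norm sigma p].

Lemma trigval1 (z : C) : trigval 1 z = 1.
Proof. by rewrite /trigval size_poly1 big_ord1 coef1 /= expr0z mulr1. Qed.

(** Let A be the difference and q close to 1_A on the circle. Then q is small on sigma, hence on tau
    by hypothesis, although it is close to 1 on A. Integrating 1 <= 2 |1 - q|^2 + 2 |q|^2 over A
    bounds its measure by c = 2 + 2 K^2 times the squared error, which is taken below e / c. *)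
Lemma null_setD_of_le (sigma tau : set C) (ms : measurable sigma) (mt : measurable tau) (K : R) :
  (forall p, trig_norm tau p <= K * trig_norm sigma p) ->
  mu (tau `\` sigma) = 0%E.
Proof.
move=> tsK; pose A := tau `\` sigma; have mA : measurable A by exact: measurableD.
apply/eqP; rewrite -/A -measure_le0; apply/lee_addgt0Pr => e e0; rewrite add0e.
pose c := 2 + 2 * K ^+ 2; have c0 : 0 < c by rewrite ltr_wpDr// mulr_ge0// sqr_ge0.
have [|q qA] := @indic_trig_approx R A mA 1 (Num.sqrt (e / c)).
  by rewrite sqrtr_gt0 divr_gt0.
pose D (z : C) := rnorm ((\1_A z : R)%:C%C * trigval 1 z - trigval q z) ^+ 2.
have {qA} DI : (\int[mu]_z (D z)%:E <= (e / c)%:E)%E.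
  by apply/ltW; rewrite -[X in X%:E]sqr_sqrtr// divr_ge0// ltW.
have mD (B : set C) : measurable_fun B (fun z => (D z)%:E).
  apply/measurable_EFinP; apply: cmeasurable_rnorm2.
  have h := cmeasurable_trigval (q : {poly R[i]}).
  have h1 : cmeasurable_fun setT (fun z : C => (\1_A z : R)%:C%C - trigval q z).
    rewrite (_ : (fun z => _) = (fun z : C => (\1_A z : R)%:C%C + (-1) * trigval q z)).
      apply: cmeasurable_funD; first by split; [exact: measurable_indic|exact: measurable_cst].
      by apply: (@cmeasurable_funM _ _ _ _ (cst (-1))) => //; split; exact: measurable_cst.
    by apply/funext => z; rewrite mulN1r.
  under eq_fun do rewrite trigval1 mulr1.
  by case: h1 => hr hi; split; exact: measurable_funTS.
have D0 z : 0 <= D z by exact: sqr_ge0.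
have subI (B : set C) (g : C -> R) : measurable B -> measurable_fun setT (fun z => (g z)%:E) ->
    (forall z, 0 <= g z) -> (\int[mu]_(z in B) (g z)%:E <= \int[mu]_z (g z)%:E)%E.
  by move=> mB mg g0; apply: ge0_subset_integral => // z _; rewrite lee_fin.
have qs : (\int[mu]_(z in sigma) (rnorm (trigval q z) ^+ 2)%:E <= (e / c)%:E)%E.
  apply: le_trans DI; apply: le_trans (subI sigma D ms (mD _) D0).
  rewrite le_eqVlt; apply/orP; left; apply/eqP/eq_integral => z; rewrite inE => sz.
  by rewrite /D indicE memNset ?mul0r ?sub0r ?(@rnormN _ R[i]^o)// => -[].
have qt : (\int[mu]_(z in tau) (rnorm (trigval q z) ^+ 2)%:E <= (K ^+ 2 * (e / c))%:E)%E.
  have {}qs : trig_norm sigma q ^+ 2 <= e / c by rewrite -lee_fin -(trig_norm_sq q ms).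
  rewrite (trig_norm_sq q mt) lee_fin.
  apply: (@le_trans _ _ ((K * trig_norm sigma q) ^+ 2)).
    by rewrite ler_pXn2r ?nnegrE ?trig_norm_ge0// (le_trans (trig_norm_ge0 _ _) (tsK q)).
  by rewrite exprMn ler_wpM2l ?sqr_ge0.
have qA : (\int[mu]_(z in A) (rnorm (trigval q z) ^+ 2)%:E <= (K ^+ 2 * (e / c))%:E)%E.
  apply: le_trans qt; apply: ge0_subset_integral => //.
  - exact: rnorm_trig_measurable.
  - by move=> z _; rewrite lee_fin sqr_ge0.
  - by move=> z [].
have DA : (\int[mu]_(z in A) (D z)%:E <= (e / c)%:E)%E by exact: le_trans (subI A D mA (mD _) D0) DI.
apply: (@le_trans _ _ (\int[mu]_(z in A) (cst 1%E z))%E); first by rewrite integral_cst// mul1e.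
apply: (@le_trans _ _ (\int[mu]_(z in A) (2%:E * (D z)%:E + 2%:E * (rnorm (trigval q z) ^+ 2)%:E))%E).
  apply: ge0_le_integral => //.
  - by apply: emeasurable_funD; apply: measurable_funeM => //; exact: rnorm_trig_measurable.
  - move=> z Az /=; rewrite -!EFinM -EFinD lee_fin /D indicE mem_set// trigval1 mul1r.
    rewrite !rnorm2E; case: (trigval q z) => x y /=.
    rewrite -subr_ge0 (_ : _ - 1 = (1 - 2 * x) ^+ 2 + 4 * y ^+ 2); last by ring.
    by rewrite addr_ge0 ?sqr_ge0// mulr_ge0// sqr_ge0.
rewrite ge0_integralD//; last 4 first.
- by move=> z _; rewrite mule_ge0 ?lee_fin.
- exact: measurable_funeM.
- by move=> z _; rewrite mule_ge0 ?lee_fin ?sqr_ge0.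
- by apply: measurable_funeM; exact: rnorm_trig_measurable.
rewrite !ge0_integralZl_EFin//; last 2 first.
- exact: rnorm_trig_measurable.
- by move=> z _; rewrite lee_fin sqr_ge0.
apply: (@le_trans _ _ (2%:E * (e / c)%:E + 2%:E * (K ^+ 2 * (e / c))%:E)%E).
  by rewrite leeD// lee_wpmul2l ?lee_fin.
rewrite -!EFinM -EFinD lee_fin.
suff -> : 2 * (e / c) + 2 * (K ^+ 2 * (e / c)) = e by [].
by move: c0; rewrite /c => c0; field; rewrite gt_eqF.
by move=> z _; rewrite lee_fin sqr_ge0.
Qed.

Lemma equinormed_unique (V : normedModType R[i]) (f : nat -> V) (sigma tau : set C)
    (ms : measurable sigma) (mt : measurable tau) :
  equinormed f sigma -> equinormed f tau -> arc_eq sigma tau.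
Proof.
have half (s t : set C) (ms' : measurable s) (mt' : measurable t) :
    equinormed f s -> equinormed f t -> mu (t `\` s) = 0%E.
  move=> [a [b [a0 b0 ab]]] [a' [b' [a'0 b'0 ab']]].
  apply: (@null_setD_of_le s t ms' mt' (b / a')) => p.
  have aux (x w y : R) : a' * x <= w -> w <= b * y -> x <= b / a' * y.
    by move=> xw wy; rewrite mulrAC ler_pdivlMr// mulrC; exact: le_trans xw wy.
  have /andP[_ h2] := ab p; have /andP[h3 _] := ab' p.
  exact: (aux _ _ _ h3 h2).
move=> es et; rewrite /arc_eq /setY; apply/eqP; rewrite -measure_le0.
apply: (@le_trans _ _ (mu (sigma `\` tau) + mu (tau `\` sigma))%E).
  by apply: measureU2; exact: measurableD.
rewrite le_eqVlt; apply/orP; left; apply/eqP; rewrite -[RHS]adde0; congr (_ + _)%E.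
  exact: (half _ _ mt ms et es).
exact: (half _ _ ms mt es et).
Qed.

Lemma orbit_succ (X : normedModType R[i]) (T : X -> X) x n : bijective T ->
  operator_orbit T x (n + 1) = T (operator_orbit T x n).
Proof.
move=> bT; have [TK _] := operator_inverseK bT.
case: n => [n|[|n]].
- by rewrite (_ : n%:Z + 1 = n.+1%:Z)//; lia.
- by rewrite (_ : Negz 0 + 1 = 0%:Z)//= TK.
- by rewrite (_ : Negz n.+1 + 1 = Negz n) ?[in RHS]/operator_orbit ?iterS ?TK//; lia.
Qed.

Lemma orbit_zero (X : normedModType R[i]) (T : boundedOperator X X) n : bijective T ->
  operator_orbit T 0 n = 0.
Proof.
move=> bT; have [TK _] := operator_inverseK bT.
have I0 : operator_inverse T 0 = 0 by apply: (bij_inj bT); rewrite TK raddf0.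
by case: n => n; rewrite /operator_orbit; elim: n => //= n ->; rewrite ?raddf0.
Qed.

(** On a point of the orbit of x0 both sides give the next point of the orbit of y0; linearity and
    density do the rest. *)
Lemma intertwine_dense (X Y : normedModType R[i]) (T : boundedOperator X X)
    (T' : boundedOperator Y Y) (S : boundedOperator X Y) x0 y0 :
  bijective T -> bijective T' ->
  dense_range (lc (fun k => operator_orbit T x0 (int_enum k))) ->
  (forall k, S (operator_orbit T x0 (int_enum k)) = operator_orbit T' y0 (int_enum k)) ->
  forall x, S (T x) = T' (S x).
Proof.
move=> bT bT' dX SE.
have [K K0 KP] := linear_rnorm_bound T; have [K' K'0 K'P] := linear_rnorm_bound T'.
have [M M0 MP] := linear_rnorm_bound S.
pose B := M * K + K' * M; have B0 : 0 < B by rewrite addr_gt0// mulr_gt0.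
apply: (@dense_linear_eq _ _ _ _ _ (S \o T) (T' \o S) B dX B0).
- move=> x; apply: le_trans (MP _) _; apply: (@le_trans _ _ (M * (K * rnorm x))).
    by rewrite ler_wpM2l ?(ltW M0)//; exact: KP.
  by rewrite mulrA ler_wpM2r ?rnorm_ge0// lerDl mulr_ge0// ltW.
- move=> x; apply: le_trans (K'P _) _; apply: (@le_trans _ _ (K' * (M * rnorm x))).
    by rewrite ler_wpM2l ?(ltW K'0)//; exact: MP.
  by rewrite mulrA ler_wpM2r ?rnorm_ge0// lerDr mulr_ge0// ltW.
move=> p; rewrite [LHS](linear_lc (S \o T)) [RHS](linear_lc (T' \o S)).
(* The enumeration does not turn the shift of the integers into k + 1, so the successor is located
   through [int_rank]. *)
apply: eq_lc => k /=; rewrite SE -orbit_succ// -(int_rankK (int_enum k + 1)) SE int_rankK.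
by rewrite orbit_succ.
Qed.

End equivalent_norms.

Section models.
Variables (R : realType) (H : innerProductType R) (T : boundedOperator H H) (f0 : H).
Hypotheses (cH : seq_complete H) (bT : bijective T).
Local Notation mu := (@arc_length R).
Local Notation C := (borel_circle R).
Let f k := operator_orbit T f0 (int_enum k).

(** The similarity V carries f_k to the characters, so the bounds of V and of its inverse are the
    norm equivalence, and the density of the characters pulls back. *)
Lemma model_equinormed (sigma : set C) : multiplication_model T f0 sigma ->
  measurable sigma /\ equinormed f sigma /\ dense_range (lc f).
Proof.
move=> [ms [_ [V [bV VT V1]]]]; split=> //; have [VK KV] := operator_inverseK bV.
have VTM x : V (T x) = mulcoord ms (V x) by rewrite VT KV.
have Vlc p : V (lc f p) = lc (echar ms) p.
  rewrite linear_lc; apply: eq_lc => k /=.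
  by rewrite (orbit_intertwine _ _ bT (mulcoord_bij ms) VTM) -V1.
have [M M0 MP] := linear_rnorm_bound V.
have [c c0 cP] := bounded_inverse cH (@L2_circle_complete R _ ms) bV.
have VN p : rnorm (V (lc f p)) = trig_norm sigma p by rewrite Vlc trig_normE.
split.
  exists M^-1, c; split; rewrite ?invr_gt0// => p; rewrite -VN.
  have aux (y x : R) : y <= M * x -> M^-1 * y <= x by move=> yM; rewrite mulrC ler_pdivrMr// mulrC.
  by apply/andP; split; [exact: aux (MP _)|exact: cP].
have aux (x y e : R) : x <= c * y -> y < e / c -> x < e.
  by rewrite ltr_pdivlMr// mulrC => xy ye; exact: le_lt_trans xy ye.
move=> x e e0; have [|p pP] := @echar_dense R sigma ms (V x) (e / c); first by rewrite divr_gt0.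
exists p; apply: (aux _ _ _ (cP _)); move: pP; rewrite -Vlc -raddfB.
exact.
Qed.

Lemma equinormed_model (sigma : set C) (ms : measurable sigma) :
  (0 < mu sigma)%E -> equinormed f sigma -> dense_range (lc f) ->
  multiplication_model T f0 sigma.
Proof.
move=> s0 [a [b [a0 b0 ab]]] df.
have [|V [VE _]] := @extend_dense _ _ H (L2_circle ms) (lc f) (lc (echar ms)) a^-1 df
  (@L2_circle_complete R _ ms).
  have aux (x y : R) : a * x <= y -> x <= a^-1 * y by rewrite [_^-1 * _]mulrC ler_pdivlMr// mulrC.
  by move=> p; have /andP[h _] := ab p; rewrite [leLHS]trig_normE; exact: aux.
have [|W [WE _]] := @extend_dense _ _ (L2_circle ms) H (lc (echar ms)) (lc f) b (@echar_dense R sigma ms) cH.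
  by move=> p; have /andP[_ h] := ab p; rewrite [X in _ <= _ * X]trig_normE.
have VW : cancel V W by apply: (bounded_op_cancel df) => p; rewrite VE WE.
have WV : cancel W V by apply: (bounded_op_cancel (@echar_dense R sigma ms)) => p; rewrite WE VE.
have bV : bijective V by exists W.
have [VK KV] := operator_inverseK bV.
have Vf k : V (f k) = echar ms k.
  by have := VE 'X^k; rewrite /= !lcXn.
exists ms; split=> //; exists V; split=> //.
  move=> g; rewrite -{1}(VK g); apply/esym.
  by apply: (intertwine_dense bT (mulcoord_bij ms) df) => k; exact: Vf.
(* Index 0 enumerates the integer 0: the orbit terms are f_0 and the function 1. *)
by have := Vf 0%N.
Qed.

End models.

(** Different coefficients can represent nearly the same function on sigma. Approximating 1_sigma p
    on the whole circle selects q, close to p on sigma, with l^2 norm at most the norm of p in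
    L^2(sigma) plus e. *)
Lemma trig_truncate (R : realType) (sigma : set (borel_circle R)) (ms : measurable sigma)
    (p : {poly R[i]}) (e : R) : 0 < e ->
  exists q, trig_norm sigma (p - q) < e /\ trig_norm setT q <= trig_norm sigma p + e.
Proof.
pose mu := @arc_length R; pose C := borel_circle R.
move=> e0; have [q qe] := indic_trig_approx ms p e0; exists q.
pose D (z : C) := rnorm ((\1_sigma z : R)%:C%C * trigval p z - trigval q z) ^+ 2.
pose y : L2_circle (@measurableT _ C) := L2class (MkL2fun (indic_trig_sqint p ms)).
pose Q : L2fun mu (@measurableT _ C) :=
  MkL2fun (trigM_sqint q (MkL2fun (one_sqint (@measurableT _ C)))).
have QE : l2val Q = trigval q by apply/funext => z /=; rewrite mulr1.
have DE : (\int[mu]_z (D z)%:E = (rnorm (y - lc (echar measurableT) q) ^+ 2)%:E)%E.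
  rewrite (lc_echarE QE) -raddfB -rnorm_L2class; apply: eq_integral => z _.
  by rewrite l2valB QE.
have ye : rnorm (y - lc (echar measurableT) q) < e.
  by rewrite -(@ltr_pXn2r _ 2) ?nnegrE ?rnorm_ge0 ?(ltW e0)// -lte_fin -DE.
have yE : rnorm y = trig_norm sigma p.
  apply/eqP; rewrite -(@eqrXn2 _ 2) ?rnorm_ge0 ?trig_norm_ge0//; apply/eqP.
  apply: EFin_inj; rewrite -(trig_norm_sq p ms) -rnorm_L2class /=.
  rewrite [RHS]integral_mkcond; apply: eq_integral => z _.
  rewrite patchE indicE; case: (z \in sigma); first by rewrite mul1r.
  by rewrite mul0r (@rnorm0 _ R[i]^o) expr0n.
split.
  rewrite -(@ltr_pXn2r _ 2) ?nnegrE ?trig_norm_ge0 ?(ltW e0)// -lte_fin -(trig_norm_sq _ ms).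
  apply: le_lt_trans qe; apply: (@le_trans _ _ (\int[mu]_(z in sigma) (D z)%:E)%E).
    rewrite le_eqVlt; apply/orP; left; apply/eqP/eq_integral => z zs.
    by rewrite /D indicE zs mul1r trigvalB.
  apply: ge0_subset_integral => //; last by move=> z _; rewrite lee_fin sqr_ge0.
  have [+ _] := L2funP (MkL2fun (indic_trig_sqint p ms) - Q).
  move=> /cmeasurable_rnorm2; under eq_fun do rewrite l2valB QE /=.
  by move=> ?; exact/measurable_EFinP.
rewrite -yE -(trig_normE measurableT q).
have := rnormD_le (lc (echar measurableT) q) y; rewrite rnormBC => h.
by apply: le_trans h _; rewrite addrC lerD2l ltW.
Qed.

Section frame_equinormed.
Variables (R : realType) (H : innerProductType R).
Local Notation mu := (@arc_length R).
Local Notation C := (borel_circle R).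

Lemma equinormed_frame_bounds (f : nat -> H) (sigma : set C) : measurable sigma ->
  equinormed f sigma -> dense_range (lc f) ->
  exists A B : R, [/\ 0 < A, 0 < B & forall g : H,
    (forall n, \sum_(i < n) rnorm (inner g (f i)) ^+ 2 <= B * rnorm g ^+ 2) /\
    exists n, A * rnorm g ^+ 2 <= \sum_(i < n) rnorm (inner g (f i)) ^+ 2].
Proof.
move=> ms [a [b [a0 b0 ab]]] df.
(* Approximate [g] by [lc f q] with the l^2 norm of [q] at most [K |g|], then
   estimate [<g, lc f q>] by AM-GM. *)
pose K := 2 / a + 1 / b; have K0 : 0 < K by rewrite addr_gt0// divr_gt0.
have K2 : 0 < K ^+ 2 by rewrite exprn_gt0.
have up p : rnorm (lc f p) ^+ 2 <= b ^+ 2 * l2sq p.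
  rewrite -trig_normT -exprMn ler_pXn2r ?nnegrE ?rnorm_ge0 ?mulr_ge0 ?trig_norm_ge0 ?(ltW b0)//.
  have /andP[_ h] := ab p; apply: le_trans h _; rewrite ler_wpM2l ?(ltW b0)//.
  exact: trig_norm_subset.
exists ((2 * K ^+ 2)^-1), (b ^+ 2); split; rewrite ?invr_gt0 ?mulr_gt0 ?exprn_gt0// => g.
split; first by move=> n; apply: analysis_bound => //; rewrite exprn_gt0.
have [->|g_neq0] := eqVneq g 0.
  by exists 0%N; rewrite rnorm0 expr0n mulr0 big_ord0.
pose y := rnorm g; have y0 : 0 < y.
  rewrite lt_neqAle rnorm_ge0 andbT; apply: contra g_neq0 => /eqP/esym h.
  by apply/eqP; apply: rnorm_eq0.
have [|p gp] := df g (y / 8); first by rewrite divr_gt0.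
have [|q [pq qP]] := @trig_truncate R sigma ms p (y / (8 * b)).
  by rewrite divr_gt0// mulr_gt0.
have gq : rnorm (g - lc f q) <= y / 4.
  apply: le_trans (rnorm_triangle (lc f p) _ _) _.
  rewrite -raddfB /=; have /andP[_ h] := ab (p - q).
  have : b * trig_norm sigma (p - q) <= y / 8.
    have -> : y / 8 = b * (y / (8 * b)) by field; rewrite gt_eqF.
    by rewrite ler_wpM2l// ltW.
  by lra.
(* The constant K adds 2 / a, as a times the norm of p is at most |lc f p| <= 2 y, and 1 / b, which
   covers the truncation error y / (8 b). *)
have qK : l2sq q <= K ^+ 2 * y ^+ 2.
  rewrite -trig_normT -exprMn ler_pXn2r ?nnegrE ?trig_norm_ge0 ?mulr_ge0 ?(ltW K0) ?(ltW y0)//.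
  apply: le_trans qP _.
  have pb : trig_norm sigma p <= 2 * y / a.
    rewrite ler_pdivlMr// mulrC; have /andP[h _] := ab p; apply: le_trans h _.
    have := rnormD_le (lc f p) g; rewrite rnormBC -/y; lra.
  have : y / (8 * b) <= y / b.
    by rewrite invfM mulrA ler_wpM2r ?invr_ge0 ?(ltW b0)//; lra.
  have -> : K * y = 2 * y / a + y / b by rewrite /K; field; rewrite !gt_eqF.
  by lra.
exists (size q); set s := \sum_(i < _) _.
have h1 : y ^+ 2 = complex.Re (inner g (g - lc f q)) + complex.Re (inner g (lc f q)).
  by rewrite -raddfD /= -innerDr subrK -rnorm_sq.
have h2 : complex.Re (inner g (g - lc f q)) <= y ^+ 2 / 4.
  apply: le_trans (ler_norm _) _; apply: le_trans (Re_rnorm _) _.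
  apply: le_trans (inner_CS _ _) _; rewrite -/y expr2 -mulrA.
  by rewrite ler_wpM2l// ltW.
have h3 : complex.Re (inner g (lc f q)) <= (2 * K ^+ 2)^-1 * l2sq q + K ^+ 2 / 2 * s.
  rewrite innerC /lc inner_suml rmorph_sum raddf_sum /= /l2sq /s !mulr_sumr -big_split /=.
  apply: ler_sum => i _; rewrite rmorphM /= -(innerC g (f i)).
  apply: le_trans (ler_norm _) _; apply: le_trans (Re_rnorm _) _.
  rewrite rnormM rnorm_conj; set u := rnorm q`_i; set v := rnorm _.
  rewrite -subr_ge0 (_ : _ - _ = (2 * K ^+ 2)^-1 * (u - K ^+ 2 * v) ^+ 2).
    by rewrite mulr_ge0 ?sqr_ge0// invr_ge0 mulr_ge0// ltW.
  by field; rewrite gt_eqF.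
have h4 : (2 * K ^+ 2)^-1 * l2sq q <= y ^+ 2 / 2.
  rewrite mulrC ler_pdivrMr ?mulr_gt0//; apply: le_trans qK _.
  by rewrite le_eqVlt; apply/orP; left; apply/eqP; field.
(* Collecting, y^2 <= y^2 / 4 + y^2 / 2 + (K^2 / 2) s, and absorbing the first two terms gives the
   bound 1 / (2 K^2). *)
rewrite mulrC ler_pdivrMr ?mulr_gt0// -/y mulrC; lra.
Qed.

(** The frame algorithm: for p the first n coefficients <g, f_i>, the vector B^-1 lc e p solves S u
    = g up to a residual of squared norm at most (1 - A / B) |g|^2. Here n depends on g, so only
    finite sums occur, and [approx_onto] iterates. *)
Lemma frame_synthesis_onto (X : normedModType R[i]) (e : nat -> X) (f : nat -> H)
    (A B : R) (S : boundedOperator X H) : seq_complete X -> 0 < A -> 0 < B ->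
  (forall p, rnorm (lc e p) ^+ 2 = l2sq p) ->
  (forall p, S (lc e p) = lc f p) -> (forall p, rnorm (lc f p) ^+ 2 <= B * l2sq p) ->
  (forall g : H, exists n, A * rnorm g ^+ 2 <= \sum_(i < n) rnorm (inner g (f i)) ^+ 2) ->
  exists2 c : R, 0 < c & forall g, exists u, S u = g /\ rnorm u <= c * rnorm g.
Proof.
move=> cX A0 B0 eE SE fB lo.
have hi := analysis_bound B0 fB.
(* The maximum with 0 covers A > B, which can only happen on a trivial space. *)
pose q2 := Num.max 0 (1 - A / B); pose q := Num.sqrt q2.
have q20 : 0 <= q2 by rewrite le_max lexx.
have q21 : q2 < 1 by rewrite gt_max ltr01 ltrBlDr ltrDl divr_gt0.
have q01 : 0 <= q < 1 by rewrite sqrtr_ge0 -[ltRHS]sqrtr1 ltr_sqrt.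
pose c := Num.sqrt B^-1; have c0 : 0 < c by rewrite sqrtr_gt0 invr_gt0.
have BV : 0 < B^-1 by rewrite invr_gt0.
have [K K0 KP] := linear_rnorm_bound S.
exists (c / (1 - q)); first by rewrite divr_gt0// subr_gt0; case/andP: q01.
apply: (approx_onto cX (ltW c0) q01 KP) => g.
have [n nA] := lo g; pose p := \poly_(i < n) inner g (f i).
have sE : l2sq p = \sum_(i < n) rnorm (inner g (f i)) ^+ 2 by exact: l2sq_poly.
exists (B^-1%:C%C *: lc e p); split.
  rewrite rnormZr ?(ltW BV)// -(@ler_pXn2r _ 2) ?nnegrE ?mulr_ge0 ?rnorm_ge0 ?(ltW c0) ?(ltW BV)//.
  rewrite !exprMn eE /c sqr_sqrtr ?(ltW BV)// sE expr2 -mulrA ler_wpM2l ?(ltW BV)//.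
  by rewrite mulrC ler_pdivrMr// mulrC.
rewrite linearZ /= SE -(@ler_pXn2r _ 2) ?nnegrE ?mulr_ge0 ?rnorm_ge0 ?sqrtr_ge0//.
rewrite (frame_step f g n B^-1) -/p exprMn sqr_sqrtr//.
have h1 : B^-1 ^+ 2 * rnorm (lc f p) ^+ 2 <= B^-1 * l2sq p.
  rewrite expr2 -mulrA ler_wpM2l ?(ltW BV)// mulrC ler_pdivrMr// mulrC.
  exact: fB.
have h2 : A / B * rnorm g ^+ 2 <= B^-1 * l2sq p.
  by rewrite [A / B]mulrC -mulrA ler_wpM2l ?(ltW BV)// sE.
have h3 : (1 - A / B) * rnorm g ^+ 2 <= q2 * rnorm g ^+ 2.
  by rewrite ler_wpM2r ?sqr_ge0// le_max lexx orbT.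
by move: h3; rewrite mulrBl mul1r; lra.
Qed.

Hypothesis cH : seq_complete H.
Variables (T : boundedOperator H H) (f0 : H).
Hypothesis bT : bijective T.
Let f k := operator_orbit T f0 (int_enum k).

Local Notation E := (L2_circle (@measurableT _ C)).
Local Notation M := (mulcoord (@measurableT _ C)).
Local Notation ec := (echar (@measurableT _ C)).

Lemma frame_equinormed : (exists x : H, x != 0) -> frame (operator_orbit T f0) ->
  exists sigma : set C, [/\ measurable sigma, (0 < mu sigma)%E, equinormed f sigma &
    dense_range (lc f)].
Proof.
move=> [x0 x0_neq0] /frame_nat[A [B [A0 B0 AB]]].
have hi n g : \sum_(i < n) rnorm (inner g (f i)) ^+ 2 <= B * rnorm g ^+ 2 by exact: (AB g).1.
have fB := synthesis_bound B0 hi.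
pose b := Num.sqrt B; have b0 : 0 < b by rewrite sqrtr_gt0.
have [|S [SE Sb]] := @extend_dense _ _ E H (lc ec) (lc f) b (@echar_dense R _ measurableT) cH.
  move=> p; rewrite [X in _ <= _ * X]trig_normE -(@ler_pXn2r _ 2) ?nnegrE ?rnorm_ge0 ?mulr_ge0 ?trig_norm_ge0 ?(ltW b0)//.
  by rewrite exprMn trig_normT sqr_sqrtr ?(ltW B0)//; exact: fB.
have ecE p : rnorm (lc ec p) ^+ 2 = l2sq p by rewrite trig_normE trig_normT.
have [c c0 onto] := frame_synthesis_onto (@L2_circle_complete R _ measurableT) A0 B0 ecE SE fB
  (fun g => (AB g).2).
have df : dense_range (lc f).
  move=> g e e0; have [u [Su _]] := onto g.
  have [|p pP] := @echar_dense R _ measurableT u (e / b); first by rewrite divr_gt0.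
  exists p; rewrite -Su -SE -raddfB; apply: le_lt_trans (Sb _) _.
  move: pP; rewrite ltr_pdivlMr// mulrC; exact.
have Sec k : S (ec k) = f k by have := SE 'X^k; rewrite /= !lcXn.
have ST : forall u, S (M u) = T (S u).
  by apply: (intertwine_dense (mulcoord_bij _) bT (@echar_dense R _ measurableT)) => k; exact: Sec.
have Sorb u n : S (operator_orbit M u n) = operator_orbit T (S u) n.
  exact: orbit_intertwine (mulcoord_bij _) bT ST.
have [|||n Nn nP] := @projection _ E [set u | S u = 0] (one_L2 measurableT)
    (@L2_circle_complete R _ measurableT).
- exact: raddf0.
- by move=> k y z /= Sy Sz; rewrite linearP /= Sy Sz scaler0 addr0.
- move=> y yN; apply: rnorm_eps0 => e e0.
  have [|z [/= Sz yz]] := yN (e / b); first by rewrite divr_gt0.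
  rewrite -[S y]subr0 -Sz -raddfB; apply: le_trans (Sb _) _.
  by move: yz; rewrite ltr_pdivlMr// mulrC => /ltW.
pose fn : L2fun mu (@measurableT _ C) := repr n.
have nE : n = L2class fn by rewrite L2class_repr.
pose one : L2fun mu (@measurableT _ C) := MkL2fun (one_sqint (@measurableT _ C)).
(* [fn] represents the projection of 1 onto the kernel of S, and [f1] represents phi. *)
pose f1 := one - fn.
have f1E : one_L2 measurableT - n = L2class f1 by rewrite nE -raddfB.
have f1V z : f1 z = 1 - fn z by rewrite /f1 l2valB.
clearbody f1.
have orth (w : L2fun mu (@measurableT _ C)) : S (L2class w) = 0 ->
    {ae mu, forall z, setT z -> f1 z * (w z)^* = 0}.
  move=> Sw; apply: fourier_ae0 => k; rewrite -f1E; apply: nP => /=.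
  by rewrite Sorb Sw orbit_zero.
have idem : {ae mu, forall z, setT z -> f1 z * (fn z)^* = 0} by apply: orth; rewrite -nE.
(* The zero set of [fn]: there [f1] equals 1, and by [idem] it vanishes almost everywhere
   outside. *)
pose sigma : set C := (fun z => rnorm (fn z) ^+ 2) @^-1` [set 0].
have ms : measurable sigma.
  have [+ _] := L2funP fn; move=> /cmeasurable_rnorm2 => mf.
  by rewrite -[sigma]setTI; exact: mf.
have sigma_fn z : sigma z -> fn z = 0.
  by move=> /eqP; rewrite sqrf_eq0 => /eqP; exact: (@rnorm_eq0 _ R[i]^o).
have f1_sigma z : sigma z -> f1 z = 1 by move=> /sigma_fn; rewrite f1V => ->; rewrite subr0.
have f1_nsigma : {ae mu, forall z, ~ sigma z -> f1 z = 0}.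
  apply: filterS idem => z /(_ Logic.I)/eqP; rewrite mulf_eq0 => /orP[/eqP //|].
  rewrite conjC_eq0 => /eqP fz ns; exfalso; apply: ns.
  by rewrite /sigma /= fz (@rnorm0 _ R[i]^o) expr0n.
(* [fn = 1 - f1] lies in the kernel of [S], hence so does [p * fn]. *)
have Sphi p : S (L2class (MkL2fun (trigM_sqint p f1))) = lc f p.
  have Sn : S (L2class (MkL2fun (trigM_sqint p fn))) = 0.
    rewrite -(@lc_orbitE R _ measurableT fn (MkL2fun (trigM_sqint p fn)) p (fun=> erefl)); rewrite [LHS](linear_lc S).
    rewrite (@eq_lc _ _ _ (fun=> 0)); first by rewrite /lc big1// => i _; rewrite scaler0.
    by move=> k /=; rewrite Sorb -nE Nn orbit_zero.
  have oneE : l2val (MkL2fun (trigM_sqint p one)) = trigval p.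
    by apply/funext => z /=; rewrite mulr1.
  have Se : S (L2class (MkL2fun (trigM_sqint p one))) = lc f p.
    by rewrite -(@lc_echarE R _ measurableT p _ oneE); exact: SE.
  rewrite -Se -[LHS]addr0 -Sn -raddfD -raddfD; congr (S (L2class _)).
  apply: L2fun_ext => z; rewrite l2valD.
  by rewrite -[LHS]/(trigval p z * f1 z + trigval p z * fn z) f1V -mulrDr subrK.
have Nphi p : rnorm (L2class (MkL2fun (trigM_sqint p f1)) : E) = trig_norm sigma p.
  apply/eqP; rewrite -(@eqrXn2 _ 2) ?rnorm_ge0 ?trig_norm_ge0//; apply/eqP.
  apply: EFin_inj; rewrite -(trig_norm_sq p ms) -rnorm_L2class /= [RHS]integral_mkcond.
  apply: ae_eq_integral => //.
  - have [+ _] := L2funP (MkL2fun (trigM_sqint p f1)); move=> /cmeasurable_rnorm2 h.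
    exact/measurable_EFinP.
  - by apply/(measurable_restrictT _ _).1 => //; exact: rnorm_trig_measurable.
  apply: filterS f1_nsigma => z fz _; rewrite patchE; case: ifPn => zs.
    by rewrite f1_sigma ?mulr1//; rewrite inE in zs.
  rewrite notin_setE in zs; rewrite fz// mulr0 (@rnorm0 _ R[i]^o) expr0n.
  by [].
(* A preimage u of [lc f p] with |u| <= c |lc f p| differs from the trigonometric polynomial p by an
   element of the kernel, which [orth] shows to vanish almost everywhere on sigma. So p = u there,
   and its norm in L^2(sigma) is at most |u|. *)
have low p : c^-1 * trig_norm sigma p <= rnorm (lc f p).
  have [u [Su uc]] := onto (lc f p).
  pose w := MkL2fun (trigM_sqint p one) - repr u.
  have wE : L2class w = lc ec p - u.
    rewrite raddfB /= L2class_repr; congr (_ - u); apply/esym/lc_echarE.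
    by apply/funext => z /=; rewrite mulr1.
  have w0 : {ae mu, forall z, setT z -> f1 z * (w z)^* = 0}.
    by apply: orth; rewrite wE raddfB /= SE Su subrr.
  have pu : trig_norm sigma p <= rnorm u.
    rewrite -(@ler_pXn2r _ 2) ?nnegrE ?rnorm_ge0 ?trig_norm_ge0// -lee_fin.
    rewrite -(trig_norm_sq p ms) -[u]L2class_repr -rnorm_L2class.
    have mu2 : measurable_fun setT (fun z => (rnorm (repr u z) ^+ 2)%:E).
      by have [+ _] := L2funP (repr u); move=> /cmeasurable_rnorm2 h; exact/measurable_EFinP.
    apply: (@le_trans _ _ (\int[mu]_(z in sigma) (rnorm (repr u z) ^+ 2)%:E)%E); last first.
      by apply: ge0_subset_integral => // z _; rewrite lee_fin sqr_ge0.
    rewrite le_eqVlt; apply/orP; left; apply/eqP; apply: ae_eq_integral => //.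
    - exact: rnorm_trig_measurable.
    - exact: measurable_funS mu2.
    apply: filterS w0 => z /(_ Logic.I) wz sz; move: wz; rewrite f1_sigma// mul1r => /eqP.
    rewrite conjC_eq0 /w l2valB /= mulr1 subr_eq0 => /eqP ->.
    by [].
  have aux (x y v : R) : x <= y -> y <= c * v -> c^-1 * x <= v.
    by move=> xy yv; rewrite mulrC ler_pdivrMr// mulrC; exact: le_trans yv.
  exact: aux pu uc.
have eq_f : equinormed f sigma.
  exists c^-1, b; split; rewrite ?invr_gt0// => p; rewrite low /= -Nphi -{1}Sphi.
  exact: Sb.
(* Were sigma null, all the norms in L^2(sigma) would vanish, hence every [lc f p], and density
   would leave only the zero vector in H. *)
exists sigma; split=> //; rewrite lt_neqAle measure_ge0 andbT; apply/eqP => s0.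
have trig0 p : trig_norm sigma p = 0.
  apply/eqP; rewrite -sqrf_eq0; apply/eqP; apply: EFin_inj; rewrite -(trig_norm_sq p ms).
  by apply: null_set_integral => //; exact: rnorm_trig_measurable.
suff : x0 = 0 by move/eqP; rewrite (negbTE x0_neq0).
apply: rnorm_eps0 => e e0; have [p pP] := df x0 e e0; apply/ltW.
have [a' [b' [_ _ ab']]] := eq_f; have /andP[_ h] := ab' p; rewrite trig0 mulr0 in h.
have fp0 : lc f p = 0 by apply: rnorm_eq0; apply/eqP; rewrite eq_le h rnorm_ge0.
by move: pP; rewrite fp0 subr0.
Qed.

Lemma trig_norm_full (sigma : set C) p : measurable sigma -> arc_eq sigma setT ->
  trig_norm sigma p = trig_norm setT p.
Proof.
move=> ms s0; apply/eqP; rewrite -(@eqrXn2 _ 2) ?trig_norm_ge0//; apply/eqP.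
apply: EFin_inj; rewrite -!trig_norm_sq//.
rewrite [RHS](@ge0_negligible_integral _ _ _ mu setT (~` sigma))//.
- by rewrite setTD setCK.
- exact: measurableC.
- exact: rnorm_trig_measurable.
- by move=> z _; rewrite lee_fin sqr_ge0.
- by rewrite -[RHS]s0; congr (mu _); rewrite /setY setDT set0U setTD.
Qed.

(** By Parseval's identity, the Riesz bounds say that f is equinormed with the full circle, so
    [equinormed_unique] compares the two sets. Conversely, the norms over sigma and over a full set
    coincide. *)
Lemma riesz_equinormed (sigma : set C) : measurable sigma ->
  equinormed f sigma -> dense_range (lc f) ->
  riesz_basis (operator_orbit T f0) <-> arc_eq sigma setT.
Proof.
move=> ms es df; split=> [rb|sT].
  have [a [b [a0 b0 ab]]] := riesz_basis_bounds cH rb.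
  apply: (equinormed_unique ms measurableT es).
  exists (Num.sqrt a), (Num.sqrt b); split; rewrite ?sqrtr_gt0// => p.
  have := ab p; rewrite -trig_normT -[X in X * _ <= _ <= _](@sqr_sqrtr _ a) ?(ltW a0)//.
  rewrite -[X in _ <= _ <= X * _](@sqr_sqrtr _ b) ?(ltW b0)// -!exprMn.
  by rewrite !ler_pXn2r ?nnegrE ?mulr_ge0 ?rnorm_ge0 ?trig_norm_ge0 ?sqrtr_ge0.
have [a [b [a0 b0 ab]]] := es.
apply: (@bounds_riesz_basis _ _ _ cH (a ^+ 2) (b ^+ 2)); rewrite ?exprn_gt0// => p.
have := ab p; rewrite (trig_norm_full p ms sT) -trig_normT -!exprMn => /andP[h1 h2].
by rewrite !ler_pXn2r ?nnegrE ?mulr_ge0 ?rnorm_ge0 ?trig_norm_ge0 ?(ltW a0) ?(ltW b0)// h1 h2.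
Qed.

End frame_equinormed.

Theorem theorem4p8 (R : realType) (H : hilbertType R)
    (T : boundedOperator H H) (f0 : H) :
  separable H -> infinite_dimensional H -> bijective T ->
  (frame (operator_orbit T f0) <->
     exists sigma : set (borel_circle R), multiplication_model T f0 sigma) /\
  (frame (operator_orbit T f0) ->
     (forall sigma tau : set (borel_circle R),
        multiplication_model T f0 sigma -> multiplication_model T f0 tau ->
        arc_eq sigma tau) /\
     (forall sigma : set (borel_circle R),
        multiplication_model T f0 sigma ->
        (riesz_basis (operator_orbit T f0) <-> arc_eq sigma setT))).
Proof.
move=> _ infH bT; have cH := @seq_complete_complete R H.
(* If every vector were 0, the empty set would span H. *)
have nontriv : exists x : H, x != 0.
  apply: contrapT => /forallNP H0; apply: (infH set0) => //.
  apply/seteqP; split=> // x _; exists 0%N, (fun=> 0), (fun=> 0); split=> [[]//|].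
  by rewrite big_ord0; apply/eqP/negPn/negP; exact: H0.
split.
  split=> [/(frame_equinormed cH bT nontriv)[sigma [ms s0 es df]]|[sigma ms]].
    by exists sigma; exact: equinormed_model s0 es df.
  have [msigma [es df]] := model_equinormed cH bT ms.
  have [A [B [A0 B0 AB]]] := equinormed_frame_bounds msigma es df.
  exact: (nat_frame A0 B0 AB).
move=> _; split=> [sigma tau|sigma] /(model_equinormed cH bT)[ms [es df]].
  move=> /(model_equinormed cH bT)[mt [et _]].
  exact: equinormed_unique ms mt es et.
exact: riesz_equinormed ms es df.
Qed.
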